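(* Let $d\ge 2$ and $0<a<b$. Let $(t(v), v\in\mathbb{Z}^d)$ be a family of random variables taking values in $[a,b]$ which has a representation satisfying conditions (i), (ii) and (iii) defined in the context. Let $T(0,v)$ denote the (site version) passage time from $0$ to $v$. Then there is a constant $C>0$ such that for all $v\in\mathbb{Z}^d$ with $|v|\ge 2$, $$\operatorname{Var}(T(0,v))\le \frac{C\,|v|}{\log|v|}.$$ The analogous result for the bond version also holds: if $(t(e), e\in E)$ is a family of $[a,b]$-valued random variables indexed by the edges of $\mathbb{Z}^d$ which has a representation satisfying the edge analogs of conditions (i), (ii), (iii), then the same conclusion holds for the bond-version passage times.
   Context: For $v=(v_1,\dots,v_d)\in\mathbb{Z}^d$ put $|v|=\sum_{i=1}^d|v_i|$. $\mathbb{Z}^d$ is regarded as the cubic lattice graph (vertices at $|\cdot|$-distance $1$ are joined by an edge) and $E$ is its edge set. A path from $v$ to $w$ is a finite alternating sequence $v_0=v,e_1,v_1,\dots,e_n,v_n=w$ with $e_i$ an edge between $v_{i-1}$ and $v_i$. Passage times. Site version: given nonnegative values $t(v)$, $v\in\mathbb{Z}^d$, the passage time of a path $\pi$ is $T(\pi)=\sum_{v\in\pi}t(v)$ (sum over the vertices of $\pi$). Bond version: given nonnegative values $t(e)$, $e\in E$, $T(\pi)=\sum_{e\in\pi}t(e)$ (sum over the edges of $\pi$). In both cases $T(v,w)=\inf_{\pi:v\to w}T(\pi)$, the infimum over all paths $\pi$ from $v$ to $w$. Representation. Let $S$ be a finite set and $I$ a countably infinite set. For a finite $W\subset I$ and $x\in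 S^I$ write $x_W=(x_i,i\in W)$. For a function $h:S^I\to\mathbb{R}$ and $y\in S^W$, say that $y$ determines the value of $h$ if $h(x)=h(x')$ for all $x,x'\in S^I$ with $x_W=x'_W=y$. Let $X_i$, $i\in I$, be i.i.d. $S$-valued random variables. The random variables $t(v)$, $v\in\mathbb{Z}^d$, are represented by $(X_i,i\in I)$ if each $t(v)$ is a (measurable) function of $(X_i,i\in I)$. The family $(t(v),v\in\mathbb{Z}^d)$ has a representation satisfying (i), (ii), (iii) if there are such $S$, $I$, $(X_i)_{i\in I}$ representing it with: (i) There exist $c_0>0$ and $\varepsilon_0>0$ such that for each $v\in\mathbb{Z}^d$ there is a sequence $i_1(v),i_2(v),\dots$ of elements of $I$ such that for all $k=1,2,\dots$, $$P\big((X_{i_1(v)},\dots,X_{i_k(v)})\text{ does not determine }t(v)\big)\le \frac{c_0}{k^{3d+\varepsilon_0}}.$$ (ii) For the sequences in (i): there exists $\alpha>0$ such that for all $v,w\in\mathbb{Z}^d$ and all positive integers $k<\alpha|v-w|$, $$\{i_1(v),\dots,i_k(v)\}\cap\{i_1(w),\dots,i_k(w)\}=\varnothing.$$ (iii) The distribution of the family $(t(v),v\in\mathbb{Z}^d)$ is invariant under translations of $\mathbb{Z}^d$. The edge analogs of (i)–(iii) are obtained by replacing vertices $v,w$ by edges $e,f\in E$ throughout, with $|v-w|$ in (ii) replaced by the distance between $e$ and $f$, i.e. the minimum of $|x-y|$ over endpoints $x$ of $e$ and $y$ of $f$. *)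

(* Defs.v *)
From HB Require Import structures.
From mathcomp Require Import all_boot all_order all_algebra finmap.
From mathcomp Require Import all_classical all_reals all_analysis.

Set Implicit Arguments.
Unset Strict Implicit.
Unset Printing Implicit Defensive.

Import Order.TTheory GRing.Theory Num.Theory.

Local Open Scope classical_set_scope.
Local Open Scope ring_scope.

Section Lattice.
Variable d : nat.

Definition l1norm (v : 'rV[int]_d) : nat := (\sum_(i < d) `|v 0%R i|)%N.

(* The pair (x, i) stands for the undirected edge {x, x + u_i}, where u_i is   *)
(* the i-th unit vector; joins_exists_unique below shows that every pair of    *)
(* neighbours is joined by exactly one such edge.                              *)
Definition edge : Type := ('rV[int]_d * 'I_d)%type.
Definition edge_src (e : edge) : 'rV[int]_d := e.1.
Definition edge_tgt (e : edge) : 'rV[int]_d := e.1 + delta_mx 0 e.2.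

Definition joins (e : edge) (x y : 'rV[int]_d) : bool :=
  ((edge_src e == x) && (edge_tgt e == y))
  || ((edge_src e == y) && (edge_tgt e == x)).

Definition site_dist (v w : 'rV[int]_d) : nat := l1norm (v - w).

Definition edge_dist (e f : edge) : nat :=
  minn (minn (site_dist (edge_src e) (edge_src f))
             (site_dist (edge_src e) (edge_tgt f)))
       (minn (site_dist (edge_tgt e) (edge_src f))
             (site_dist (edge_tgt e) (edge_tgt f))).

Definition site_shift (z v : 'rV[int]_d) : 'rV[int]_d := v + z.
Definition edge_shift (z : 'rV[int]_d) (e : edge) : edge := (e.1 + z, e.2).

(* The path v, e_1, v_1, ..., e_n, v_n is given by its starting point v and    *)
(* the sequence of steps p = [:: (e_1, v_1); ...; (e_n, v_n)].                 *)
Fixpoint is_path (v w : 'rV[int]_d) (p : seq (edge * 'rV[int]_d)) : bool :=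
  if p is (e, u) :: p' then joins e v u && is_path u w p' else v == w.

Definition path_sites (v : 'rV[int]_d) (p : seq (edge * 'rV[int]_d)) :
  seq 'rV[int]_d := v :: [seq s.2 | s <- p].
Definition path_edges (p : seq (edge * 'rV[int]_d)) : seq edge :=
  [seq s.1 | s <- p].

Definition site_passage_time (R : realType) (t : 'rV[int]_d -> R)
    (v w : 'rV[int]_d) : R :=
  inf [set \sum_(u <- path_sites v p) t u | p in [set p | is_path v w p]].

Definition bond_passage_time (R : realType) (t : edge -> R)
    (v w : 'rV[int]_d) : R :=
  inf [set \sum_(e <- path_edges p) t e | p in [set p | is_path v w p]].

Lemma l1normN (v : 'rV[int]_d) : l1norm (- v) = l1norm v.
Proof. by apply: eq_bigr => i _; rewrite mxE abszN. Qed.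

Lemma l1norm_eq1P (v : 'rV[int]_d) : l1norm v = 1%N <->
  exists i : 'I_d, v = delta_mx 0 i \/ v = - delta_mx 0 i.
Proof.
split=> [v1|[i vi]]; last first.
  have ->: l1norm v = l1norm (delta_mx 0 i).
    by case: vi => ->; rewrite ?l1normN.
  rewrite /l1norm (bigD1 i)//= !mxE !eqxx/= big1// => j /negPf ji.
  by rewrite mxE ji andbF.
have [i vi0] : exists i, v 0 i != 0.
  apply/existsP; rewrite -negb_forall; apply/negP => /forallP v0.
  by move: v1; rewrite /l1norm big1// => i _; rewrite (eqP (v0 i)).
move: (v1); rewrite /l1norm (bigD1 i)//=.
have : (0 < `|v 0%R i|)%N by rewrite absz_gt0.
case E: `|v 0%R i|%N => [//|[|n]] _; last by rewrite !addSn.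
rewrite add1n => -[/eqP]; rewrite sum_nat_eq0 => /forallP vj0.
have vj j : j != i -> v 0 j = 0.
  by move=> ji; have := vj0 j; rewrite ji/= absz_eq0 => /eqP.
exists i; have [vi|vi] : v 0 i = 1 \/ v 0 i = -1.
- by case: (v 0 i) E => [m /= ->|m /= [->]]; [left|right].
- left; apply/rowP => j; rewrite !mxE eqxx/=.
  by have [->|/vj] := eqVneq j i.
- right; apply/rowP => j; rewrite !mxE eqxx/=.
  by have [->|/vj ->] := eqVneq j i; rewrite ?oppr0.
Qed.

Lemma joins_exists_unique (x y : 'rV[int]_d) :
  site_dist x y = 1%N <-> exists! e : edge, joins e x y.
Proof.
have delta_inj (i j : 'I_d) :
    delta_mx 0 i = delta_mx 0 j :> 'rV[int]_d -> i = j.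
  move=> /rowP /(_ i); rewrite !mxE !eqxx/=.
  by case: eqP.
have delta_pos (i j : 'I_d) :
    delta_mx 0 i + delta_mx 0 j <> 0 :> 'rV[int]_d.
  move=> /rowP /(_ i); rewrite !mxE !eqxx/=.
  by case: eqP.
rewrite /site_dist l1norm_eq1P; split.
- case=> i [xy|xy].
  + have Ex : x = y + delta_mx 0 i by rewrite -xy addrC subrK.
    exists (y, i); split.
      by rewrite /joins /edge_src /edge_tgt/= -Ex !eqxx orbT.
    move=> [z j]; rewrite /joins /edge_src /edge_tgt/= Ex.
    case/orP => /andP[/eqP -> /eqP].
      rewrite -addrA -[RHS]addr0 => /addrI /delta_pos //.
    by move=> /addrI /delta_inj ->.
  + have Ey : y = x + delta_mx 0 i.
      by rewrite -[delta_mx 0 i]opprK -xy opprB addrC subrK.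
    exists (x, i); split.
      by rewrite /joins /edge_src /edge_tgt/= -Ey !eqxx.
    move=> [z j]; rewrite /joins /edge_src /edge_tgt/= Ey.
    case/orP => /andP[/eqP -> /eqP].
      by move=> /addrI /delta_inj ->.
    rewrite -addrA -[RHS]addr0 => /addrI /delta_pos //.
- case=> -[z j] [+ _]; rewrite /joins /edge_src /edge_tgt/=.
  case/orP => /andP[/eqP -> /eqP <-]; exists j.
  + by right; rewrite opprD addrA subrr add0r.
  + by left; rewrite addrC addKr.
Qed.

End Lattice.

Section Representation.

Definition product_salgebra (J T : Type) (G : set (set T)) :
    set (set (J -> T)) :=
  <<s \bigcup_j preimage_set_system setT (fun x : J -> T => x j) G >>.

Definition restr (S : finType) (I : choiceType) (W : {fset I}) (x : I -> S) :
  {ffun W -> S} := [ffun i => x (val i)].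

Definition determines (S : finType) (I : choiceType) (R : Type)
    (W : {fset I}) (y : {ffun W -> S}) (h : (I -> S) -> R) : Prop :=
  forall x x' : I -> S, restr W x = y -> restr W x' = y -> h x = h x'.

(* i_1, ..., i_k; the value of the sequence at 0 is not used.                  *)
Definition first_indices (I : choiceType) (i : nat -> I) (k : nat) : {fset I} :=
  [fset i j | j in iota 1 k]%fset.

Context {disp : measure_display} {Omega : measurableType disp} {R : realType}.
Variable P : probability Omega R.

Definition mutually_independent (I : choiceType) (S : Type)
    (X : I -> Omega -> S) : Prop :=
  forall (W : {fset I}) (B : I -> set S),
    P (\bigcap_(i in [set` W]) (X i @^-1` B i)) =
    (\prod_(i <- W) P (X i @^-1` B i))%E.

(* S carries the discrete sigma-algebra. *)
Definition iid (I : choiceType) (S : Type) (X : I -> Omega -> S) : Prop :=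
  [/\ forall (i : I) (B : set S), measurable (X i @^-1` B),
      forall (i j : I) (B : set S), P (X i @^-1` B) = P (X j @^-1` B)
    & mutually_independent X].

Definition represents (J : Type) (I : choiceType) (S : Type)
    (X : I -> Omega -> S) (h : J -> (I -> S) -> R) (t : J -> Omega -> R) :
    Prop :=
  (forall (v : J) (B : set R), measurable B ->
     product_salgebra discrete_measurable (h v @^-1` B)) /\
  (forall (v : J) (w : Omega), t v w = h v (X ^~ w)).

Definition determination_bound (d : nat) (J : Type) (I : choiceType)
    (S : finType) (X : I -> Omega -> S) (h : J -> (I -> S) -> R)
    (i : J -> nat -> I) : Prop :=
  exists c0 eps0 : R, [/\ 0 < c0, 0 < eps0 &
    forall (v : J) (k : nat), (0 < k)%N ->
      (P [set w | ~ determines (restr (first_indices (i v) k) (X ^~ w)) (h v)]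
       <= (c0 / k%:R `^ ((3 * d)%:R + eps0))%:E)%E].

Definition separated_indices (J : Type) (dist : J -> J -> nat)
    (I : choiceType) (i : J -> nat -> I) : Prop :=
  exists alpha : R, 0 < alpha /\
    forall (v w : J) (k : nat), (0 < k)%N -> k%:R < alpha * (dist v w)%:R ->
      [disjoint first_indices (i v) k & first_indices (i w) k]%fset.

Definition translation_invariant (d : nat) (J : Type)
    (shift : 'rV[int]_d -> J -> J) (t : J -> Omega -> R) : Prop :=
  forall (z : 'rV[int]_d) (A : set (J -> R)), product_salgebra measurable A ->
    P [set w | A (fun v => t (shift z v) w)] = P [set w | A (t ^~ w)].

(* J is the index set of the family (sites or edges), with its distance and    *)
(* the action of the translations.                                             *)
Definition has_representation (d : nat) (J : Type) (dist : J -> J -> nat)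
    (shift : 'rV[int]_d -> J -> J) (t : J -> Omega -> R) : Prop :=
  (exists (S : finType) (I : countType) (X : I -> Omega -> S)
          (h : J -> (I -> S) -> R) (i : J -> nat -> I),
     [/\ infinite_set [set: I], iid X, represents X h t,
         determination_bound d X h i & separated_indices dist i]) /\
  translation_invariant shift t.

End Representation.

(* Main.v *)
Require Import Defs.
From HB Require Import structures.
From mathcomp Require Import all_boot all_order all_algebra finmap.
From mathcomp Require Import all_classical all_reals all_analysis.
From mathcomp Require Import measurable_realfun.
From mathcomp Require Import ring lra zify.

Set Implicit Arguments.
Unset Strict Implicit.
Unset Printing Implicit Defensive.

Import Order.TTheory GRing.Theory Num.Theory.

Local Open Scope classical_set_scope.
Local Open Scope ring_scope.

(** The proof combines the averaging idea of Benjamini, Kalai and Schramm with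
    the entropy inequality of Falik and Samorodnitsky. Write [n] for the norm of
    the endpoint [x] and [T z] for the passage time from [z] to [x + z].

    Moving both endpoints by [z] changes the passage time by at most a multiple of
    the norm of [z] ([shifted_passage_time_lip]). Hence [T 0] may be replaced by
    the average [F] of the [T z] over a box of radius [M ^ 3], where [M] is about
    the twelfth root of [n]; this costs a term of order [M ^ 6], at most the square
    root of [n]. On a finite product space [falik_samorodnitsky] gives
    [Var F * ln (Var F / B) <= C * E2], where [E2] is the sum over the variables of
    the squared L2 influences on [F], and [B] bounds the sum of the squared L1
    influences. It remains to see that [E2] is of order [n] and that [B] is of order
    [n / M]: as [ln (M + 1)] is comparable to [ln n], this yields
    the bound ([variance_of_log]).

    A variable influences [F] only through sites or edges (below: carriers) of a
    geodesic whose passage time it can change. Let the radius of a carrier be the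
    number of variables that have to be inspected before its passage time is known.
    Carriers influenced by a common variable are at distance at most of the order of the
    larger of their radii, and as the passage times lie in [[a, b]] a geodesic has
    only of the order of [r] carriers within distance [r] of a point
    ([geodesic_near]). So the sum of the squared influences is at most of the order
    of the sum of the squared radii along the geodesic ([sum_sqr_influenced]). The
    geodesic depends on all variables and might prefer carriers with a large radius.
    This is controlled by a first moment computation for all chains of
    pairwise distant carriers: carriers farther apart than a multiple of [k]
    have independent events of radius larger than [k], and if these have probability
    [rho ^ d], then a path of length [l] meets in mean at most of the order of
    [rho * l] of them ([mean_chain_size]). With [rho] of order [k ^ - (3 + eps)] the
    sum over [k] converges, and [E2] is of order [n]
    ([mean_sum_sqr_influenced], [averaged_L2]).

    For [B] it is enough that every single variable has L1 influence of order
    [1 / M] on [F], because the L1 influences have a sum of order [n]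
    ([averaged_L1]). By translation invariance the probability that a given carrier
    lies on the geodesic from [z], averaged over [z] in the box, is the mean
    fraction of the box that is visited by one geodesic, which is of order [1 / M ^ 3]
    since the dimension is at least two ([box_visits]). Interpolating between this
    and the rarity of large radii gives [influence_bound_small].

    The passage time involves infinitely many variables. For a fixed endpoint only
    finitely many carriers matter, and outside an event of arbitrarily small
    probability their passage times are functions of the first [K] variables
    ([truncated], [truncated_exact]), which live on a finite product space. There
    translation invariance survives up to a small error ([geo_near_law]). *)

(** * Finite product probability spaces *)

Section ProductSpace.
Variables (R : realType) (W S : finType) (q : S -> R).
Hypothesis q_ge0 : forall s, 0 <= q s.
Hypothesis q_sum1 : \sum_s q s = 1.

Local Notation Om := {ffun W -> S}.
Implicit Types (f g h : Om -> R) (x y : Om) (i j : W) (L : seq W).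

Definition weight x : R := \prod_i q (x i).
Definition Ex f : R := \sum_x weight x * f x.
Definition upd i s x : Om := [ffun j => if j == i then s else x j].
(** The conditional expectation given all coordinates except [i]. *)
Definition avg i f x : R := \sum_s q s * f (upd i s x).
Definition avgs L f : Om -> R := foldr avg f L.
Definition indep i f := forall s x, f (upd i s x) = f x.
Definition depends (A : pred W) f :=
  forall x y, (forall i, A i -> x i = y i) -> f x = f y.

Lemma weight_ge0 x : 0 <= weight x.
Proof. exact: prodr_ge0. Qed.

Lemma weight_gt0 x i : 0 < weight x -> 0 < q (x i).
Proof.
rewrite /weight (bigD1 i)//= => h.
have := q_ge0 (x i); rewrite le_eqVlt => /orP[/eqP e|//].
by move: h; rewrite -e mul0r ltxx.
Qed.

Lemma updE i s x : upd i s x i = s.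
Proof. by rewrite ffunE eqxx. Qed.

Lemma upd_upd i s s' x : upd i s (upd i s' x) = upd i s x.
Proof. by apply/ffunP => j; rewrite !ffunE; case: eqP. Qed.

Lemma upd_id i x : upd i (x i) x = x.
Proof. by apply/ffunP => j; rewrite !ffunE; case: eqP => [->|]. Qed.

Lemma upd_comm i j s s' x : i != j ->
  upd i s (upd j s' x) = upd j s' (upd i s x).
Proof.
move=> /eqP ij; apply/ffunP => k; rewrite !ffunE.
by case: eqP => [->|//]; case: eqP.
Qed.

Lemma weight_upd i s x : weight x * q s = weight (upd i s x) * q (x i).
Proof.
rewrite /weight (bigD1 i)//= [in RHS](bigD1 i)//= updE.
rewrite [in RHS](eq_bigr (fun j => q (x j))).
  by rewrite mulrAC [RHS]mulrAC [q s * _]mulrC.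
by move=> j /negPf ji; rewrite ffunE ji.
Qed.

(** Resampling one coordinate is a reversible move: exchanging the old and the
    new value of the coordinate preserves the joint law of the pair. *)
Lemma resample_exchange i (F : Om -> Om -> R) :
  \sum_x weight x * (\sum_s q s * F x (upd i s x)) =
  \sum_x weight x * (\sum_s q s * F (upd i s x) x).
Proof.
have E (G : Om -> Om -> R) : \sum_x weight x * (\sum_s q s * G x (upd i s x)) =
    \sum_(u : Om * S) weight u.1 * q u.2 * G u.1 (upd i u.2 u.1).
  rewrite -(pair_bigA _ (fun x s => weight x * q s * G x (upd i s x)))/=.
  apply: eq_bigr => x _; rewrite mulr_sumr; apply: eq_bigr => s _.
  by rewrite mulrA.
rewrite (E F) (E (fun x y => F y x)).
pose k (u : Om * S) := (upd i u.2 u.1, u.1 i).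
have kK : involutive k.
  by move=> [x s]; rewrite /k/= updE upd_upd upd_id.
rewrite (reindex_inj (inv_inj kK))/=.
apply: eq_bigr => -[x s] _ /=.
by rewrite upd_upd upd_id -weight_upd.
Qed.

Lemma Ex_avg i f : Ex (avg i f) = Ex f.
Proof.
rewrite /Ex /avg (resample_exchange i (fun _ y => f y)).
by apply: eq_bigr => x _; rewrite -mulr_suml q_sum1 mul1r.
Qed.

Lemma ExD f g : Ex (fun x => f x + g x) = Ex f + Ex g.
Proof. by rewrite /Ex -big_split; apply: eq_bigr => x _; rewrite /= mulrDr. Qed.

Lemma ExZ c f : Ex (fun x => c * f x) = c * Ex f.
Proof. by rewrite /Ex mulr_sumr; apply: eq_bigr => x _; ring. Qed.

Lemma ExB f g : Ex (fun x => f x - g x) = Ex f - Ex g.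
Proof. by rewrite /Ex -sumrB; apply: eq_bigr => x _; rewrite mulrBr. Qed.

Lemma Ex_sum (T : Type) (r : seq T) (P : pred T) (F : T -> Om -> R) :
  Ex (fun x => \sum_(t <- r | P t) F t x) = \sum_(t <- r | P t) Ex (F t).
Proof.
rewrite /Ex exchange_big/=; apply: eq_bigr => x _.
by rewrite mulr_sumr.
Qed.

(** The logarithmic estimates below may fail at configurations of weight zero. *)
Lemma ler_Ex_pos f g : (forall x, 0 < weight x -> f x <= g x) -> Ex f <= Ex g.
Proof.
move=> fg; apply: ler_sum => x _.
have := weight_ge0 x; rewrite le_eqVlt => /orP[/eqP <-|w0].
  by rewrite !mul0r.
by rewrite ler_wpM2l ?fg// ltW.
Qed.

Lemma ler_Ex f g : (forall x, f x <= g x) -> Ex f <= Ex g.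
Proof. by move=> fg; apply: ler_Ex_pos. Qed.

Lemma Ex_ge0 f : (forall x, 0 <= f x) -> 0 <= Ex f.
Proof. by move=> f0; apply: sumr_ge0 => x _; rewrite mulr_ge0// weight_ge0. Qed.

Lemma eq_Ex f g : f =1 g -> Ex f = Ex g.
Proof. by move=> fg; apply: eq_bigr => x _; rewrite fg. Qed.

Lemma weight_sum1 : \sum_x weight x = 1.
Proof.
rewrite /weight -(bigA_distr_bigA (fun (_ : W) s => q s))/=.
by rewrite big1.
Qed.

Lemma Ex_cst c : Ex (fun=> c) = c.
Proof. by rewrite /Ex -mulr_suml weight_sum1 mul1r. Qed.

Lemma avgD i f g x : avg i (fun x => f x + g x) x = avg i f x + avg i g x.
Proof. by rewrite /avg -big_split; apply: eq_bigr => s _; rewrite /= mulrDr. Qed.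

Lemma avgB i f g x : avg i (fun x => f x - g x) x = avg i f x - avg i g x.
Proof. by rewrite /avg -sumrB; apply: eq_bigr => s _; rewrite mulrBr. Qed.

Lemma avgZ i c f x : avg i (fun x => c * f x) x = c * avg i f x.
Proof. by rewrite /avg mulr_sumr; apply: eq_bigr => s _; ring. Qed.

Lemma avg_ge0 i f x : (forall x, 0 <= f x) -> 0 <= avg i f x.
Proof. by move=> f0; apply: sumr_ge0 => s _; rewrite mulr_ge0. Qed.

Lemma avg_indep i f : indep i (avg i f).
Proof. by move=> s x; apply: eq_bigr => s' _; rewrite upd_upd. Qed.

Lemma avg_pull i g f x : indep i g ->
  avg i (fun x => g x * f x) x = g x * avg i f x.
Proof.
by move=> ig; rewrite /avg mulr_sumr; apply: eq_bigr => s _; rewrite ig; ring.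
Qed.

Lemma avg_id i f : indep i f -> avg i f = f.
Proof.
move=> fi; apply/funext => x; rewrite /avg.
under eq_bigr do rewrite fi.
by rewrite -mulr_suml q_sum1 mul1r.
Qed.

Lemma avg_comm i j f : avg i (avg j f) = avg j (avg i f).
Proof.
have [->//|ij] := eqVneq i j.
apply/funext => x; rewrite /avg.
under eq_bigr do rewrite mulr_sumr.
rewrite exchange_big; apply: eq_bigr => s _.
rewrite mulr_sumr; apply: eq_bigr => s' _.
by rewrite (upd_comm _ _ _ ij); ring.
Qed.

Lemma indep_avg i j f : indep j f -> indep j (avg i f).
Proof.
have [-> _|ij jf s x] := eqVneq i j; first exact: avg_indep.
by apply: eq_bigr => s' _; rewrite (upd_comm _ _ _ ij) jf.
Qed.

Lemma indep_avgs L j f : indep j f -> indep j (avgs L f).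
Proof. by elim: L => //= i L IH /IH; exact: indep_avg. Qed.

Lemma avgs_indep L j f : j \in L -> indep j (avgs L f).
Proof.
elim: L => //= i L IH; rewrite in_cons => /orP[/eqP ->|/IH].
  exact: avg_indep.
exact: indep_avg.
Qed.

Lemma avgs_avg L i f : avgs L (avg i f) = avg i (avgs L f).
Proof. by elim: L => //= j L ->; rewrite avg_comm. Qed.

Lemma Ex_avgs L f : Ex (avgs L f) = Ex f.
Proof. by elim: L => //= i L IH; rewrite Ex_avg. Qed.

Lemma avgsB L f g :
  avgs L (fun x => f x - g x) = (fun x => avgs L f x - avgs L g x).
Proof.
by elim: L => //= i L ->; apply/funext => x; rewrite avgB.
Qed.

Lemma avgs_pull L g f : (forall i, i \in L -> indep i g) ->
  avgs L (fun x => g x * f x) = (fun x => g x * avgs L f x).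
Proof.
elim: L => //= i L IH gi; rewrite IH; last first.
  by move=> j jL; apply: gi; rewrite in_cons jL orbT.
by apply/funext => x; rewrite avg_pull//; apply: gi; rewrite mem_head.
Qed.

Lemma avgs_ge0 L f x : (forall x, 0 <= f x) -> 0 <= avgs L f x.
Proof. by move=> f0; elim: L x => //= i L IH x; apply: avg_ge0. Qed.

Lemma Ex_norm_avgs L f : Ex (fun x => `|avgs L f x|) <= Ex (fun x => `|f x|).
Proof.
elim: L => //= i L IH; apply: le_trans IH.
rewrite -[leRHS](Ex_avg i); apply: ler_Ex => x.
rewrite /avg; apply: le_trans (ler_norm_sum _ _ _) _.
by apply: ler_sum => s _; rewrite normrM ger0_norm.
Qed.

(** Two configurations are joined by changing the coordinates one at a time. *)
Lemma indep_all_const f : (forall i, indep i f) -> forall x, f x = Ex f.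
Proof.
move=> fi x.
have E y : f y = f x.
  pose z L := foldr (fun i z => upd i (y i) z) x L.
  have <- : z (enum W) = y.
    apply/ffunP => i.
    have : i \in enum W by rewrite mem_enum.
    rewrite /z; elim: (enum W) => //= j L IH.
    by rewrite in_cons ffunE; case: eqP => [->//|_ /=].
  by rewrite /z; elim: (enum W) => //= j L IH; rewrite fi.
by rewrite (eq_Ex E) Ex_cst.
Qed.

Lemma depends_indep (A : pred W) f i : depends A f -> ~~ A i -> indep i f.
Proof.
move=> fA iA s x; apply: fA => j jA; rewrite ffunE.
by case: eqP iA => // <-; rewrite jA.
Qed.

(** Average over the coordinates in [A]: [g] is unaffected, and [f] becomes its
    mean. *)
Lemma Ex_mul_indep (A B : pred W) f g : depends A f -> depends B g ->
  (forall i, A i -> ~~ B i) -> Ex (fun x => f x * g x) = Ex f * Ex g.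
Proof.
move=> fA gB AB.
have Af : forall x, avgs (enum A) f x = Ex f.
  move=> x; rewrite -(Ex_avgs (enum A)); apply: indep_all_const => i.
  have [iA|iA] := boolP (A i).
    by apply: avgs_indep; rewrite mem_enum.
  by apply: indep_avgs; exact: depends_indep fA iA.
rewrite -(Ex_avgs (enum A)).
under [X in Ex (avgs _ X)]eq_fun do rewrite mulrC.
rewrite avgs_pull; last first.
  by move=> i; rewrite mem_enum => iA; apply: depends_indep gB (AB _ _).
under eq_Ex do rewrite Af mulrC.
exact: ExZ.
Qed.

(** ** Entropy and the Falik-Samorodnitsky inequality *)

Definition xlnx (u : R) : R := u * ln u.

Definition Phi f : R := Ex (fun x => xlnx (f x)).

Lemma ln_le_sub1 (u : R) : 0 < u -> ln u <= u - 1.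
Proof.
move=> u0; have -> : ln u = ln (1 + (u - 1)) by congr ln; ring.
by apply: le_ln1Dx; lra.
Qed.

Lemma ln_ge_1subV (u : R) : 0 < u -> 1 - u^-1 <= ln u.
Proof.
move=> u0; have := @ln_le_sub1 u^-1.
rewrite invr_gt0 => /(_ u0); rewrite lnV ?posrE//; lra.
Qed.

(** Relative entropy is jointly convex: this is the pointwise tangent-plane
    inequality behind it. The zero cases hold because [0 * ln 0 = 0]. *)
Lemma relative_entropy_tangent (g h G H : R) : 0 <= g -> 0 <= h -> 0 <= G ->
  0 <= H -> (0 < g -> [/\ 0 < h, 0 < G & 0 < H]) ->
  g * ln G - g * ln H + (g - h * (G / H)) <= g * ln g - g * ln h.
Proof.
move=> g0 h0 G0 H0; move: g0; rewrite le_eqVlt => /orP[/eqP <- _|g0 /(_ g0)].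
  rewrite !mul0r subrr !add0r oppr_le0.
  by rewrite mulr_ge0 ?divr_ge0.
move=> [h0' G0' H0'].
have := @ln_ge_1subV (g * H / (h * G)).
rewrite !(divr_gt0, mulr_gt0)// => /(_ isT).
rewrite ln_div ?posrE ?mulr_gt0// !lnM ?posrE// => K.
rewrite -!mulrBr.
have -> : g - h * (G / H) = g * (1 - (g * H / (h * G))^-1).
  by field; rewrite !gt_eqF.
rewrite -mulrDr (ler_pM2l g0); lra.
Qed.

Lemma avg_gt0 i f x : 0 < weight x -> (forall x, 0 <= f x) -> 0 < f x ->
  0 < avg i f x.
Proof.
move=> wx f0 fx; rewrite /avg (bigD1 (x i))//= upd_id.
rewrite ltr_pwDl ?mulr_gt0 ?(weight_gt0 i wx)//.
by apply: sumr_ge0 => s _; rewrite mulr_ge0.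
Qed.

Lemma avgs_gt0 L f x : 0 < weight x -> (forall x, 0 <= f x) -> 0 < f x ->
  0 < avgs L f x.
Proof.
move=> wx f0 fx; elim: L => //= i L IH.
by apply: avg_gt0 => // y; exact: avgs_ge0.
Qed.

(** A function that does not see the averaged coordinates may be integrated
    against [f] or against its average. *)
Lemma Ex_avgs_pull L f g : (forall i, i \in L -> indep i g) ->
  Ex (fun x => f x * g x) = Ex (fun x => avgs L f x * g x).
Proof.
move=> gi; rewrite -(Ex_avgs L).
under [X in Ex (avgs _ X)]eq_fun do rewrite mulrC.
by rewrite avgs_pull//; apply: eq_Ex => x; rewrite mulrC.
Qed.

Lemma Ex_avg_pull i f g : indep i g ->
  Ex (fun x => f x * g x) = Ex (fun x => avg i f x * g x).
Proof.
by move=> gi; apply: (@Ex_avgs_pull [:: i]) => j; rewrite inE => /eqP ->.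
Qed.

(** By convexity of the relative entropy, averaging over other coordinates does
    not increase the mean entropy in coordinate [i]. *)
Lemma entropy_drop_avgs L i f : (forall x, 0 <= f x) ->
  Phi (avgs L f) - Phi (avg i (avgs L f)) <= Phi f - Phi (avg i f).
Proof.
move=> f0; set G := avgs L f; set h := avg i f; set H := avg i G.
have G0 x : 0 <= G x by exact: avgs_ge0.
have h0 x : 0 <= h x by exact: avg_ge0.
have H0 x : 0 <= H x by exact: avg_ge0.
have Eh : Phi h = Ex (fun x => f x * ln (h x)).
  rewrite /Phi /xlnx (@Ex_avg_pull i f)// => s x; congr ln; exact: avg_indep.
have EH : Phi H = Ex (fun x => f x * ln (H x)).
  rewrite (@Ex_avgs_pull L f); last first.
    by move=> j jL s x; congr ln; apply: indep_avg; exact: avgs_indep.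
  rewrite (@Ex_avg_pull i (avgs L f))// => s x; congr ln; exact: avg_indep.
have EG : Phi G = Ex (fun x => f x * ln (G x)).
  rewrite (@Ex_avgs_pull L f)// => j jL s x; congr ln; exact: avgs_indep.
have EhH : Ex (fun x => h x * (G x / H x)) <= Ex f.
  rewrite (@Ex_avgs_pull L h); last first.
    by move=> j jL s x; rewrite /H /G (indep_avg i (avgs_indep f jL)) (avgs_indep f jL).
  rewrite -(Ex_avgs L f); apply: ler_Ex => x.
  rewrite avgs_avg -/G -/H mulrCA.
  have [->|HN] := eqVneq (H x) 0; first by rewrite mul0r mulr0.
  by rewrite divff// mulr1.
have : Ex (fun x => f x * ln (G x) - f x * ln (H x) + (f x - h x * (G x / H x)))
    <= Ex (fun x => f x * ln (f x) - f x * ln (h x)).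
  apply: ler_Ex_pos => x wx; apply: relative_entropy_tangent => // fx.
  have Gx : 0 < G x by exact: avgs_gt0.
  by split => //; [exact: avg_gt0|exact: avg_gt0].
rewrite ExD !ExB -Eh -EH -EG -/(xlnx _) => K.
have -> : Phi f = Ex (fun x => f x * ln (f x)) by [].
lra.
Qed.

(** Tensorization of entropy: the entropy lost when a coordinate is averaged out
    is that of a function already averaged over others, and [entropy_drop_avgs]
    compares it with that of [f]. *)
Lemma entropy_tensorization L f : (forall x, 0 <= f x) ->
  Phi f - Phi (avgs L f) <= \sum_(i <- L) (Phi f - Phi (avg i f)).
Proof.
move=> f0; elim: L => [|i L IH] /=; first by rewrite big_nil subrr.
rewrite big_cons; have := entropy_drop_avgs L i f0; lra.
Qed.

Definition Ent f := Phi f - xlnx (Ex f).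

Lemma Ent_tensorization f : (forall x, 0 <= f x) ->
  Ent f <= \sum_i (Phi f - Phi (avg i f)).
Proof.
move=> f0.
have := entropy_tensorization (enum W) f0; rewrite big_enum/=.
suff -> : Phi (avgs (enum W) f) = xlnx (Ex f) by [].
rewrite /Phi -[RHS]Ex_cst; apply: eq_Ex => x; congr xlnx.
rewrite -(Ex_avgs (enum W) f); apply: indep_all_const => i.
by apply: avgs_indep; rewrite mem_enum.
Qed.

Variable kappa : R.
Hypothesis kappa_gt0 : 0 < kappa.
Hypothesis q_atom : forall s, q s = 0 \/ kappa <= q s.

(** One-coordinate logarithmic Sobolev inequality: the entropy of [V ^+ 2] is at
    most [Var (V ^+ 2) / E (V ^+ 2)], and on atoms of mass at least [kappa] the
    values of [V ^+ 2] are at most [E (V ^+ 2) / kappa]. *)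
Lemma entropy_site i (V : Om -> R) :
  Phi (fun x => V x ^+ 2) - Phi (avg i (fun x => V x ^+ 2)) <=
  4 / kappa * Ex (fun x => (V x - avg i V x) ^+ 2).
Proof.
set g := fun x => V x ^+ 2; set c := avg i V; set m := avg i g.
have g0 x : 0 <= g x by exact: sqr_ge0.
have m0 x : 0 <= m x by exact: avg_ge0.
have im : indep i m by exact: avg_indep.
have ic : indep i c by exact: avg_indep.
have -> : Phi m = Ex (fun x => g x * ln (m x)).
  by rewrite /Phi /xlnx (@Ex_avg_pull i g)// => s x; rewrite im.
rewrite /Phi -ExB.
(* [c ^+ 2] may replace the mean [m] of [g], which minimises the mean square *)
apply: (@le_trans _ _ (Ex (fun x => (g x - c x ^+ 2) ^+ 2 * (m x)^-1))).
  have K : Ex (fun x => g x * (c x ^+ 2 / m x)) = Ex (fun x => m x * (c x ^+ 2 / m x)).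
    by apply: Ex_avg_pull => s x; rewrite im ic.
  have : Ex (fun x => xlnx (g x) - g x * ln (m x)) <=
    Ex (fun x => (g x - c x ^+ 2) ^+ 2 * (m x)^-1
       - (m x - c x ^+ 2) ^+ 2 / m x + 2 * (g x * (c x ^+ 2 / m x))
       - 2 * (m x * (c x ^+ 2 / m x))
       + (m x - g x)).
    apply: ler_Ex_pos => x wx; rewrite /xlnx.
    have [gx|gx] := ltP 0 (g x); last first.
      have -> : g x = 0 by apply/eqP; rewrite eq_le gx g0.
      rewrite !mul0r subrr sub0r subr0 mulr0 addr0.
      have [->|mN] := eqVneq (m x) 0; first by rewrite invr0 !(mulr0,mul0r) !(subr0,addr0).
      suff -> : (- c x ^+ 2) ^+ 2 / m x - (m x - c x ^+ 2) ^+ 2 / m x -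
        2 * (m x * (c x ^+ 2 / m x)) + m x = 0 by [].
      by field.
    have mx : 0 < m x by exact: avg_gt0.
    have : ln (g x / m x) <= g x / m x - 1 by apply: ln_le_sub1; rewrite divr_gt0.
    rewrite ln_div ?posrE// => /(ler_wpM2l (ltW gx)) K1.
    rewrite -mulrBr; apply: le_trans K1 _; rewrite le_eqVlt; apply/orP; left.
    by apply/eqP; field; rewrite gt_eqF.
  rewrite !(ExB, ExD) !ExZ K => K2.
  have Em : Ex m = Ex g by exact: Ex_avg.
  have : 0 <= Ex (fun x => (m x - c x ^+ 2) ^+ 2 / m x).
    by apply: Ex_ge0 => x; rewrite divr_ge0// sqr_ge0.
  lra.
rewrite -ExZ; apply: ler_Ex_pos => x wx.
have qx : kappa <= q (x i).
  case: (q_atom (x i)) => // e; have := weight_gt0 i wx.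
  by rewrite e ltxx.
have gm : g x <= m x / kappa.
  rewrite ler_pdivlMr// mulrC; apply: (@le_trans _ _ (q (x i) * g x)).
    by rewrite ler_wpM2r.
  rewrite /m /avg (bigD1 (x i))//= upd_id lerDl.
  by apply: sumr_ge0 => s _; rewrite mulr_ge0.
have k1 : kappa <= 1.
  apply: le_trans qx _; rewrite -q_sum1 (bigD1 (x i))//= lerDl.
  exact: sumr_ge0.
have cm : c x ^+ 2 <= m x.
  have : 0 <= avg i (fun y => (V y - c x) ^+ 2) x.
    by apply: avg_ge0 => y; exact: sqr_ge0.
  suff -> : avg i (fun y => (V y - c x) ^+ 2) x = m x - c x ^+ 2 by rewrite subr_ge0.
  have -> : (fun y => (V y - c x) ^+ 2) =
      (fun y => g y - (2 * c x) * V y + c x ^+ 2).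
    by apply/funext => y; rewrite /g; ring.
  rewrite avgD avgB avgZ -/c -/m.
  rewrite (@avg_id i (fun _ => c x ^+ 2))//; ring.
have cmk : c x ^+ 2 <= m x / kappa.
  apply: le_trans cm _; rewrite ler_pdivlMr//.
  by rewrite -[leRHS]mulr1 ler_wpM2l.
have [->|mN] := eqVneq (m x) 0.
  rewrite invr0 mulr0 mulr_ge0 ?sqr_ge0// divr_ge0// ltW//.
have mx : 0 < m x by rewrite lt_neqAle eq_sym mN m0.
rewrite ler_pdivrMr//.
have -> : (g x - c x ^+ 2) ^+ 2 = (V x - c x) ^+ 2 * (V x + c x) ^+ 2.
  by rewrite /g; ring.
have -> : 4 / kappa * (V x - c x) ^+ 2 * m x = (V x - c x) ^+ 2 * (4 * (m x / kappa)).
  by ring.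
rewrite ler_wpM2l ?sqr_ge0//.
have : (V x + c x) ^+ 2 <= 2 * g x + 2 * c x ^+ 2.
  rewrite -subr_ge0 /g.
  have -> : 2 * V x ^+ 2 + 2 * c x ^+ 2 - (V x + c x) ^+ 2 = (V x - c x) ^+ 2 by ring.
  exact: sqr_ge0.
lra.
Qed.

Lemma log_sobolev (V : Om -> R) :
  Ent (fun x => V x ^+ 2) <=
  4 / kappa * \sum_i Ex (fun x => (V x - avg i V x) ^+ 2).
Proof.
apply: le_trans (Ent_tensorization _) _ => [x|]; first exact: sqr_ge0.
by rewrite mulr_sumr; apply: ler_sum => i _; exact: entropy_site.
Qed.

(** The differences of the martingale which averages out the coordinates of
    [L], the last coordinate of the list first. *)
Fixpoint mdiffs L f : seq (Om -> R) :=
  if L is i :: L' then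
    (fun x => avgs L' f x - avg i (avgs L' f) x) :: mdiffs L' f
  else [::].

Lemma Ex_sqr_sub_avg i f :
  Ex (fun x => (f x - avg i f x) ^+ 2) =
  Ex (fun x => f x ^+ 2) - Ex (fun x => avg i f x ^+ 2).
Proof.
have K : Ex (fun x => f x * avg i f x) = Ex (fun x => avg i f x * avg i f x).
  by apply: Ex_avg_pull; exact: avg_indep.
have -> : (fun x => (f x - avg i f x) ^+ 2) =
    (fun x => f x ^+ 2 - 2 * (f x * avg i f x) + avg i f x * avg i f x).
  by apply/funext => x; ring.
rewrite ExD ExB ExZ K.
have -> : (fun x => avg i f x ^+ 2) = (fun x => avg i f x * avg i f x).
  by apply/funext => x; rewrite expr2.
ring.
Qed.

Lemma mdiffs_orthogonal L f :
  \sum_(V <- mdiffs L f) Ex (fun x => V x ^+ 2) =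
  Ex (fun x => f x ^+ 2) - Ex (fun x => avgs L f x ^+ 2).
Proof.
elim: L => [|i L IH] /=; first by rewrite big_nil subrr.
by rewrite big_cons IH Ex_sqr_sub_avg; ring.
Qed.

(** Conditional expectations commute; hence the energy of [V] in the coordinate
    [i], summed over the differences [V] of [f], is that of [f]. *)
Lemma mdiffs_sub_avg L i f :
  mdiffs L (fun x => f x - avg i f x) =
  [seq (fun x => V x - avg i V x) | V <- mdiffs L f].
Proof.
elim: L => //= j L ->; congr cons; apply/funext => x.
by rewrite avgsB avgs_avg !avgB (avg_comm j i); ring.
Qed.

Lemma mdiffs_L1 L f :
  \sum_(V <- mdiffs L f) Ex (fun x => `|V x|) ^+ 2 <=
  \sum_(i <- L) Ex (fun x => `|f x - avg i f x|) ^+ 2.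
Proof.
elim: L => [|i L IH] /=; first by rewrite !big_nil.
rewrite !big_cons lerD// lerXn2r ?nnegrE ?Ex_ge0//.
rewrite -avgs_avg.
have := Ex_norm_avgs L (fun x => f x - avg i f x).
by rewrite avgsB.
Qed.

(** [Ent V^2] dominates [E V^2 * ln (E V^2 / (E |V|)^2)]; the right-hand side is
    linearised at the slope [r] so that it can be summed over several [V]. *)
Lemma Ent_sqr_ge (V : Om -> R) (r : R) : 0 < r ->
  Ex (fun x => V x ^+ 2) * ln r + Ex (fun x => V x ^+ 2)
     - Ex (fun x => `|V x|) ^+ 2 * r <= Ent (fun x => V x ^+ 2).
Proof.
move=> r0; set a := Ex (fun x => V x ^+ 2); set b := Ex (fun x => `|V x|).
have a0 : 0 <= a by apply: Ex_ge0 => x; exact: sqr_ge0.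
have b0 : 0 <= b by exact: Ex_ge0.
(* the tangent of [u * ln u] at [u = c ^+ 2]; the best choice is [c = a / b] *)
have tangent c : 0 < c -> a * (2 * ln c + 2) - 2 * c * b <=
    Phi (fun x => V x ^+ 2).
  move=> c0; rewrite /a [_ * (2 * _ + 2)]mulrC -!ExZ -ExB; apply: ler_Ex => x.
  rewrite /xlnx -[V x ^+ 2]ger0_norm ?sqr_ge0// normrX.
  have := normr_ge0 (V x); set v := `|V x|.
  rewrite le_eqVlt => /orP[/eqP <-|v0].
    by rewrite expr0n/= mulr0 mul0r mulr0 subr0.
  rewrite lnXn// mulr2n.
  have := @ln_ge_1subV (v / c); rewrite divr_gt0// => /(_ isT).
  rewrite ln_div ?posrE// => K.
  have -> : (2 * ln c + 2) * v ^+ 2 - 2 * c * v =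
      v ^+ 2 * (2 * ln c + 2 * (1 - (v / c)^-1)).
    by field; rewrite !gt_eqF.
  rewrite ler_wpM2l ?sqr_ge0//; lra.
have ab : (a == 0) = (b == 0).
  rewrite /a /b /Ex !psumr_eq0/=; last 2 first.
  - by move=> x _; rewrite mulr_ge0 ?weight_ge0.
  - by move=> x _; rewrite mulr_ge0 ?weight_ge0 ?sqr_ge0.
  by apply: eq_all => x; rewrite !mulf_eq0 normr_eq0 orbb.
rewrite /Ent -/a.
have [a00|aN] := eqVneq a 0.
  have b00 : b = 0 by apply/eqP; rewrite -ab a00.
  have := tangent 1 ltr01; rewrite a00 b00 /xlnx !(mul0r,mulr0,expr0n)/=.
  by rewrite !(mul0r, subr0, addr0).
have bN : b != 0 by rewrite -ab.
have {}a0 : 0 < a by rewrite lt_neqAle eq_sym aN.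
have {}b0 : 0 < b by rewrite lt_neqAle eq_sym bN.
have := tangent (a / b); rewrite divr_gt0// => /(_ isT).
have -> : 2 * (a / b) * b = 2 * a by field.
have -> : ln (a / b) = ln a - ln b by rewrite ln_div.
move=> K1; rewrite /xlnx.
have := @ln_ge_1subV (a / (b ^+ 2 * r)).
rewrite divr_gt0 ?mulr_gt0 ?exprn_gt0// => /(_ isT).
rewrite ln_div ?posrE ?mulr_gt0 ?exprn_gt0// lnM ?posrE ?exprn_gt0//.
rewrite lnXn// mulr2n => /(ler_wpM2l (ltW a0)).
have -> : a * (1 - (a / (b ^+ 2 * r))^-1) = a - b ^+ 2 * r.
  by field; rewrite aN bN gt_eqF.
lra.
Qed.

Definition Var f := Ex (fun x => (f x - Ex f) ^+ 2).

Lemma VarE f : Var f = Ex (fun x => f x ^+ 2) - Ex f ^+ 2.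
Proof.
rewrite /Var; set c := Ex f.
have -> : (fun x => (f x - c) ^+ 2) = (fun x => f x ^+ 2 - 2 * c * f x + c ^+ 2).
  by apply/funext => x; ring.
rewrite ExD ExB ExZ Ex_cst -/c; ring.
Qed.

(** Variance is superconcentrated as soon as the influences are small in L1: sum
    the lower bound on [Ent V^2] and the logarithmic Sobolev inequality over the
    martingale differences [V] of [f]. *)
Theorem falik_samorodnitsky f (B : R) : 0 < B ->
  \sum_i Ex (fun x => `|f x - avg i f x|) ^+ 2 <= B ->
  Var f * ln (Var f / B) <=
  4 / kappa * \sum_i Ex (fun x => (f x - avg i f x) ^+ 2).
Proof.
move=> B0 hB; set v := Var f.
have rhs0 : 0 <= 4 / kappa * \sum_i Ex (fun x => (f x - avg i f x) ^+ 2).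
  apply: mulr_ge0; first by rewrite divr_ge0// ltW.
  by apply: sumr_ge0 => i _; apply: Ex_ge0 => x; exact: sqr_ge0.
have [v0|vN] := leP v 0.
  have -> : v = 0.
    apply/eqP; rewrite eq_le v0; apply: Ex_ge0 => x; exact: sqr_ge0.
  by rewrite mul0r.
have sumV : \sum_(V <- mdiffs (enum W) f) Ex (fun x => V x ^+ 2) = v.
  rewrite mdiffs_orthogonal /v VarE; congr (_ - _).
  rewrite -[RHS]Ex_cst; apply: eq_Ex => x; congr (_ ^+ 2).
  rewrite -(Ex_avgs (enum W) f); apply: indep_all_const => i.
  by apply: avgs_indep; rewrite mem_enum.
have r0 : 0 < v / B by rewrite divr_gt0.
apply: (@le_trans _ _ (\sum_(V <- mdiffs (enum W) f) Ent (fun x => V x ^+ 2))).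
  have : \sum_(V <- mdiffs (enum W) f) (Ex (fun x => V x ^+ 2) * ln (v / B)
     + Ex (fun x => V x ^+ 2) - Ex (fun x => `|V x|) ^+ 2 * (v / B)) <=
     \sum_(V <- mdiffs (enum W) f) Ent (fun x => V x ^+ 2).
    by apply: ler_sum => V _; exact: Ent_sqr_ge.
  apply: le_trans.
  rewrite sumrB big_split/= -!mulr_suml sumV.
  have := mdiffs_L1 (enum W) f; rewrite big_enum/= => /le_trans/(_ hB) K.
  have := ler_wpM2r (ltW r0) K.
  have -> : B * (v / B) = v by field; rewrite gt_eqF.
  lra.
apply: (@le_trans _ _ (\sum_(V <- mdiffs (enum W) f)
   (4 / kappa * \sum_i Ex (fun x => (V x - avg i V x) ^+ 2)))).
  by apply: ler_sum => V _; exact: log_sobolev.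
rewrite -mulr_sumr ler_wpM2l ?(divr_ge0 _ (ltW kappa_gt0))// exchange_big/=.
apply: ler_sum => i _.
have := mdiffs_orthogonal (enum W) (fun x => f x - avg i f x).
rewrite mdiffs_sub_avg big_map => ->.
by rewrite gerBl; apply: Ex_ge0 => x; exact: sqr_ge0.
Qed.

(** The resampling effect of a coordinate is symmetric in law, so its positive
    part is enough to control it. *)
Lemma influence_L1 i f (D : Om -> R) :
  (forall x s, f (upd i s x) - f x <= D x) -> (forall x, 0 <= D x) ->
  Ex (fun x => `|f x - avg i f x|) <= 2 * Ex D.
Proof.
move=> fD D0.
apply: (@le_trans _ _ (\sum_x weight x * (\sum_s q s * (D x + D (upd i s x))))).
  apply: ler_sum => x _; rewrite ler_wpM2l ?weight_ge0//.
  have -> : f x - avg i f x = \sum_s q s * (f x - f (upd i s x)).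
    under eq_bigr do rewrite mulrBr.
    by rewrite sumrB -mulr_suml q_sum1 mul1r.
  apply: le_trans (ler_norm_sum _ _ _) _; apply: ler_sum => s _.
  rewrite normrM ger0_norm// ler_wpM2l//.
  have K1 := fD x s; have := fD (upd i s x) (x i).
  rewrite upd_upd upd_id => K2.
  by have := D0 x; have := D0 (upd i s x); rewrite ler_norml; lra.
under eq_bigr do under eq_bigr do rewrite mulrDr.
under eq_bigr do rewrite big_split/= mulrDr.
rewrite big_split/= (resample_exchange i (fun _ y => D y)).
rewrite -big_split/= /Ex mulr_sumr; apply: ler_sum => x _.
by rewrite -!mulr_suml q_sum1; lra.
Qed.

Lemma influence_L2 i f (D : Om -> R) :
  (forall x s, f (upd i s x) - f x <= D x) -> (forall x, 0 <= D x) ->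
  Ex (fun x => (f x - avg i f x) ^+ 2) <= 2 * Ex (fun x => D x ^+ 2).
Proof.
move=> fD D0.
apply: (@le_trans _ _ (\sum_x weight x *
    (\sum_s q s * (D x ^+ 2 + D (upd i s x) ^+ 2)))).
  apply: ler_sum => x _; rewrite ler_wpM2l ?weight_ge0//.
  set c := avg i f x.
  have J : (f x - c) ^+ 2 <= \sum_s q s * (f x - f (upd i s x)) ^+ 2.
    have -> : \sum_s q s * (f x - f (upd i s x)) ^+ 2 =
       avg i (fun y => (f y - c) ^+ 2) x + (f x - c) ^+ 2.
      transitivity (avg i (fun y => (f y - c) ^+ 2 + (-2 * (f x - c)) * (f y - c)
           + (f x - c) ^+ 2) x).
        by apply: eq_bigr => s _; congr (_ * _); ring.
      rewrite !avgD avgZ avgB (@avg_id i (fun _ => c))// -/c.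
      rewrite (@avg_id i (fun _ => (f x - c) ^+ 2))//; ring.
    rewrite lerDr; apply: avg_ge0 => y; exact: sqr_ge0.
  apply: le_trans J _; apply: ler_sum => s _; rewrite ler_wpM2l//.
  have K1 := fD x s; have := fD (upd i s x) (x i).
  rewrite upd_upd upd_id => K2.
  have D1 := D0 x; have D2 := D0 (upd i s x).
  have [h|h] := leP (f x) (f (upd i s x)); nra.
under eq_bigr do under eq_bigr do rewrite mulrDr.
under eq_bigr do rewrite big_split/= mulrDr.
rewrite big_split/= (resample_exchange i (fun _ y => D y ^+ 2)).
rewrite -big_split/= /Ex mulr_sumr; apply: ler_sum => x _.
by rewrite -!mulr_suml q_sum1; lra.
Qed.

End ProductSpace.

(** * Counting in the lattice *)

Section LatticeCounting.
Variables (R : realType) (d : nat).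
Implicit Types u v w : 'rV[int]_d.

Lemma l1norm0 : l1norm (0 : 'rV[int]_d) = 0%N.
Proof. by rewrite /l1norm big1// => i _; rewrite mxE. Qed.

Lemma l1norm_triangle v w : (l1norm (v + w) <= l1norm v + l1norm w)%N.
Proof.
have absz_triangle (m n : int) : (`|(m + n)%R| <= `|m| + `|n|)%N by lia.
rewrite /l1norm -big_split/=; apply: leq_sum => i _.
by rewrite mxE absz_triangle.
Qed.

Lemma coord_le_l1norm v i : (`|v 0%R i| <= l1norm v)%N.
Proof. by rewrite /l1norm (bigD1 i)//= leq_addr. Qed.

Lemma site_dist_sym v w : site_dist v w = site_dist w v.
Proof. by rewrite /site_dist -l1normN opprB. Qed.

Lemma site_dist_triangle u v w :
  (site_dist u w <= site_dist u v + site_dist v w)%N.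
Proof.
rewrite /site_dist; apply: leq_trans (l1norm_triangle _ _).
by rewrite addrA subrK.
Qed.

Lemma site_distvv v : site_dist v v = 0%N.
Proof. by rewrite /site_dist subrr l1norm0. Qed.

Definition cube_point (r : nat) (f : {ffun 'I_d -> 'I_(r.*2.+1)}) : 'rV[int]_d :=
  \row_i ((f i : nat)%:Z - r%:Z).

Definition cube (r : nat) : seq 'rV[int]_d :=
  [seq cube_point f | f <- enum {ffun 'I_d -> 'I_(r.*2.+1)}].

Lemma cube_point_inj r : injective (@cube_point r).
Proof.
move=> f g /rowP fg; apply/ffunP => i; apply: val_inj => /=.
by have := fg i; rewrite !mxE => /addIr [].
Qed.

Lemma cube_uniq r : uniq (cube r).
Proof. by rewrite map_inj_uniq ?enum_uniq//; exact: cube_point_inj. Qed.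

Lemma size_cube r : size (cube r) = (r.*2.+1 ^ d)%N.
Proof. by rewrite size_map -cardE card_ffun !card_ord. Qed.

Lemma mem_cube r v : (l1norm v <= r)%N -> v \in cube r.
Proof.
move=> vr; apply/mapP.
have K i : (`|v 0%R i| <= r)%N by apply: leq_trans vr; exact: coord_le_l1norm.
exists [ffun i => inord `|(v 0 i + r%:Z)%R|%N]; first by rewrite mem_enum.
apply/rowP => i; rewrite !mxE ffunE.
move: (v 0 i) (K i) => c cr.
by rewrite inordK -?addnn; lia.
Qed.

Lemma cube_l1norm r v : v \in cube r -> (l1norm v <= d * r)%N.
Proof.
move=> /mapP[f _ ->]; rewrite /l1norm.
apply: (@leq_trans (\sum_(i < d) r)%N); last by rewrite sum_nat_const card_ord.
apply: leq_sum => i _; rewrite mxE.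
by move: (nat_of_ord (f i)) (ltn_ord (f i)) => k; rewrite -addnn; lia.
Qed.

Lemma geometric_sum_le (s : R) (r : nat) : 0 < s ->
  \sum_(1 <= k < r.+1) expR (- s * k%:R) <= (1 - expR (- s * r%:R)) / s.
Proof.
move=> s0; elim: r => [|r IH]; first by rewrite big_geq// mulr0 expR0 subrr mul0r.
rewrite big_nat_recr//=.
have -> : expR (- s * r.+1%:R) = expR (- s * r%:R) * expR (- s).
  by rewrite -expRD; congr expR; rewrite -natr1; ring.
set Y := expR (- s * r%:R) in IH *; set y := expR (- s).
have Y0 : 0 < Y by exact: expR_gt0.
have ys : s * y <= 1 - y.
  have : y * (1 + s) <= 1.
    rewrite /y expRN -ler_pdivlMl ?invr_gt0 ?expR_gt0// invrK mulr1.
    exact: expR_ge1Dx.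
  lra.
apply: (@le_trans _ _ ((1 - Y) / s + Y * y)); first by rewrite lerD2r.
rewrite -lerBrDl -mulrBl ler_pdivlMr//.
have -> : 1 - Y * y - (1 - Y) = Y * (1 - y) by ring.
by rewrite -mulrA ler_pM2l// mulrC.
Qed.

Lemma exp_sum_line (s : R) (r : nat) : 0 < s -> s <= 1 ->
  \sum_(k < r.*2.+1) expR (- s * `|((k : nat)%:Z - r%:Z)%R|%N%:R) <= 3 / s.
Proof.
move=> s0 s1.
rewrite -(big_mkord xpredT (fun k => expR (- s * `|(k%:Z - r%:Z)%R|%N%:R))).
rewrite (@big_cat_nat _ _ _ r)//=; last by rewrite -addnn; lia.
have -> : \sum_(0 <= k < r) expR (- s * `|(k%:Z - r%:Z)%R|%N%:R) =
    \sum_(1 <= k < r.+1) expR (- s * k%:R).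
  rewrite big_nat_rev/= add0n [RHS]big_add1/= big_nat [RHS]big_nat.
  by apply: eq_bigr => k kr; congr (expR (_ * _%:R)); lia.
have -> : \sum_(r <= k < r.*2.+1) expR (- s * `|(k%:Z - r%:Z)%R|%N%:R) =
    1 + \sum_(1 <= k < r.+1) expR (- s * k%:R).
  rewrite big_ltn; last by rewrite -addnn; lia.
  have -> : `|(r%:Z - r%:Z)%R|%N = 0%N by lia.
  rewrite mulr0 expR0; congr (_ + _).
  rewrite -[r.+1 in LHS]add1n big_addn.
  have -> : (r.*2.+1 - r = r.+1)%N by rewrite -addnn; lia.
  by rewrite big_nat [RHS]big_nat; apply: eq_bigr => k kr;
    congr (expR (_ * _%:R)); lia.
have := geometric_sum_le r s0.
have : (1 - expR (- s * r%:R)) / s <= 1 / s.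
  by rewrite ler_pM2r ?invr_gt0// gerBl expR_ge0.
have : 1 <= 1 / s by rewrite ler_pdivlMr// mul1r.
have -> : 3 / s = 1 / s + 1 / s + 1 / s by ring.
lra.
Qed.

(** The sum factors into [d] two-sided geometric series. *)
Lemma exp_sum_cube (s : R) (r : nat) : 0 < s -> s <= 1 ->
  \sum_(v <- cube r) expR (- s * (l1norm v)%:R) <= (3 / s) ^+ d.
Proof.
move=> s0 s1; rewrite /cube big_map big_enum/=.
have -> : \sum_(f : {ffun 'I_d -> 'I_(r.*2.+1)})
    expR (- s * (l1norm (cube_point f))%:R) =
    \sum_(f : {ffun 'I_d -> 'I_(r.*2.+1)})
      \prod_i expR (- s * `|((f i : nat)%:Z - r%:Z)%R|%N%:R).
  apply: eq_bigr => f _; rewrite -expR_sum -mulr_sumr; congr expR.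
  rewrite /l1norm natr_sum; congr (_ * _); apply: eq_bigr => i _.
  by rewrite mxE.
rewrite -(bigA_distr_bigA (fun _ (k : 'I_(r.*2.+1)) =>
   expR (- s * `|((k : nat)%:Z - r%:Z)%R|%N%:R)))/=.
rewrite -[in leRHS](card_ord d) -prodr_const; apply: ler_prod => i _.
by rewrite exp_sum_line// andbT; apply: sumr_ge0 => k _; exact: expR_ge0.
Qed.

Lemma mem_le_sum (T : eqType) (F : T -> R) (l : seq T) t :
  (forall t, 0 <= F t) -> t \in l -> F t <= \sum_(t' <- l) F t'.
Proof.
by move=> F0 tl; rewrite (big_rem t)//= lerDl; apply: sumr_ge0.
Qed.

Lemma sum_uniq_subset (T : eqType) (F : T -> R) (l l' : seq T) :
  (forall t, 0 <= F t) -> uniq l -> {subset l <= l'} ->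
  \sum_(t <- l) F t <= \sum_(t <- l') F t.
Proof.
move=> F0; elim: l l' => [|t l IH] l' /=.
  by rewrite big_nil => _ _; apply: sumr_ge0.
move=> /andP[tl ul] sl.
rewrite big_cons (big_rem t (_ : t \in l')) ?sl ?mem_head//= lerD2l.
apply: IH => // t' t'l.
have : t' \in l' by rewrite sl// in_cons t'l orbT.
rewrite (perm_mem (perm_to_rem (_ : t \in l'))) ?sl ?mem_head//.
by rewrite in_cons => /orP[/eqP e|//]; rewrite -e t'l in tl.
Qed.

Lemma exp_sum_translate (s : R) (r : nat) v w : 0 < s -> s <= 1 ->
  \sum_(u <- cube r) expR (- s * (site_dist (v + u) w)%:R) <= (3 / s) ^+ d.
Proof.
move=> s0 s1.
pose r' := (d * r + l1norm (v - w))%N.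
have -> : \sum_(u <- cube r) expR (- s * (site_dist (v + u) w)%:R) =
    \sum_(u <- [seq v + u - w | u <- cube r]) expR (- s * (l1norm u)%:R).
  by rewrite [RHS]big_map.
apply: le_trans (exp_sum_cube r' s0 s1); apply: sum_uniq_subset.
- by move=> u; exact: expR_ge0.
- rewrite map_inj_uniq ?cube_uniq// => u u' /addIr; exact: addrI.
- move=> u /mapP[u' /cube_l1norm u'r ->]; apply: mem_cube.
  have -> : v + u' - w = u' + (v - w) by rewrite addrAC addrC.
  by apply: leq_trans (l1norm_triangle _ _) _; rewrite leq_add2r.
Qed.

End LatticeCounting.

(** The two versions of the model attach a passage time to each element of a
    set of carriers (sites or edges), which are located in the lattice. *)
Section Carriers.
Variables (R : realType) (d : nat) (J : eqType).
Variables (pos : J -> 'rV[int]_d) (at_pos : 'rV[int]_d -> seq J) (cA : nat).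
Hypothesis mem_at_pos : forall j, j \in at_pos (pos j).
Hypothesis pos_at_pos : forall v j, j \in at_pos v -> pos j = v.
Hypothesis size_at_pos : forall v, (size (at_pos v) <= cA)%N.
Implicit Types (u v w z : 'rV[int]_d) (j b : J) (l c : seq J).

Definition carriers z (r : nat) : seq J :=
  flatten [seq at_pos (z + u) | u <- cube d r].

Lemma mem_carriers z r j : (site_dist (pos j) z <= r)%N -> j \in carriers z r.
Proof.
move=> jr; apply/flatten_mapP; exists (pos j - z); first exact: mem_cube.
by rewrite addrC subrK.
Qed.

Lemma sum_carriers z r (F : 'rV[int]_d -> R) : (forall v, 0 <= F v) ->
  \sum_(j <- carriers z r) F (pos j) <= cA%:R * \sum_(u <- cube d r) F (z + u).
Proof.
move=> F0; rewrite /carriers big_flatten big_map mulr_sumr; apply: ler_sum => u _.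
rewrite big_seq; under eq_bigr => j /pos_at_pos -> do [].
rewrite -big_seq big_const_seq count_predT iter_addr_0 -[_ *+ _]mulr_natl.
by rewrite ler_wpM2r// ler_nat.
Qed.

Lemma size_carriers z r : (size (carriers z r) <= cA * r.*2.+1 ^ d)%N.
Proof.
rewrite -(ler_nat R) -sum1_size natr_sum.
apply: le_trans (@sum_carriers z r (fun=> 1) _) _ => //.
by rewrite big_const_seq count_predT iter_addr_0 size_cube natrM.
Qed.

Lemma uniq_near_size l z r : uniq l ->
  (forall j, j \in l -> (site_dist (pos j) z <= r)%N) ->
  (size l <= cA * r.*2.+1 ^ d)%N.
Proof.
move=> ul lr; apply: leq_trans (size_carriers z r); apply: uniq_leq_size => //.
by move=> j /lr; exact: mem_carriers.
Qed.

(** ** Chains of distant carriers *)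

Fixpoint walk_length v l : nat :=
  if l is j :: l' then (site_dist (pos j) v + walk_length (pos j) l')%N else 0%N.

Lemma walk_length_move v w l : (walk_length v l <= site_dist v w + walk_length w l)%N.
Proof.
case: l => //= j l; rewrite addnA leq_add2r addnC (site_dist_sym v).
exact: site_dist_triangle.
Qed.

Lemma walk_length_subseq v c l : subseq c l ->
  (walk_length v c <= walk_length v l)%N.
Proof.
elim: l c v => [|j l IH] [|b c] v //=.
case: eqP => [->|_] h; first by rewrite leq_add2l; exact: IH.
apply: (@leq_trans (site_dist (pos j) v + walk_length (pos j) (b :: c))%N).
  rewrite (site_dist_sym (pos j) v); exact: (walk_length_move v (pos j) (b :: c)).
by rewrite leq_add2l; exact: IH.
Qed.

Lemma site_dist_walk v l j : j \in l -> (site_dist (pos j) v <= walk_length v l)%N.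
Proof.
elim: l v => //= b l IH v; rewrite in_cons => /orP[/eqP ->|/IH h].
  exact: leq_addr.
apply: leq_trans (site_dist_triangle _ (pos b) _) _.
by rewrite addnC leq_add2l.
Qed.

Section Greedy.
Variables (far : rel J).
Hypothesis far_irr : forall j, ~~ far j j.

(** Keeping each element of [P] which is far from all those kept before gives a
    subsequence that is maximal among those with pairwise distant elements. *)
Fixpoint greedy (P : pred J) l : seq J :=
  if l is j :: l' then
    let c := greedy P l' in if P j && all (far j) c then j :: c else c
  else [::].

Lemma greedy_subseq P l : subseq (greedy P l) l.
Proof.
elim: l => //= j l IH; case: ifP => _; first by rewrite eqxx.
exact: (subseq_trans IH (subseq_cons _ _)).
Qed.

Lemma greedy_all P l : all P (greedy P l).
Proof. by elim: l => //= j l IH; case: ifP => //= /andP[-> _]. Qed.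

Lemma greedy_far P l : pairwise far (greedy P l).
Proof. by elim: l => //= j l IH; case: ifP => //= /andP[_ ->]. Qed.

Lemma greedy_uniq P l : uniq (greedy P l).
Proof.
elim: l => //= j l IH; case: ifP => //= /andP[_ /allP h].
by rewrite IH andbT; apply/negP => /h; apply/negP.
Qed.

Lemma greedy_cover (P : pred J) l j : j \in l -> P j ->
  has (fun b => ~~ far j b) (greedy P l).
Proof.
elim: l => //= b l IH; rewrite in_cons => /orP[/eqP -> Pb|jl Pj].
  rewrite Pb/=; case: ifP => [_ /=|/negbT]; first by rewrite far_irr.
  by rewrite -has_predC.
by case: ifP => _ /=; rewrite IH// orbT.
Qed.

(** By maximality every element of [P] is near an element of the greedy
    subsequence. *)
Lemma count_le_greedy (P : pred J) l D :
  (forall b, b \in l -> count (fun j => ~~ far j b) l <= D)%N ->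
  (count P l <= D * size (greedy P l))%N.
Proof.
move=> hD.
apply: (@leq_trans (\sum_(b <- greedy P l) count (fun j => ~~ far j b) l)%N).
  under eq_bigr do rewrite -sum1_count big_mkcond/=.
  rewrite exchange_big/= -sum1_count big_mkcond/= big_seq [leqRHS]big_seq.
  apply: leq_sum => j jl; case: ifP => // Pj.
  rewrite -big_mkcond/= sum1_count -has_count; exact: greedy_cover.
apply: (@leq_trans (\sum_(b <- greedy P l) D)%N).
  rewrite big_seq [leqRHS]big_seq; apply: leq_sum => b /(mem_subseq (greedy_subseq _ _)).
  exact: hD.
by rewrite big_const_seq count_predT iter_addn_0.
Qed.

End Greedy.

Section Chains.
Variables (W S : finType) (q : S -> R).
Hypothesis q_ge0 : forall s, 0 <= q s.
Hypothesis q_sum1 : \sum_s q s = 1.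
Variables (far : rel J) (bad : J -> pred {ffun W -> S}) (A : J -> pred W) (p : R).
Hypothesis p_ge0 : 0 <= p.
Hypothesis far_irr : forall j, ~~ far j j.
Hypothesis bad_depends : forall j (x y : {ffun W -> S}),
  (forall i, A j i -> x i = y i) -> bad j x = bad j y.
Hypothesis far_disjoint : forall j b i, far j b -> A j i -> ~~ A b i.
Hypothesis bad_prob : forall j, Ex q (fun x => (bad j x)%:R) <= p.

Local Notation E := (Ex q).

(** Distant carriers depend on disjoint sets of coordinates. *)
Lemma all_bad_prob c : pairwise far c ->
  E (fun x => (all (bad^~ x) c)%:R) <= p ^+ size c.
Proof.
elim: c => [_|j c IH] /=; first by rewrite expr0 Ex_cst.
move=> /andP[/allP jc fc].
have -> : (fun x => (bad j x && all (bad^~ x) c)%:R : R) =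
    (fun x => (bad j x)%:R * (all (bad^~ x) c)%:R).
  by apply/funext => x; rewrite -natrM mulnb.
rewrite (@Ex_mul_indep _ _ _ _ q_sum1 (A j) (fun i => has (A^~ i) c))//.
- rewrite exprS; apply: ler_pM => //; last exact: IH.
  + by apply: Ex_ge0 => // x; rewrite ler0n.
  + by apply: Ex_ge0 => // x; rewrite ler0n.
- by move=> x y xy; rewrite (bad_depends xy).
- move=> x y xy; congr (_%:R); congr nat_of_bool.
  apply: eq_in_all => b bc; apply: bad_depends => i Ai; apply: xy.
  by apply/hasP; exists b.
- move=> i ji; apply/hasPn => b bc; exact: far_disjoint (jc _ bc) ji.
Qed.

Fixpoint tuples_of (L : seq J) (M : nat) : seq (seq J) :=
  if M is M'.+1 then [seq b :: c | b <- L, c <- tuples_of L M'] else [:: [::]].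

Lemma mem_tuples_of (L c : seq J) : {subset c <= L} -> c \in tuples_of L (size c).
Proof.
elim: c => //= b c IH h; apply/allpairsP; exists (b, c); split => //=.
  by apply: h; rewrite mem_head.
by apply: IH => j jc; apply: h; rewrite in_cons jc orbT.
Qed.

Lemma size_tuples_of (L c : seq J) M : c \in tuples_of L M -> size c = M.
Proof.
by elim: M c => [|M IH] c /=; [rewrite inE => /eqP ->|
  move=> /allpairsP[[b c'] [_ /IH <- ->]]].
Qed.

(** The generating function of chains decouples into one factor per step. *)
Lemma chain_generating (L : seq J) (s G : R) (M : nat) v :
  (forall v, \sum_(b <- L) expR (- s * (site_dist (pos b) v)%:R) <= G) ->
  \sum_(c <- tuples_of L M) expR (- s * (walk_length v c)%:R) <= G ^+ M.
Proof.
move=> hG; elim: M v => [|M IH] v /=.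
  by rewrite big_seq1/= mulr0 expR0 expr0.
have G0 : 0 <= G by apply: le_trans (hG v); apply: sumr_ge0 => b _; exact: expR_ge0.
rewrite big_allpairs_dep/=.
apply: (@le_trans _ _ (\sum_(b <- L) expR (- s * (site_dist (pos b) v)%:R) * G ^+ M)).
  apply: ler_sum => b _.
  under eq_bigr do rewrite natrD mulrDr expRD.
  by rewrite -mulr_sumr ler_wpM2l ?expR_ge0.
by rewrite -mulr_suml exprS ler_wpM2r// exprn_ge0.
Qed.

(** With [s] chosen so that a step of a chain has weight at most [1/2], the
    number of bad elements of a chain exceeds [s] times its length by at most a
    constant in mean. The bound [n <= n - s l + s l <= expR (n - s l) + s l]
    turns the maximum over chains into a sum. *)
Lemma chain_exponential (g : {ffun W -> S} -> seq J) z (l : nat) (s : R) :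
  0 < s -> s <= 1 ->
  (forall x, walk_length z (g x) <= l)%N ->
  (forall x, size (g x) <= l)%N ->
  expR 1 * p * (cA%:R * (3 / s) ^+ d) <= 1 / 2 ->
  E (fun x => (size (greedy far (bad^~ x) (g x)))%:R) <= s * l%:R + 2.
Proof.
move=> s0 s1 gl gsz hp.
pose L := carriers z l.
pose wt x (c : seq J) : R := (pairwise far c)%:R * (all (bad^~ x) c)%:R *
   (expR (size c)%:R * expR (- s * (walk_length z c)%:R)).
pose Z x : R := \sum_(M < l.+1) \sum_(c <- tuples_of L M) wt x c.
have wt0 x c : 0 <= wt x c.
  by rewrite mulr_ge0// ?mulr_ge0 ?ler0n// expR_ge0.
have step v : \sum_(b <- L) expR (- s * (site_dist (pos b) v)%:R) <=
    cA%:R * (3 / s) ^+ d.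
  apply: le_trans (@sum_carriers z l (fun u => expR (- s * (site_dist u v)%:R)) _) _.
    by move=> u; exact: expR_ge0.
  by rewrite ler_wpM2l//; exact: exp_sum_translate.
have EZ : E Z <= 2.
  rewrite Ex_sum.
  apply: (@le_trans _ _ (\sum_(M < l.+1) (1 / 2) ^+ M)); last first.
    have K : \sum_(M < l.+1) ((1 / 2) ^+ M : R) = 2 - (1 / 2) ^+ l.
      elim: (l) => [|n IH]; first by rewrite big_ord1 !expr0; lra.
      by rewrite big_ord_recr/= IH exprS; lra.
    by rewrite K gerBl exprn_ge0.
  apply: ler_sum => M _; rewrite Ex_sum.
  apply: (@le_trans _ _ (\sum_(c <- tuples_of L M)
     expR 1 ^+ M * p ^+ M * expR (- s * (walk_length z c)%:R))).
    rewrite big_seq [leRHS]big_seq; apply: ler_sum => c /size_tuples_of sc.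
    rewrite /wt sc.
    have -> : (fun x => (pairwise far c)%:R * (all (bad^~ x) c)%:R *
       (expR M%:R * expR (- s * (walk_length z c)%:R))) =
      (fun x => ((pairwise far c)%:R * (expR M%:R * expR (- s * (walk_length z c)%:R)))
          * (all (bad^~ x) c)%:R).
      by apply/funext => x; ring.
    rewrite ExZ.
    have eM : expR M%:R = expR 1 ^+ M :> R by rewrite -expRM_natl mulr1.
    case: (boolP (pairwise far c)) => [fc|_]; last first.
      by rewrite !mul0r !mulr_ge0 ?expR_ge0// ?exprn_ge0// expR_ge0.
    rewrite mul1r eM -!mulrA ler_wpM2l ?exprn_ge0 ?expR_ge0//.
    rewrite mulrC ler_wpM2r ?expR_ge0// -sc; exact: all_bad_prob.
  rewrite -mulr_sumr -exprMn.
  apply: (@le_trans _ _ ((expR 1 * p) ^+ M * (cA%:R * (3 / s) ^+ d) ^+ M)).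
    rewrite ler_wpM2l ?chain_generating//.
    by rewrite exprn_ge0// mulr_ge0// expR_ge0.
  rewrite -exprMn lerXn2r ?nnegrE//.
  by rewrite !mulr_ge0 ?expR_ge0// exprn_ge0// divr_ge0// ltW.
have key x : (size (greedy far (bad^~ x) (g x)))%:R <= s * l%:R + Z x.
  set c := greedy far _ _.
  have sc : subseq c (g x) by exact: greedy_subseq.
  have cl : (walk_length z c <= l)%N.
    exact: leq_trans (walk_length_subseq _ sc) (gl x).
  have szc : (size c < l.+1)%N.
    by rewrite ltnS; apply: leq_trans (gsz x); exact: size_subseq.
  have cZ : expR (size c)%:R * expR (- s * (walk_length z c)%:R) <= Z x.
    rewrite /Z (bigD1 (Ordinal szc))//= -[leLHS]addr0; apply: lerD; last first.
      by apply: sumr_ge0 => M _; apply: sumr_ge0.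
    apply: le_trans (@mem_le_sum _ _ (wt x) _ c (wt0 x) (mem_tuples_of _)).
      by rewrite /wt greedy_far greedy_all !mul1r.
    move=> j jc; apply: mem_carriers.
    apply: leq_trans cl; exact: site_dist_walk.
  apply: (@le_trans _ _ (s * l%:R + expR ((size c)%:R - s * (walk_length z c)%:R))).
    have := expR_ge1Dx ((size c)%:R - s * (walk_length z c)%:R).
    have : s * (walk_length z c)%:R <= s * l%:R by rewrite ler_pM2l// ler_nat.
    lra.
  by rewrite lerD2l expRD -mulNr.
apply: le_trans (ler_Ex q_ge0 key) _.
by rewrite ExD Ex_cst// lerD2l.
Qed.

(** A union bound over all carriers within reach, efficient when bad carriers
    are so rare that the whole neighbourhood contains less than one in mean. *)
Lemma chain_union (g : {ffun W -> S} -> seq J) z (l : nat) :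
  (forall x, walk_length z (g x) <= l)%N ->
  E (fun x => (size (greedy far (bad^~ x) (g x)))%:R) <=
  p * (cA * l.*2.+1 ^ d)%:R.
Proof.
move=> gl; pose L := carriers z l.
apply: (@le_trans _ _ (E (fun x => \sum_(b <- L) (bad b x)%:R))).
  apply: ler_Ex => // x; set c := greedy far _ _.
  have -> : (size c)%:R = \sum_(b <- c) (bad b x)%:R :> R.
    rewrite -sum1_size natr_sum big_seq [RHS]big_seq; apply: eq_bigr => b bc.
    by rewrite (allP (greedy_all far (bad^~ x) (g x)) _ bc).
  apply: sum_uniq_subset => //; first exact: greedy_uniq.
  move=> b bc; apply: mem_carriers; apply: leq_trans (gl x).
  by apply: site_dist_walk; exact: (mem_subseq (greedy_subseq _ _ _) bc).
rewrite Ex_sum; apply: (@le_trans _ _ (\sum_(b <- L) p)).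
  by apply: ler_sum => b _; exact: bad_prob.
rewrite big_const_seq count_predT iter_addr_0 -(mulr_natr p (size L)) ler_wpM2l// ler_nat.
exact: size_carriers.
Qed.

Variables (c1 rho : R).
Hypothesis c1_ge0 : 0 <= c1.
Hypothesis rho_gt0 : 0 < rho.
Hypothesis p_le : p <= c1 * rho ^+ d.
Hypothesis d_gt0 : (0 < d)%N.

(** With [s = chain_const * rho] the step weight in [chain_exponential] is at most
    [1 / 2]. *)
Definition chain_const : R := 3 * (1 + 2 * expR 1 * c1 * cA%:R).

(** If [p] is of order [rho ^+ d], a path of length [l] meets at most of the
    order of [rho * l] pairwise distant bad carriers in mean. *)
Lemma mean_chain_size (g : {ffun W -> S} -> seq J) z (l : nat) :
  (forall x, walk_length z (g x) <= l)%N ->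
  (forall x, size (g x) <= l)%N ->
  E (fun x => (size (greedy far (bad^~ x) (g x)))%:R) <=
  3 * chain_const * rho * l%:R.
Proof.
move=> gl gsz.
pose K : R := 1 + 2 * expR 1 * c1 * cA%:R.
have e1 : 1 <= expR 1 :> R by have := @expR_ge1Dx R 1; lra.
have cc0 : 0 <= c1 * cA%:R by rewrite mulr_ge0.
have K1 : 1 <= K by rewrite lerDl -!mulrA mulr_ge0// mulr_ge0// expR_ge0.
have K0 : 0 < K by lra.
have cK : expR 1 * (c1 * cA%:R) <= K / 2 by rewrite /K; lra.
have KV : K^-1 ^+ d <= K^-1.
  case: (d) d_gt0 => // n _; rewrite exprS ler_piMr ?invr_ge0 ?(ltW K0)//.
  by rewrite exprn_ile1 ?invr_ge0 ?(ltW K0)// invf_le1.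
pose s := 3 * K * rho.
have s0 : 0 < s by rewrite !mulr_gt0.
have -> : 3 * chain_const * rho * l%:R = 3 * (s * l%:R).
  by rewrite /chain_const -/K /s; ring.
have sl0 : 0 <= s * l%:R by rewrite mulr_ge0// ltW.
(* if [1 < s], the bound exceeds the number [l] of all carriers on the path *)
have [s1|s1] := leP s 1; last first.
  apply: (@le_trans _ _ (E (fun=> l%:R))).
    apply: ler_Ex => // x; rewrite ler_nat; apply: leq_trans (gsz x).
    by apply: size_subseq; exact: greedy_subseq.
  rewrite Ex_cst//.
  have : 1 * l%:R <= s * l%:R by rewrite ler_wpM2r// ltW.
  lra.
(* the additive constant of [chain_exponential] is harmless for [1 <= s * l];
   otherwise the union bound is of order [(s * l) ^+ d <= s * l] *)
have [sl1|sl1] := leP 1 (s * l%:R).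
  apply: (le_trans (chain_exponential s0 s1 gl gsz _)); last lra.
  apply: (@le_trans _ _ (expR 1 * (c1 * rho ^+ d) * (cA%:R * (3 / s) ^+ d))).
    rewrite ler_wpM2r ?mulr_ge0 ?exprn_ge0 ?divr_ge0 ?(ltW s0)//.
    by rewrite ler_wpM2l ?expR_ge0.
  have -> : 3 / s = K^-1 * rho^-1.
    by rewrite /s; field; rewrite !gt_eqF.
  rewrite exprMn (exprVn rho).
  have -> : expR 1 * (c1 * rho ^+ d) * (cA%:R * (K^-1 ^+ d * (rho ^+ d)^-1)) =
     expR 1 * (c1 * cA%:R) * K^-1 ^+ d.
    by field; rewrite expf_neq0// gt_eqF.
  apply: (@le_trans _ _ (K / 2 * K^-1)); last first.
    by rewrite mulrAC divff ?gt_eqF// mul1r; lra.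
  by apply: ler_pM => //; rewrite ?exprn_ge0 ?invr_ge0 ?(ltW K0)// mulr_ge0// expR_ge0.
have [l0|l0] := posnP l.
  apply: (@le_trans _ _ (E (fun=> 0))); last by rewrite Ex_cst// mulr_ge0.
  apply: ler_Ex => // x; have := gsz x; rewrite l0.
  by case: (g x).
apply: le_trans (chain_union gl) _.
apply: (@le_trans _ _ (c1 * cA%:R * (3 * (rho * l%:R)) ^+ d)).
  have -> : c1 * cA%:R * (3 * (rho * l%:R)) ^+ d =
     (c1 * rho ^+ d) * (cA%:R * (3 * l%:R) ^+ d).
    by rewrite !exprMn; ring.
  apply: ler_pM => //; rewrite natrM ler_wpM2l// natrX.
  rewrite lerXn2r ?nnegrE ?mulr_ge0//.
  by rewrite -natrM ler_nat -addnn; move: l0; clear; lia.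
have -> : 3 * (rho * l%:R) = K^-1 * (s * l%:R).
  by rewrite /s; field; rewrite gt_eqF.
rewrite exprMn (mulrA (c1 * cA%:R)).
apply: (@le_trans _ _ (1 * (s * l%:R))); last lra.
apply: ler_pM; rewrite ?mulr_ge0 ?exprn_ge0 ?invr_ge0 ?(ltW K0)//; last first.
  case: (d) d_gt0 => // n _; rewrite exprS ler_piMr//.
  by rewrite exprn_ile1// ltW.
apply: (@le_trans _ _ (K * K^-1)); last by rewrite divff// gt_eqF.
apply: ler_pM => //; rewrite ?exprn_ge0 ?invr_ge0 ?(ltW K0)//.
have : 1 * (c1 * cA%:R) <= expR 1 * (c1 * cA%:R) by rewrite ler_wpM2r.
lra.
Qed.

End Chains.
End Carriers.

(** * Influences of the variables on averaged passage times *)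

Lemma sum_count_mem (J : eqType) (f : J -> nat) (l U : seq J) : uniq U ->
  {subset l <= U} -> (\sum_(j <- l) f j = \sum_(j <- U) count_mem j l * f j)%N.
Proof.
move=> uU; elim: l => [_|b l IH sU]; first by rewrite big_nil big1.
rewrite big_cons IH; last by move=> j jl; apply: sU; rewrite in_cons jl orbT.
under [RHS]eq_bigr do rewrite /= mulnDl.
rewrite big_split/=; congr (_ + _)%N.
rewrite (bigD1_seq b)//= ?eqxx ?mul1n; last by apply: sU; rewrite mem_head.
by rewrite big1 ?addn0// => j /negPf; rewrite eq_sym => ->.
Qed.

Lemma sum_inv_sqr (R : realType) n : \sum_(k < n) (k.+1%:R ^+ 2)^-1 <= 2 :> R.
Proof.
case: n => [|n]; first by rewrite big_ord0.
suff : \sum_(k < n.+1) (k.+1%:R ^+ 2)^-1 <= 2 - n.+1%:R^-1 :> R.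
  by move=> /le_trans; apply; rewrite gerBl invr_ge0.
elim: n => [|n IH]; first by rewrite big_ord1 expr1n invr1; lra.
rewrite big_ord_recr/=; apply: le_trans (lerD IH (lexx _)) _.
set u : R := n.+1%:R; have u1 : 1 <= u by rewrite ler1n.
have -> : n.+2%:R = u + 1 :> R by rewrite /u natr1.
have : ((u + 1) ^+ 2)^-1 <= (u * (u + 1))^-1 by rewrite lef_pV2 ?posrE; nra.
have -> : (u * (u + 1))^-1 = u^-1 - (u + 1)^-1.
  by field; apply/andP; split; rewrite gt_eqF//; lra.
by move: (_ ^- 2) (u^-1) ((u + 1)^-1) => x y z; lra.
Qed.

Section Influences.
Variables (R : realType) (d : nat) (J : eqType).
Variables (pos : J -> 'rV[int]_d) (at_pos : 'rV[int]_d -> seq J) (cA : nat).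
Hypothesis mem_at_pos : forall j, j \in at_pos (pos j).
Hypothesis pos_at_pos : forall v j, j \in at_pos v -> pos j = v.
Hypothesis size_at_pos : forall v, (size (at_pos v) <= cA)%N.
Variables (W S : finType) (q : S -> R).
Hypothesis q_ge0 : forall s, 0 <= q s.
Hypothesis q_sum1 : \sum_s q s = 1.
Local Notation Om := {ffun W -> S}.
Local Notation E := (Ex q).

(** [A j k] is the set of the first [k] variables inspected for the carrier [j],
    and [lambda] is the separation constant. The probability that [k] variables do
    not suffice is of order [rho k ^+ d], with [rho k] decaying faster than the
    inverse cube of [k]. *)
Variables (h : J -> Om -> R) (A : J -> nat -> pred W) (K lambda : nat).
Variables (c1 : R) (rho : nat -> R) (crho : R).
Hypothesis d_ge2 : (2 <= d)%N.
Hypothesis A_mono : forall j k k' i, (k <= k')%N -> A j k i -> A j k' i.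
Hypothesis A_card : forall j k, (\sum_i (A j k i : nat) <= k)%N.
Hypothesis A_disjoint : forall j j' k i,
  (lambda * k < site_dist (pos j) (pos j'))%N -> A j k i -> ~~ A j' k i.

(** It is enough to compare [x] with the configurations agreeing with it on
    [A j k]: two of these with different values cannot both agree with [h j x]. *)
Definition undetermined j k (x : Om) : bool :=
  [exists y : Om, [forall i, A j k i ==> (y i == x i)] && (h j y != h j x)].

Hypothesis undetermined_K : forall j x, ~~ undetermined j K x.
Hypothesis c1_ge0 : 0 <= c1.
Hypothesis rho_gt0 : forall k, 0 < rho k.
Hypothesis rho_cube : forall k, (k.+1%:R) ^+ 3 * rho k <= 1.
Hypothesis rho_sum : forall n, \sum_(k < n) k.+1%:R ^+ 2 * rho k <= crho.
Hypothesis undetermined_prob : forall j k,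
  E (fun x => (undetermined j k x)%:R) <= c1 * rho k ^+ d.

Lemma A0 j i : A j 0 i = false.
Proof.
apply/negbTE/negP => Ai; have := A_card j 0.
by rewrite (bigD1 i)//= Ai.
Qed.

Lemma undetermined_depends j k (x y : Om) : (forall i, A j k i -> x i = y i) ->
  undetermined j k x = undetermined j k y.
Proof.
suff K1 (u v : Om) : (forall i, A j k i -> u i = v i) ->
    undetermined j k u -> undetermined j k v.
  by move=> xy; apply/idP/idP; apply: K1 => // i /xy.
move=> uv /existsP[w /andP[/forallP wu hw]]; apply/existsP.
have [e|e] := eqVneq (h j w) (h j v).
  exists u; apply/andP; split; last by rewrite -e eq_sym.
  by apply/forallP => i; apply/implyP => /uv ->.
exists w; rewrite e andbT; apply/forallP => i; apply/implyP => Ai.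
by rewrite -uv//; exact: (implyP (wu i)).
Qed.

Definition influenced i j (x : Om) : bool :=
  [exists s, h j (upd i s x) != h j x].

Lemma influenced_undetermined i j k x :
  influenced i j x -> ~~ A j k i -> undetermined j k x.
Proof.
move=> /existsP[s hs] Ai; apply/existsP; exists (upd i s x); rewrite hs andbT.
apply/forallP => i'; apply/implyP => Ai'; rewrite ffunE.
have [ii|_] := eqVneq i' i; last exact: eqxx.
by move: Ai; rewrite -ii Ai'.
Qed.

Lemma ex_determined j x : exists k, ~~ undetermined j k x.
Proof. by exists K. Qed.

(** A variable can influence [h j] at [x] only if it is among the first
    [radius j x] ones; see [influenced_radius]. *)
Definition radius j x : nat := ex_minn (ex_determined j x).

Lemma radius_leK j x : (radius j x <= K)%N.
Proof. rewrite /radius; case: ex_minnP => k _ H; exact: H. Qed.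

Lemma lt_radius j x k : (k < radius j x)%N -> undetermined j k x.
Proof.
rewrite /radius; case: ex_minnP => r _ hr kr; apply: contraT => nu.
by have := hr k nu; rewrite leqNgt kr.
Qed.

Lemma influenced_radius i j x : influenced i j x -> A j (radius j x) i.
Proof.
move=> ix; apply: contraT => /(influenced_undetermined ix).
by rewrite /radius; case: ex_minnP => k /negPf ->.
Qed.

Lemma sqr_radius_le j x :
  (radius j x ^ 2 <= \sum_(k < K) k.*2.+1 * (undetermined j k x))%N.
Proof.
have -> : (radius j x ^ 2 = \sum_(k < radius j x) k.*2.+1)%N.
  elim: (radius j x) => [|n IH]; first by rewrite big_ord0.
  by rewrite big_ord_recr/= -IH -addnn; lia.
rewrite (big_ord_widen _ (fun k => k.*2.+1) (radius_leK j x)) big_mkcond/=.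
by apply: leq_sum => k _; case: ifP => // /lt_radius ->; rewrite muln1.
Qed.

(** ** One family of geodesics *)
Section Geodesic.
Variables (g : Om -> seq J) (z : 'rV[int]_d) (l cN : nat).
Hypothesis g_size : forall x, (size (g x) <= l)%N.
Hypothesis g_walk : forall x, (walk_length pos z (g x) <= l)%N.
Hypothesis g_near : forall x u r,
  (count (fun j => site_dist (pos j) u <= r) (g x) <= cN * r.+1)%N.

Definition influenced_count i x : nat := count (influenced i ^~ x) (g x).

(** Group the pairs of carriers influenced by a common variable according to
    the larger of the two radii: a partner lies within a multiple of that radius,
    and the number of partners on a geodesic is linear in it. *)
Lemma sum_sqr_influenced x :
  (\sum_i influenced_count i x ^ 2 <=
   2 * (cN * lambda.+1) * \sum_(j <- g x) radius j x ^ 2)%N.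
Proof.
pose t j j' := (\sum_i (A j (radius j x) i && A j' (radius j' x) i))%N.
pose t' j j' := (\sum_i (A j (radius j x) i && A j' (radius j x) i))%N.
have step1 : (\sum_i influenced_count i x ^ 2 <=
    \sum_(j <- g x) \sum_(j' <- g x) t j j')%N.
  rewrite /t; under [leqRHS]eq_bigr do rewrite exchange_big/=.
  rewrite exchange_big/=; apply: leq_sum => i _.
  rewrite /influenced_count -sum1_count big_mkcond/= -mulnn big_distrl/=.
  apply: leq_sum => j _; rewrite big_distrr/=; apply: leq_sum => j' _.
  case: ifP => // /influenced_radius ->; rewrite mul1n.
  by case: ifP => // /influenced_radius ->.
have step2 : (\sum_(j <- g x) \sum_(j' <- g x) t j j' <=
    2 * \sum_(j <- g x) \sum_(j' <- g x) t' j j')%N.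
  rewrite mul2n -addnn [X in (_ <= _ + X)%N]exchange_big/= -big_split/=.
  apply: leq_sum => j _; rewrite -big_split/=; apply: leq_sum => j' _.
  have [le|/ltnW le] := leqP (radius j' x) (radius j x).
    apply: leq_trans (leq_addr _ _); apply: leq_sum => i _.
    case: (A j _ i) => //=; case E1: (A j' _ i) => //.
    by rewrite (A_mono le E1).
  apply: leq_trans (leq_addl _ _); apply: leq_sum => i _.
  case E1: (A j _ i) => //=; rewrite (A_mono le E1) andbT.
  by case: (A j' _ i).
apply: leq_trans step1 (leq_trans step2 _).
rewrite -mulnA leq_mul2l/= big_distrr/=; apply: leq_sum => j _.
set r := radius j x.
have t'0 j' : (lambda * r < site_dist (pos j) (pos j'))%N -> t' j j' = 0%N.
  move=> far; rewrite /t' big1// => i _; rewrite -/r.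
  by case E1: (A j r i) => //=; rewrite (negPf (A_disjoint far E1)).
have t'r j' : (t' j j' <= r)%N.
  rewrite /t'; apply: leq_trans (A_card j r); apply: leq_sum => i _.
  by rewrite -/r; case: (A j r i); case: (A j' r i).
apply: (@leq_trans (\sum_(j' <- g x) r * (site_dist (pos j') (pos j) <= lambda * r))%N).
  apply: leq_sum => j' _; rewrite site_dist_sym.
  have [_|far] := leqP (site_dist (pos j) (pos j')) (lambda * r).
    by rewrite muln1 t'r.
  by rewrite (t'0 _ far).
rewrite -big_distrr/=.
have -> : (\sum_(j' <- g x) (site_dist (pos j') (pos j) <= lambda * r) =
    count (fun j' => site_dist (pos j') (pos j) <= lambda * r) (g x))%N.
  by rewrite -sum1_count [RHS]big_mkcond/=; apply: eq_bigr => j' _; case: leqP.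
have [->//|r0] := posnP r.
apply: (@leq_trans (r * (cN * (lambda * r).+1))%N); first by rewrite leq_mul2l g_near orbT.
rewrite -mulnn [leqRHS]mulnA [leqRHS]mulnC leq_mul2l -mulnA leq_mul2l.
by apply/orP; right; apply/orP; right; rewrite mulSn addnC -addn1 leq_add2l.
Qed.

Definition energy_const : R :=
  12 * (cN * lambda.+1)%:R ^+ 2 * chain_const cA c1 * crho.

Lemma chain_const_ge0 : 0 <= chain_const cA c1.
Proof.
by rewrite mulr_ge0// addr_ge0// !mulr_ge0// expR_ge0.
Qed.

(** The undetermined carriers of a geodesic lie near the members of a chain of
    distant ones, whose number [mean_chain_size] bounds; near each of them the
    geodesic has of the order of [k] carriers. *)
Lemma mean_undetermined_count k :
  E (fun x => (count (fun j => undetermined j k x) (g x))%:R) <=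
  3 * (cN * lambda.+1)%:R * chain_const cA c1 * (k.+1%:R * rho k) * l%:R.
Proof.
pose far j j' := (lambda * k < site_dist (pos j) (pos j'))%N.
have far_irr j : ~~ far j j by rewrite /far site_distvv.
apply: (@le_trans _ _ (E (fun x => (cN * (lambda * k).+1)%:R *
   (size (greedy far (fun j => undetermined j k x) (g x)))%:R))).
  apply: ler_Ex => // x; rewrite -natrM ler_nat; apply: count_le_greedy => //.
  move=> b _; apply: leq_trans (g_near x (pos b) (lambda * k)).
  by apply/eq_leq/eq_count => j; rewrite /far -leqNgt.
rewrite ExZ.
apply: (@le_trans _ _ ((cN * lambda.+1 * k.+1)%:R *
    (3 * chain_const cA c1 * rho k * l%:R))); last first.
  by rewrite natrM le_eqVlt; apply/orP; left; apply/eqP; ring.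
apply: ler_pM => //.
- by apply: Ex_ge0.
- rewrite ler_nat -mulnA leq_mul2l; apply/orP; right.
  by rewrite mulSn mulnS; lia.
have dp : (0 < d)%N by apply: ltn_trans d_ge2.
apply: (mean_chain_size mem_at_pos pos_at_pos size_at_pos q_ge0 q_sum1
  (bad := fun j x => undetermined j k x) (A := fun j => A j k)
  (p := c1 * rho k ^+ d)) => //.
- by rewrite mulr_ge0// exprn_ge0// ltW.
- by move=> j x y; exact: undetermined_depends.
- by move=> j b i; exact: A_disjoint.
Qed.

(** Write the square of a radius [r] as the sum of [2 * k + 1] over [k < r]. The
    term [k] contributes of the order of [k * (k * rho k) * l] in mean, which is
    summable: here the decay of [rho] is used in full. *)
Lemma mean_sum_sqr_influenced :
  E (fun x => \sum_i (influenced_count i x)%:R ^+ 2) <= energy_const * l%:R.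
Proof.
pose N := (cN * lambda.+1)%N.
apply: (@le_trans _ _ (E (fun x => (2 * N)%:R * \sum_(k < K)
   (k.*2.+1)%:R * (count (fun j => undetermined j k x) (g x))%:R))).
  apply: ler_Ex => // x.
  have -> : \sum_i (influenced_count i x)%:R ^+ 2 =
      (\sum_i influenced_count i x ^ 2)%:R :> R.
    by rewrite natr_sum; apply: eq_bigr => i _; rewrite natrX.
  under [X in _ <= _ * X]eq_bigr do rewrite -natrM.
  rewrite -natr_sum -natrM ler_nat; apply: leq_trans (sum_sqr_influenced x) _.
  rewrite -/N leq_mul2l; apply/orP; right.
  apply: (@leq_trans (\sum_(j <- g x) \sum_(k < K) k.*2.+1 * (undetermined j k x))%N).
    by apply: leq_sum => j _; exact: sqr_radius_le.
  rewrite exchange_big/=; apply: leq_sum => k _.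
  rewrite -big_distrr/= leq_mul2l -sum1_count [leqRHS]big_mkcond/=.
  by apply: leq_sum => j _; case: undetermined.
rewrite ExZ Ex_sum.
apply: (@le_trans _ _ ((2 * N)%:R * \sum_(k < K)
  (6 * N%:R * chain_const cA c1 * l%:R) * (k.+1%:R ^+ 2 * rho k))).
  rewrite ler_wpM2l//; apply: ler_sum => k _; rewrite ExZ.
  apply: (@le_trans _ _ ((2 * k.+1)%:R * (3 * N%:R * chain_const cA c1 *
     (k.+1%:R * rho k) * l%:R))).
    apply: ler_pM => //; first exact: Ex_ge0.
      by rewrite ler_nat -addnn; lia.
    exact: mean_undetermined_count.
  by rewrite natrM le_eqVlt; apply/orP; left; apply/eqP; ring.
rewrite -mulr_sumr /energy_const -/N.
have c0 : 0 <= 6 * N%:R * chain_const cA c1 * l%:R.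
  by rewrite mulr_ge0// mulr_ge0 ?chain_const_ge0.
apply: (@le_trans _ _ ((2 * N)%:R * (6 * N%:R * chain_const cA c1 * l%:R * crho))).
  by rewrite ler_wpM2l// ler_wpM2l.
by rewrite natrM le_eqVlt; apply/orP; left; apply/eqP; ring.
Qed.

End Geodesic.

(** ** The average over starting points *)
Section Averaged.
Variables (Box : seq 'rV[int]_d) (g : 'rV[int]_d -> Om -> seq J).
Variables (T : 'rV[int]_d -> Om -> R) (a b cT : R) (l cN M : nat).
Hypothesis Box_gt0 : (0 < size Box)%N.
Hypothesis ab : a <= b.
Hypothesis h_itv : forall j x, a <= h j x <= b.
Hypothesis g_size : forall z x, (size (g z x) <= l)%N.
Hypothesis g_walk : forall z x, (walk_length pos z (g z x) <= l)%N.
Hypothesis g_near : forall z x u r,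
  (count (fun j => site_dist (pos j) u <= r) (g z x) <= cN * r.+1)%N.
Hypothesis T_g : forall z x, T z x = \sum_(j <- g z x) h j x.
Hypothesis T_le : forall z x y, T z y <= \sum_(j <- g z x) h j y.
Hypothesis M_gt0 : (0 < M)%N.
Hypothesis cT_ge0 : 0 <= cT.
(** This smallness is what the average over starting points achieves. *)
Hypothesis Box_visits : forall j,
  (size Box)%:R^-1 * (\sum_(z <- Box) E (fun x => (count_mem j (g z x))%:R))
    <= cT / M%:R ^+ 3.

Local Notation mean u := ((size Box)%:R^-1 * (\sum_(z <- Box) u z)).

Definition averaged x : R := mean (fun z => T z x).

Definition influence_bound i x : R :=
  (b - a) * mean (fun z => (influenced_count (g z) i x)%:R).

Let nB_gt0 : 0 < (size Box)%:R :> R. Proof. by rewrite ltr0n. Qed.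

Lemma ler_mean (u v : 'rV[int]_d -> R) : (forall z, u z <= v z) ->
  mean u <= mean v.
Proof.
by move=> uv; rewrite ler_wpM2l ?invr_ge0 ?ler0n//; apply: ler_sum.
Qed.

Lemma mean_ge0 (u : 'rV[int]_d -> R) : (forall z, 0 <= u z) -> 0 <= mean u.
Proof. by move=> u0; rewrite mulr_ge0 ?invr_ge0 ?ler0n// sumr_ge0. Qed.

Lemma mean_cst (c : R) : mean (fun=> c) = c.
Proof.
rewrite big_const_seq count_predT iter_addr_0 -(mulr_natl c) mulrA mulVf ?mul1r//.
by rewrite gt_eqF.
Qed.

Lemma sqr_mean_le (u : 'rV[int]_d -> R) : mean u ^+ 2 <= mean (fun z => u z ^+ 2).
Proof.
set c := mean u.
have : 0 <= mean (fun z => (u z - c) ^+ 2) by apply: mean_ge0 => z; exact: sqr_ge0.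
have -> : mean (fun z => (u z - c) ^+ 2) =
    mean (fun z => u z ^+ 2) - 2 * c * c + mean (fun=> c ^+ 2).
  rewrite {3}/c -[X in _ - X]mulrCA -mulrBr -mulrDr; congr (_ * _).
  by rewrite mulr_sumr -sumrB -big_split/=; apply: eq_bigr => z _; ring.
rewrite mean_cst; lra.
Qed.

Lemma Ex_mean (u : 'rV[int]_d -> Om -> R) :
  E (fun x => mean (fun z => u z x)) = mean (fun z => E (u z)).
Proof. by rewrite ExZ Ex_sum. Qed.

Lemma influence_bound_ge0 i x : 0 <= influence_bound i x.
Proof. by rewrite mulr_ge0 ?subr_ge0//; apply: mean_ge0 => z; rewrite ler0n. Qed.

Lemma averaged_resample i x s :
  averaged (upd i s x) - averaged x <= influence_bound i x.
Proof.
rewrite /averaged /influence_bound -mulrBr -sumrB mulrCA ler_wpM2l ?invr_ge0 ?ler0n//.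
rewrite mulr_sumr; apply: ler_sum => z _.
rewrite (T_g z x); apply: (@le_trans _ _ (\sum_(j <- g z x) (h j (upd i s x) - h j x))).
  by rewrite sumrB lerD2r.
rewrite /influenced_count -sum1_count natr_sum mulr_sumr [leRHS]big_mkcond/=.
apply: ler_sum => j _; case: ifP => [_|/negbT].
  by have := h_itv j x; have := h_itv j (upd i s x); rewrite mulr1; lra.
by rewrite negb_exists => /forallP/(_ s)/negPn/eqP ->; rewrite subrr.
Qed.

Lemma mean_energy : mean (fun z =>
    E (fun x => \sum_i (influenced_count (g z) i x)%:R ^+ 2)) <=
  energy_const cN * l%:R.
Proof.
rewrite -[leRHS]mean_cst; apply: ler_mean => z.
exact: (mean_sum_sqr_influenced (g_size z) (g_walk z) (g_near z)).
Qed.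

Lemma averaged_L2 :
  \sum_i E (fun x => (averaged x - avg q i averaged x) ^+ 2) <=
  2 * (b - a) ^+ 2 * energy_const cN * l%:R.
Proof.
apply: (@le_trans _ _ (\sum_i 2 * E (fun x => influence_bound i x ^+ 2))).
  apply: ler_sum => i _; apply: influence_L2 => //.
    by move=> x s; exact: averaged_resample.
  by move=> x; exact: influence_bound_ge0.
rewrite -mulr_sumr.
have -> : 2 * (b - a) ^+ 2 * energy_const cN * l%:R =
    2 * ((b - a) ^+ 2 * (energy_const cN * l%:R)) by ring.
rewrite ler_wpM2l//.
apply: (@le_trans _ _ ((b - a) ^+ 2 * mean (fun z =>
    E (fun x => \sum_i (influenced_count (g z) i x)%:R ^+ 2)))); last first.
  by rewrite ler_wpM2l ?sqr_ge0//; exact: mean_energy.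
rewrite -Ex_mean -ExZ -Ex_sum; apply: ler_Ex => // x.
rewrite exchange_big/= mulr_sumr mulr_sumr; apply: ler_sum => i _.
rewrite /influence_bound exprMn ler_wpM2l ?sqr_ge0//; exact: sqr_mean_le.
Qed.

Definition visit_const : R :=
  2 * cA%:R * (2 * lambda.+1)%:R ^+ d * (cT + cN%:R * c1).

(** The carriers for which a given variable is among the first [k] inspected
    number at most of the order of [k ^ d]. Each is visited and influenced with a
    small probability: by the average over the starting points if [k] is small,
    by rarity of large radii if [k] is large. *)
Lemma influence_bound_small i :
  E (influence_bound i) <= (b - a) * (visit_const / M%:R).
Proof.
rewrite /influence_bound ExZ ler_wpM2l ?subr_ge0// Ex_mean.
pose U := undup (flatten [seq g z x | z <- Box, x <- enum Om]).
pose c j := mean (fun z => E (fun x => (count_mem j (g z x))%:R * (influenced i j x)%:R)).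
apply: (@le_trans _ _ (\sum_(j <- U) c j)).
  rewrite /c -mulr_sumr ler_wpM2l ?invr_ge0// [leRHS]exchange_big/= big_seq [leRHS]big_seq.
  apply: ler_sum => z zB; rewrite -Ex_sum; apply: ler_Ex => // x.
  under eq_bigr do rewrite -natrM.
  rewrite -natr_sum ler_nat /influenced_count -sum1_count big_mkcond/=.
  rewrite (@sum_count_mem _ _ _ U (undup_uniq _)); last first.
    move=> j jg; rewrite mem_undup; apply/flattenP; exists (g z x) => //.
    by apply/allpairsP; exists (z, x); rewrite mem_enum.
  by apply: leq_sum => j _; case: influenced.
have c_visit j : c j <= cT / M%:R ^+ 3.
  apply: le_trans (Box_visits j); apply: ler_mean => z; apply: ler_Ex => // x.
  by rewrite ler_piMr//; case: influenced.
have c_infl j : c j <= cN%:R * E (fun x => (influenced i j x)%:R).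
  rewrite -[leRHS]mean_cst; apply: ler_mean => z; rewrite -ExZ; apply: ler_Ex => // x.
  rewrite ler_wpM2r// ler_nat -[cN]muln1; apply: leq_trans (g_near z x (pos j) 0).
  by apply: sub_count => j' /= /eqP ->; rewrite site_distvv.
set B := cT + cN%:R * c1.
have B0 : 0 <= B by rewrite addr_ge0// mulr_ge0.
have M0 : 0 < M%:R :> R by rewrite ltr0n.
pose v k : R := B / (M%:R * (k.+1%:R ^+ d) ^+ 2).
have v0 k : 0 <= v k by rewrite divr_ge0// mulr_ge0// sqr_ge0.
(* [k] is the last number of variables which does not include [i]: the first
   bound on [c j] is used if [k.+1 ^ d <= M], the second one otherwise *)
have cjv j : c j <= \sum_(k < K) (A j k.+1 i)%:R * v k.
  have [AK|AK] := boolP (A j K i); last first.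
    have -> : c j = 0.
      rewrite /c -[RHS]mean_cst; congr (_ * _); apply: eq_bigr => z _.
      rewrite -[RHS](Ex_cst W q_sum1); apply: eq_Ex => x.
      case E1: (influenced i j x); last by rewrite mulr0.
      by have := influenced_undetermined E1 AK; rewrite (negPf (undetermined_K j x)).
    by apply: sumr_ge0 => k _; rewrite mulr_ge0.
  have [k0 Ak0 k0min] := ex_minnP (ex_intro (A j ^~ i) K AK).
  case: k0 Ak0 k0min => [|k]; first by rewrite A0.
  move=> Ak kmin; have kK : (k < K)%N by exact: kmin.
  have Ak' : ~~ A j k i by apply/negP => /kmin; rewrite ltnn.
  rewrite (bigD1 (Ordinal kK))//= Ak mul1r -[c j]addr0; apply: lerD; last first.
    by apply: sumr_ge0 => k' _; rewrite mulr_ge0.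
  set u : R := k.+1%:R; have u1 : 1 <= u by rewrite ler1n.
  have ud1 : 1 <= u ^+ d by rewrite exprn_ege1.
  have ud0 : 0 < u ^+ d by lra.
  have [uM|Mu] := leP (u ^+ d) M%:R.
    apply: le_trans (c_visit j) _; rewrite /v -/u; apply: ler_pM => //.
    - by rewrite lerDl mulr_ge0.
    - rewrite lef_pV2 ?posrE ?mulr_gt0 ?exprn_gt0//.
      rewrite [leRHS]exprS ler_pM2l//.
      by rewrite lerXn2r ?nnegrE ?(ltW ud0).
  apply: le_trans (c_infl j) _.
  apply: (@le_trans _ _ (cN%:R * (c1 * rho k ^+ d))).
    rewrite ler_wpM2l//; apply: le_trans (undetermined_prob j k).
    apply: ler_Ex => // x; rewrite ler_nat.
    by case E1: (influenced i j x) => //; rewrite (influenced_undetermined E1 Ak').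
  have rd : rho k ^+ d <= (M%:R * (u ^+ d) ^+ 2)^-1.
    apply: (@le_trans _ _ ((u ^+ d) ^+ 3)^-1).
      rewrite -[leRHS]mul1r ler_pdivlMr ?exprn_gt0//.
      rewrite -exprM mulnC exprM -exprMn mulrC exprn_ile1//; last exact: rho_cube.
      by rewrite mulr_ge0 ?exprn_ge0// ltW.
    rewrite lef_pV2 ?posrE ?mulr_gt0 ?exprn_gt0// [leRHS]exprS.
    by rewrite ler_pM2r ?exprn_gt0// ltW.
  rewrite /v -/u mulrA; apply: ler_pM => //.
  - by rewrite mulr_ge0.
  - by rewrite exprn_ge0// ltW.
  - by rewrite lerDr.
apply: (@le_trans _ _ (\sum_(j <- U) \sum_(k < K) (A j k.+1 i)%:R * v k)).
  by apply: ler_sum => j _; exact: cjv.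
rewrite exchange_big/=.
pose cc : R := cA%:R * (2 * lambda.+1)%:R ^+ d * B / M%:R.
have cc0 : 0 <= cc by rewrite divr_ge0// !mulr_ge0// exprn_ge0.
apply: (@le_trans _ _ (\sum_(k < K) cc * (k.+1%:R ^+ 2)^-1)); last first.
  rewrite -mulr_sumr /visit_const -/B.
  have -> : 2 * cA%:R * (2 * lambda.+1)%:R ^+ d * B / M%:R = cc * 2.
    by rewrite /cc; ring.
  by rewrite ler_wpM2l//; exact: sum_inv_sqr.
apply: ler_sum => k _; rewrite -mulr_suml -natr_sum.
have cnt : (\sum_(j <- U) (A j k.+1 i : nat) <= cA * (2 * lambda.+1 * k.+1) ^ d)%N.
  have -> : (\sum_(j <- U) (A j k.+1 i : nat) = size [seq j <- U | A j k.+1 i])%N.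
    rewrite size_filter -sum1_count [RHS]big_mkcond/=.
    by apply: eq_bigr => j _; case: (A j _ i).
  case E1: [seq j <- U | A j k.+1 i] => [//|j0 s]; rewrite -E1.
  have Aj0 : A j0 k.+1 i.
    by have := mem_head j0 s; rewrite -E1 mem_filter => /andP[].
  apply: leq_trans (@uniq_near_size R d J pos at_pos cA mem_at_pos pos_at_pos
    size_at_pos _ (pos j0) (lambda * k.+1) _ _) _.
  - by rewrite filter_uniq// undup_uniq.
  - move=> j; rewrite mem_filter => /andP[Aj _]; rewrite leqNgt; apply/negP => far.
    by have := A_disjoint far Aj; rewrite Aj0.
  - rewrite leq_mul2l; apply/orP; right; rewrite leq_exp2r; last exact: ltn_trans d_ge2.
    by rewrite -mul2n -mulnA (mulSn lambda); move: (lambda * _)%N; clear; lia.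
set u : R := k.+1%:R; have u1 : 1 <= u by rewrite ler1n.
have ud0 : 0 < u ^+ d by rewrite exprn_gt0//; lra.
apply: (@le_trans _ _ ((cA * (2 * lambda.+1 * k.+1) ^ d)%:R * v k)).
  by rewrite ler_wpM2r// ler_nat.
rewrite natrM natrX natrM exprMn /v -/u.
have -> : cA%:R * ((2 * lambda.+1)%:R ^+ d * u ^+ d) * (B / (M%:R * (u ^+ d) ^+ 2)) =
    cc * (u ^+ d)^-1.
  by rewrite /cc; field; rewrite !gt_eqF.
have u0 : 0 < u by lra.
by rewrite ler_wpM2l// lef_pV2 ?posrE ?exprn_gt0//; exact: ler_weXn2l.
Qed.

(** The largest L1 influence times the sum of the L1 influences; the latter is
    at most the energy because the influenced counts are integers. *)
Lemma averaged_L1 :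
  \sum_i E (fun x => `|averaged x - avg q i averaged x|) ^+ 2 <=
  4 * (b - a) ^+ 2 * visit_const * energy_const cN * (l%:R / M%:R).
Proof.
pose e i := E (influence_bound i).
have e0 i : 0 <= e i by apply: Ex_ge0 => // x; exact: influence_bound_ge0.
apply: (@le_trans _ _ (\sum_i 4 * ((b - a) * (visit_const / M%:R)) * e i)).
  apply: ler_sum => i _.
  have infl := @influence_L1 R W S q q_ge0 q_sum1 i averaged (influence_bound i)
    (averaged_resample i) (influence_bound_ge0 i).
  apply: (@le_trans _ _ ((2 * e i) ^+ 2)).
    rewrite lerXn2r ?nnegrE ?mulr_ge0//.
    by apply: Ex_ge0 => // x; exact: normr_ge0.
  have := influence_bound_small i; rewrite -/(e i) => /(ler_wpM2r (e0 i)).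
  by lra.
rewrite -mulr_sumr.
have V0 : 0 <= 4 * ((b - a) * (visit_const / M%:R)).
  rewrite mulr_ge0// mulr_ge0 ?subr_ge0// divr_ge0// /visit_const.
  by rewrite !mulr_ge0// ?exprn_ge0// addr_ge0// mulr_ge0.
have : \sum_i e i <= (b - a) * (energy_const cN * l%:R).
  rewrite /e /influence_bound -Ex_sum.
  apply: (@le_trans _ _ ((b - a) * mean (fun z =>
    E (fun x => \sum_i (influenced_count (g z) i x)%:R ^+ 2)))); last first.
    by rewrite ler_wpM2l ?subr_ge0//; exact: mean_energy.
  rewrite -Ex_mean -ExZ; apply: ler_Ex => // x.
  rewrite -mulr_sumr ler_wpM2l ?subr_ge0// -mulr_sumr ler_wpM2l ?invr_ge0//.
  rewrite exchange_big/=; apply: ler_sum => z _; apply: ler_sum => i _.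
  by rewrite -natrX ler_nat; case: influenced_count => // n; rewrite leq_pmulr.
move=> /(ler_wpM2l V0)/le_trans; apply.
by rewrite le_eqVlt; apply/orP; left; apply/eqP; ring.
Qed.

End Averaged.
End Influences.

(** * Geodesics *)

Section Argmin.
Variables (R : realType) (T : eqType).

(** Taking the first minimiser makes the choice of a geodesic a function of the
    environment, which therefore commutes with translations. *)
Definition argmin (x0 : T) (c : T -> R) (l : seq T) : T :=
  head x0 [seq x <- l | all (fun y => c x <= c y) l].

Lemma argmin_spec x0 c l : l != [::] ->
  argmin x0 c l \in l /\ forall y, y \in l -> c (argmin x0 c l) <= c y.
Proof.
move=> l0.
have [x xl xmin] : exists2 x, x \in l & forall y, y \in l -> c x <= c y.
  elim: l l0 => //= x [_ _|y l /(_ isT)[z zl zmin] _].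
    by exists x; [rewrite mem_head|move=> y; rewrite inE => /eqP ->].
  have [xz|zx] := leP (c x) (c z).
    exists x; first exact: mem_head.
    by move=> w; rewrite in_cons => /orP[/eqP ->//|/zmin]; exact: le_trans.
  exists z; first by rewrite in_cons zl orbT.
  by move=> w; rewrite in_cons => /orP[/eqP ->|/zmin//]; exact: ltW.
set f := [seq x <- l | all (fun y => c x <= c y) l].
have : argmin x0 c l \in f.
  rewrite /argmin -/f.
  have : x \in f by rewrite mem_filter xl andbT; apply/allP.
  by case: f => //= y f _; exact: mem_head.
by rewrite mem_filter => /andP[/allP].
Qed.

Lemma eq_in_argmin x0 c c' l : {in l, c =1 c'} -> argmin x0 c l = argmin x0 c' l.
Proof.
move=> cc; rewrite /argmin; congr head; apply: eq_in_filter => x xl.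
by apply: eq_in_all => y yl; rewrite !cc.
Qed.

End Argmin.

(** Cut the list at the first and at the last element satisfying [P]. *)
Lemma count_window (T : Type) (P : pred T) (l : seq T) : has P l ->
  exists p1 s1 p2 p3, [/\ l = rcons p1 s1 ++ p2 ++ p3, P s1, P (last s1 p2) &
    (count P l <= (size p2).+1)%N].
Proof.
case/split_find => s1 p1 m Ps1 np1.
have [p2 [p3 [-> Pl c3]]] : exists p2 p3,
    [/\ m = p2 ++ p3, P (last s1 p2) & count P p3 = 0%N].
  elim/last_ind: m => [|m y [p2 [p3 [-> Pl c3]]]]; first by exists [::], [::].
  case Py: (P y).
    by exists (rcons (p2 ++ p3) y), [::]; rewrite cats0 last_rcons.
  by exists p2, (rcons p3 y); rewrite rcons_cat -(cats1 p3) count_cat c3/= Py.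
exists p1, s1, p2, p3; split => //.
move: np1; rewrite has_count -eqn0Ngt => /eqP c1.
rewrite !count_cat c3 addn0 -cats1 count_cat c1/= Ps1 add0n addn0 add1n ltnS.
exact: count_size.
Qed.

Section Paths.
Variable d : nat.
Local Notation Z := 'rV[int]_d.
Local Notation step := (edge d * Z)%type.
Implicit Types (u v w z : Z) (e : edge d) (p : seq step).

Definition endpoint v p : Z := last v [seq s.2 | s <- p].

Lemma is_path_cat v w p1 p2 :
  is_path v w (p1 ++ p2) = is_path v (endpoint v p1) p1 && is_path (endpoint v p1) w p2.
Proof.
elim: p1 v => [|[e u] p1 IH] v /=; first by rewrite eqxx.
by rewrite IH andbA.
Qed.

Lemma is_path_endpoint v w p : is_path v w p -> endpoint v p = w.
Proof.
by elim: p v => [|[e u] p IH] v /=; [move/eqP|move=> /andP[_ /IH]].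
Qed.

Lemma joins_dist e v u : joins e v u -> site_dist v u = 1%N.
Proof.
move=> evu; apply/joins_exists_unique.
have [s|] := eqVneq (site_dist v u) 1%N.
  by have /joins_exists_unique := s.
move=> /eqP s; exfalso; apply: s; rewrite /site_dist; apply/l1norm_eq1P.
exists e.2; move: evu; rewrite /joins /edge_src /edge_tgt.
case/orP => /andP[/eqP <- /eqP <-].
  by right; rewrite opprD addrA subrr add0r.
by left; rewrite addrC addKr.
Qed.

Lemma step_towards v w n : site_dist v w = n.+1 ->
  exists e u, joins e v u /\ site_dist u w = n.
Proof.
move=> vw.
have [i vi] : exists i, v 0 i != w 0 i.
  apply/existsP; rewrite -negb_forall; apply/negP => /forallP h.
  by move: vw; rewrite /site_dist (_ : v = w) ?subrr ?l1norm0//; apply/rowP => i;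
    exact/eqP.
have key u : (forall j, j != i -> u 0 j = v 0 j) ->
    (`|(u 0 i - w 0 i)%R|.+1 = `|(v 0 i - w 0 i)%R|)%N -> site_dist u w = n.
  move=> uj ui; apply/eqP; rewrite -eqSS -vw; apply/eqP.
  rewrite /site_dist /l1norm (bigD1 i)//= [RHS](bigD1 i)//= !mxE -ui addSn.
  congr (_ + _).+1; apply: eq_bigr => j ji; by rewrite !mxE uj.
have D j : j != i -> (delta_mx 0 i : Z) 0 j = 0.
  by move=> /negPf ji; rewrite mxE ji andbF.
have Di : (delta_mx 0 i : Z) 0 i = 1 by rewrite mxE !eqxx.
have [lt|gt|eq] := ltgtP (v 0 i) (w 0 i); last by rewrite eq eqxx in vi.
- exists (v, i), (v + delta_mx 0 i); split.
    by rewrite /joins /edge_src /edge_tgt/= !eqxx.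
  apply: key => [j ji|]; first by rewrite mxE D// addr0.
  by rewrite mxE Di; move: (v 0 i) (w 0 i) lt => a b; lia.
- exists (v - delta_mx 0 i, i), (v - delta_mx 0 i); split.
    by rewrite /joins /edge_src /edge_tgt/= subrK !eqxx orbT.
  apply: key => [j ji|]; first by rewrite !mxE (negPf ji) andbF subr0.
  rewrite mxE mxE Di; move: (v 0 i) (w 0 i) gt => a b; lia.
Qed.

Lemma straight_path v w : exists2 p, is_path v w p & size p = site_dist v w.
Proof.
have [n] := ubnP (site_dist v w); elim: n v => // n IH v.
case E: (site_dist v w) => [|k] kn.
  exists [::] => //=; apply/eqP/rowP => i.
  have := coord_le_l1norm (v - w) i; rewrite -/(site_dist v w) E leqn0 absz_eq0.
  by rewrite mxE [X in _ + X]mxE subr_eq0 => /eqP.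
have [e [u [evu uw]]] := step_towards E.
have [|p pp sp] := IH u; first by rewrite uw.
by exists ((e, u) :: p); rewrite /= ?evu// sp uw.
Qed.

Definition step_shift z (s : step) : step := (edge_shift z s.1, s.2 + z).

Lemma joins_shift z e v u :
  joins (edge_shift z e) (v + z) (u + z) = joins e v u.
Proof.
rewrite /joins /edge_src /edge_tgt/= addrAC.
by rewrite !(inj_eq (addIr z)).
Qed.

Lemma is_path_shift z v w p :
  is_path (v + z) (w + z) (map (step_shift z) p) = is_path v w p.
Proof.
elim: p v => [|[e u] p IH] v /=; first by rewrite (inj_eq (addIr z)).
by rewrite joins_shift IH.
Qed.

Definition neighbors v : seq step :=
  flatten [seq [:: ((v, i), v + delta_mx 0 i);
                   ((v - delta_mx 0 i, i), v - delta_mx 0 i)] | i <- enum 'I_d].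

Lemma mem_neighbors e v u : joins e v u -> (e, u) \in neighbors v.
Proof.
case: e => x i; rewrite /joins /edge_src /edge_tgt/= => h.
apply/flatten_mapP; exists i; first by rewrite mem_enum.
rewrite !inE; case/orP: h => /andP[/eqP <- /eqP <-]; first by rewrite eqxx.
by rewrite addrK eqxx orbT.
Qed.

Fixpoint paths_from n v : seq (seq step) :=
  if n is n'.+1 then
    flatten [seq [seq s :: p | p <- paths_from n' s.2] | s <- neighbors v]
  else [:: [::]].

Lemma mem_paths_from v w p : is_path v w p -> p \in paths_from (size p) v.
Proof.
elim: p v => [|[e u] p IH] v //= /andP[evu pp].
apply/flatten_mapP; exists (e, u); first exact: mem_neighbors.
by apply/mapP; exists p => //; exact: IH.
Qed.

Lemma size_paths_from n v p : p \in paths_from n v -> size p = n.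
Proof.
elim: n v p => [|n IH] v p /=; first by rewrite inE => /eqP ->.
by move=> /flatten_mapP[s _ /mapP[p' /IH <- ->]].
Qed.

(** An explicit list, which turns the infimum over paths into a finite minimum. *)
Definition short_paths (N : nat) (x : Z) : seq (seq step) :=
  [seq p <- flatten [seq paths_from k 0 | k <- iota 0 N.+1] | is_path 0 x p].

Lemma mem_short_paths N x p :
  (p \in short_paths N x) = is_path 0 x p && (size p <= N)%N.
Proof.
rewrite mem_filter; have [E|] := boolP (is_path 0 x p); rewrite ?andFb// !andTb.
apply/flatten_mapP/idP.
  by move=> [k]; rewrite mem_iota => /andP[_ kN] /size_paths_from ->.
by move=> pN; exists (size p); [rewrite mem_iota|exact: mem_paths_from E].
Qed.

End Paths.

(** Sites and edges at once: [init v] lists the carriers that count at the start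
    of a path from [v], and [carrier s] is the carrier of the step [s]. *)
Section Geodesics.
Variables (R : realType) (d : nat) (J : eqType).
Local Notation Z := 'rV[int]_d.
Local Notation step := (edge d * Z)%type.
Variables (pos : J -> Z) (shift : Z -> J -> J).
Variables (init : Z -> seq J) (carrier : step -> J).
Hypothesis size_init : forall v, (size (init v) <= 1)%N.
Hypothesis pos_init : forall v j, j \in init v -> pos j = v.
Hypothesis pos_carrier : forall e v u, joins e v u ->
  (site_dist (pos (carrier (e, u))) u <= 1)%N.
Hypothesis init_shift : forall z v, init (v + z) = map (shift z) (init v).
Hypothesis carrier_shift : forall z s,
  carrier (step_shift z s) = shift z (carrier s).
Implicit Types (u v w x z : Z) (e : edge d) (p : seq step) (t : J -> R).

Definition visited v p : seq J := init v ++ map carrier p.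
Definition cost t v p : R := \sum_(j <- visited v p) t j.
Definition passage_time t v w : R :=
  inf [set cost t v p | p in [set p | is_path v w p]].

Lemma costE t v p :
  cost t v p = \sum_(j <- init v) t j + \sum_(s <- p) t (carrier s).
Proof. by rewrite /cost big_cat big_map. Qed.

Lemma visited_shift z v p :
  visited (v + z) (map (step_shift z) p) = map (shift z) (visited v p).
Proof.
rewrite /visited init_shift map_cat -!map_comp; congr (_ ++ _).
by apply: eq_map => s /=; rewrite carrier_shift.
Qed.

Lemma cost_shift t z v p :
  cost t (v + z) (map (step_shift z) p) = cost (t \o shift z) v p.
Proof. by rewrite /cost visited_shift big_map. Qed.

Lemma passage_time_min t v w p : is_path v w p ->
  (forall p', is_path v w p' -> cost t v p <= cost t v p') ->
  passage_time t v w = cost t v p.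
Proof.
move=> pp pmin; apply/eqP; rewrite eq_le; apply/andP; split.
  apply: ge_inf; last by exists p.
  by exists (cost t v p) => _ [p' /= pp' <-]; exact: pmin.
apply: lb_le_inf; first by exists (cost t v p), p.
by move=> _ [p' /= pp' <-]; exact: pmin.
Qed.

Lemma walk_length_carriers v w u p : is_path v w p ->
  (walk_length pos u (map carrier p) <= site_dist u v + 3 * size p)%N.
Proof.
elim: p v u => [|[e y] p IH] v u //= /andP[evy pp].
have h1 := pos_carrier evy; have h2 := IH _ (pos (carrier (e, y))) pp.
have h3 := joins_dist evy.
have h4 := site_dist_triangle (pos (carrier (e, y))) y u.
have h5 := site_dist_triangle y v u.
rewrite (site_dist_sym y v) h3 (site_dist_sym v u) in h5.
lia.
Qed.

Lemma walk_length_visited v w p : is_path v w p ->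
  (walk_length pos v (visited v p) <= 3 * size p)%N.
Proof.
move=> /walk_length_carriers h; rewrite /visited.
have := h v; rewrite site_distvv.
case: (init v) (size_init v) (@pos_init v) => [//|j [|//]] _ pi /=.
by rewrite (pi j) ?mem_head// site_distvv.
Qed.

Lemma size_visited v p : (size (visited v p) <= (size p).+1)%N.
Proof. by rewrite size_cat size_map (leq_add (size_init v) (leqnn _)). Qed.

Section Bounded.
Variables (a b : R) (B : nat).
Hypothesis a_gt0 : 0 < a.
Hypothesis b_ge0 : 0 <= b.
Hypothesis B_gt0 : (0 < B)%N.
Hypothesis b_le : b <= B%:R * a.
Variable t : J -> R.
Hypothesis t_itv : forall j, a <= t j <= b.

Lemma sum_steps_ge p : a * (size p)%:R <= \sum_(s <- p) t (carrier s).
Proof.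
rewrite mulr_natr -[leLHS]iter_addr_0 -count_predT -big_const_seq.
by apply: ler_sum => s _; case/andP: (t_itv (carrier s)).
Qed.

Lemma sum_le (l : seq J) : \sum_(j <- l) t j <= b * (size l)%:R.
Proof.
rewrite mulr_natr -[leRHS]iter_addr_0 -count_predT -big_const_seq.
by apply: ler_sum => s _; case/andP: (t_itv s).
Qed.

Lemma sum_steps_le p : \sum_(s <- p) t (carrier s) <= b * (size p)%:R.
Proof.
by rewrite -(big_map carrier xpredT) -(size_map carrier); exact: sum_le.
Qed.

Lemma init_ge0 v : 0 <= \sum_(j <- init v) t j.
Proof.
apply: sumr_ge0 => j _; apply: le_trans (ltW a_gt0) _.
by case/andP: (t_itv j).
Qed.

Lemma init_le v : \sum_(j <- init v) t j <= b.
Proof.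
apply: le_trans (sum_le _) _; rewrite -[leRHS]mulr1 ler_wpM2l//.
by rewrite -[leRHS]/1%:R ler_nat.
Qed.

Variable x : Z.

Definition path_bound : nat := (B * (l1norm x).+1)%N.

Definition geodesic (tau : J -> R) : seq step :=
  argmin [::] (cost tau 0) (short_paths path_bound x).

(** A path longer than [path_bound] costs more than a straight one. *)
Lemma geodesic_spec : [/\ is_path 0 x (geodesic t),
  (size (geodesic t) <= path_bound)%N &
  forall p, is_path 0 x p -> cost t 0 (geodesic t) <= cost t 0 p].
Proof.
have [p0 pp0 sp0] := straight_path 0 x.
have sp0x : size p0 = l1norm x by rewrite sp0 /site_dist sub0r l1normN.
have B1 : (size p0 <= path_bound)%N.
  by rewrite sp0x /path_bound; apply: leq_trans (leqnSn _) _; rewrite leq_pmull.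
have p0L : p0 \in short_paths path_bound x by rewrite mem_short_paths pp0.
have L0 : short_paths path_bound x != [::].
  by case: (short_paths _ _) p0L.
have [] := argmin_spec [::] (cost t 0) L0.
rewrite -/(geodesic t) mem_short_paths => /andP[gp gs] gmin; split => //.
move=> p pp; have [pN|pN] := leqP (size p) path_bound.
  by apply: gmin; rewrite mem_short_paths pp.
apply: le_trans (gmin _ p0L) _; rewrite !costE lerD2l.
apply: le_trans (sum_steps_le _) _; apply: le_trans (sum_steps_ge _).
apply: (@le_trans _ _ (B%:R * a * (l1norm x).+1%:R)).
  by apply: ler_pM => //; rewrite sp0x ler_nat.
by rewrite mulrAC -natrM mulrC ler_pM2l// ler_nat ltnW.
Qed.

Lemma passage_time_geodesic : passage_time t 0 x = cost t 0 (geodesic t).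
Proof. by have [gp _ gmin] := geodesic_spec; exact: passage_time_min. Qed.

(** A piece of a geodesic is no longer than the straight path between its ends,
    up to the factor [B]. *)
Lemma geodesic_segment p1 p2 p3 : geodesic t = p1 ++ p2 ++ p3 ->
  (size p2 <= B * site_dist (endpoint 0 p1) (endpoint (endpoint 0 p1) p2))%N.
Proof.
move=> gE; have [gp _ gmin] := geodesic_spec.
set v1 := endpoint 0 p1; set v2 := endpoint v1 p2.
move: (gp); rewrite gE is_path_cat => /andP[path1].
rewrite is_path_cat => /andP[path2 path3].
have [p pp sp] := straight_path v1 v2.
have := gmin (p1 ++ p ++ p3); rewrite is_path_cat path1/= is_path_cat.
rewrite (is_path_endpoint pp) pp -/v2 path3 => /(_ isT).
rewrite gE !costE !big_cat/= lerD2l lerD2l lerD2r => h.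
have := le_trans (sum_steps_ge p2) (le_trans h (sum_steps_le p)).
rewrite sp => h2.
have : a * (size p2)%:R <= a * (B * site_dist v1 v2)%:R.
  apply: le_trans h2 _; rewrite natrM mulrA ler_wpM2r// mulrC.
  by [].
by rewrite ler_pM2l// ler_nat.
Qed.

Lemma geodesic_steps_near u r :
  (count (fun s => site_dist s.2 u <= r) (geodesic t) <= (2 * B * r).+1)%N.
Proof.
set P := fun s : step => (site_dist s.2 u <= r)%N.
have [hp|] := boolP (has P (geodesic t)); last first.
  by rewrite has_count -leqNgt => /leq_trans; apply.
have [p1 [s1 [p2 [p3 [gE Ps1 Ps2 cP]]]]] := count_window hp.
apply: leq_trans cP _; rewrite ltnS.
have := geodesic_segment gE; rewrite /endpoint map_rcons last_rcons.
rewrite (last_map (@snd _ _)) => /leq_trans; apply.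
rewrite (mulnC 2) -mulnA leq_mul2l; apply/orP; right.
apply: leq_trans (site_dist_triangle _ u _) _.
by rewrite mul2n -addnn leq_add// site_dist_sym.
Qed.

(** From its first to its last visit near [u] the geodesic has no time for more
    than a multiple of [r] steps. *)
Lemma geodesic_near u r :
  (count (fun j => site_dist (pos j) u <= r) (visited 0 (geodesic t)) <=
   (2 * B).+2 * r.+1)%N.
Proof.
have [gp _ _] := geodesic_spec.
rewrite count_cat count_map.
apply: (@leq_trans (1 + (2 * B * r.+1).+1)%N); last first.
  by rewrite (mulSn (2 * B).+1) (mulSn (2 * B)); move: (2 * B * _)%N; clear; lia.
apply: leq_add.
  by apply: leq_trans (count_size _ _) _.
apply: leq_trans (geodesic_steps_near u r.+1).
move: (0 : Z) (geodesic t) gp => v p; elim: p v => //= -[e y] p IH v /andP[evy pp].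
apply: leq_add; last exact: IH pp.
have h := pos_carrier evy; have h2 := site_dist_triangle y (pos (carrier (e, y))) u.
rewrite (site_dist_sym y (pos _)) in h2.
have [h3|//] := leqP (site_dist (pos (carrier (e, y))) u) r.
by rewrite lt0b (leq_trans h2)// (leq_add h h3).
Qed.

End Bounded.

Variables (a b : R) (B : nat).
Hypothesis a_gt0 : 0 < a.
Hypothesis b_ge0 : 0 <= b.
Hypothesis B_gt0 : (0 < B)%N.
Hypothesis b_le : b <= B%:R * a.
Variable t : J -> R.
Hypothesis t_itv : forall j, a <= t j <= b.
Variable x : Z.

(** The passage time from [z] to [x + z], seen as the one from the origin to [x]
    in the translated environment. *)
Definition shifted_passage_time (tau : J -> R) z : R :=
  cost (tau \o shift z) 0 (geodesic B x (tau \o shift z)).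

Let shift_itv z j : a <= (t \o shift z) j <= b. Proof. exact: t_itv. Qed.

Lemma shifted_passage_time_le z p : is_path z (x + z) p ->
  shifted_passage_time t z <= cost t z p.
Proof.
move=> pp; pose q := map (step_shift (- z)) p.
have qp : map (step_shift z) q = p.
  rewrite /q -map_comp -[RHS]map_id; apply: eq_map => -[[v i] u] /=.
  by rewrite /step_shift /edge_shift/= !subrK.
have pathq : is_path 0 x q.
  by rewrite -(is_path_shift z) qp add0r.
have [_ _ h] := geodesic_spec a_gt0 b_ge0 B_gt0 b_le (shift_itv z) x.
apply: le_trans (h q pathq) _.
by rewrite -cost_shift qp add0r.
Qed.

Lemma shifted_geodesic z : exists2 p, is_path z (x + z) p &
  cost t z p = shifted_passage_time t z.
Proof.
have [gp _ _] := geodesic_spec a_gt0 b_ge0 B_gt0 b_le (shift_itv z) x.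
exists (map (step_shift z) (geodesic B x (t \o shift z))).
  by rewrite -{1}(add0r z) is_path_shift.
by rewrite -{1}(add0r z) cost_shift.
Qed.

(** Prolong a geodesic by straight paths at its two ends. *)
Lemma shifted_passage_time_lip z z' : shifted_passage_time t z <=
  shifted_passage_time t z' + b * (2 * site_dist z z' + 1)%:R.
Proof.
have [p pp <-] := shifted_geodesic z'.
have [p1 pp1 sp1] := straight_path z z'.
have [p2 pp2 sp2] := straight_path (x + z') (x + z).
have sp2' : size p2 = site_dist z z'.
  by rewrite sp2 site_dist_sym /site_dist opprD addrACA subrr add0r.
have path3 : is_path z (x + z) (p1 ++ p ++ p2).
  rewrite is_path_cat (is_path_endpoint pp1) pp1/= is_path_cat.
  by rewrite (is_path_endpoint pp) pp pp2.
apply: le_trans (shifted_passage_time_le path3) _.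
rewrite !costE !big_cat/=.
have := init_le b_ge0 t_itv z; have := init_ge0 a_gt0 t_itv z'.
have := sum_steps_le t_itv p1; have := sum_steps_le t_itv p2.
rewrite sp1 sp2' natrD natrM; lra.
Qed.

Lemma passage_time_shifted0 : (forall j, shift 0 j = j) ->
  passage_time t 0 x = shifted_passage_time t 0.
Proof.
move=> s0; rewrite (passage_time_geodesic a_gt0 b_ge0 B_gt0 b_le t_itv).
rewrite /shifted_passage_time; congr (cost _ _ (geodesic _ _ _));
  by apply/funext => j /=; rewrite s0.
Qed.

End Geodesics.

(** * The variance of the averaged passage time *)

Section Analytic.
Variable R : realType.

(** A bound of the form [v * ln (v / B) <= C1 * n] with [B] smaller than [n] by a
    power of [n] forces [v] to be of order [n / ln n]. *)
Lemma variance_of_log (v n C1 C2 Q : R) : 0 <= v -> 0 < n -> 0 < C2 -> 0 <= C1 ->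
  2 <= Q -> 1 < n -> n <= Q ^+ 12 ->
  v * ln (v / (C2 * n / Q)) <= C1 * n ->
  v <= (24 * C1 + 24 * C2) * n / ln n.
Proof.
move=> v0 n0 C20 C10 Q2 n1 nQ hv.
have Q0 : 0 < Q by lra.
have lnQ : 0 < ln Q by apply: ln_gt0; lra.
have lnn : 0 < ln n by exact: ln_gt0.
have lnnQ : ln n <= 12 * ln Q.
  have : ln n <= ln (Q ^+ 12) by rewrite ler_ln// posrE exprn_gt0.
  by rewrite lnXn// -(mulr_natl (ln Q)).
suff : v <= (2 * C1 + 2 * C2) * n / ln Q.
  move=> /le_trans; apply; rewrite ler_pdivrMr// mulrAC ler_pdivlMr//.
  rewrite -!mulrA.
  have -> : (24 * C1 + 24 * C2) * (n * ln Q) = (2 * C1 + 2 * C2) * n * (12 * ln Q) by ring.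
  by rewrite mulrA; apply: ler_wpM2l => //; rewrite mulr_ge0 ?addr_ge0 ?mulr_ge0// ltW.
have B0 : 0 < C2 * n / Q by rewrite divr_gt0// mulr_gt0.
have [->|vN] := eqVneq v 0.
  by rewrite divr_ge0 ?mulr_ge0 ?addr_ge0 ?mulr_ge0 ?(ltW C20) ?(ltW n0)// ltW.
have {}v0 : 0 < v by rewrite lt_neqAle eq_sym vN.
have [h|h] := leP (ln Q / 2) (ln (v / (C2 * n / Q))).
  have K : v * (ln Q / 2) <= C1 * n by apply: le_trans hv; rewrite ler_pM2l.
  rewrite ler_pdivlMr//.
  have : 0 <= C2 * n by rewrite mulr_ge0// ltW.
  lra.
have hvB : v / (C2 * n / Q) <= expR (ln Q / 2).
  have e : expR (ln (v / (C2 * n / Q))) = v / (C2 * n / Q).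
    by rewrite lnK// posrE divr_gt0.
  by rewrite -e ler_expR ltW.
rewrite ler_pdivrMr// in hvB; apply: le_trans hvB _.
have -> : expR (ln Q / 2) * (C2 * n / Q) = C2 * n * expR (- (ln Q / 2)).
  have QE : Q = expR (ln Q / 2) ^+ 2.
    by rewrite -expRM_natl mulrC divfK// lnK.
  by rewrite expRN {2}QE; field; rewrite gt_eqF ?expR_gt0.
have e1 : expR (- (ln Q / 2)) <= 2 / ln Q.
  rewrite expRN -[leRHS]invrK lef_pV2 ?posrE ?expR_gt0 ?invr_gt0 ?divr_gt0//.
  rewrite invf_div; have := @expR_ge1Dx R (ln Q / 2); lra.
apply: (@le_trans _ _ (C2 * n * (2 / ln Q))).
  by rewrite ler_wpM2l// mulr_ge0// ltW.
rewrite mulrA ler_pM2r ?invr_gt0//.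
have : 0 <= C1 * n by rewrite mulr_ge0// ltW.
lra.
Qed.

Lemma ex_root12 (n : nat) : (0 < n)%N ->
  exists2 M : nat, (0 < M)%N & (M ^ 12 <= n < M.+1 ^ 12)%N.
Proof.
move=> n0.
have h1 : exists M, (M ^ 12 <= n)%N by exists 1%N; rewrite exp1n.
have hb M : (M ^ 12 <= n)%N -> (M <= n)%N.
  by move=> /(leq_trans _); apply; case: M => // M; rewrite -[X in (X <= _)%N]expn1 leq_pexp2l.
case: (ex_maxnP h1 hb) => M Mn Mmax; exists M.
  by apply: Mmax; rewrite exp1n.
by rewrite Mn/= ltnNge; apply/negP => /Mmax; rewrite ltnn.
Qed.

End Analytic.

Section FiniteModel.
Variables (R : realType) (d : nat) (J : eqType).
Local Notation Z := 'rV[int]_d.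
Local Notation step := (edge d * Z)%type.
Variables (pos : J -> Z) (at_pos : Z -> seq J) (cA : nat).
Hypothesis mem_at_pos : forall j, j \in at_pos (pos j).
Hypothesis pos_at_pos : forall v j, j \in at_pos v -> pos j = v.
Hypothesis size_at_pos : forall v, (size (at_pos v) <= cA)%N.
Variables (shift : Z -> J -> J) (init : Z -> seq J) (carrier : step -> J).
Hypothesis size_init : forall v, (size (init v) <= 1)%N.
Hypothesis pos_init : forall v j, j \in init v -> pos j = v.
Hypothesis pos_carrier : forall e v u, joins e v u ->
  (site_dist (pos (carrier (e, u))) u <= 1)%N.
Hypothesis pos_shift : forall z j, pos (shift z j) = pos j + z.

Variables (W S : finType) (q : S -> R) (kappa : R).
Hypothesis q_ge0 : forall s, 0 <= q s.
Hypothesis q_sum1 : \sum_s q s = 1.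
Hypothesis kappa_gt0 : 0 < kappa.
Hypothesis q_atom : forall s, q s = 0 \/ kappa <= q s.
Local Notation Om := {ffun W -> S}.
Local Notation E := (Ex q).

Variables (h : J -> Om -> R) (A : J -> nat -> pred W) (K lambda : nat).
Variables (c1 : R) (rho : nat -> R) (crho : R).
Hypothesis d_ge2 : (2 <= d)%N.
Hypothesis A_mono : forall j k k' i, (k <= k')%N -> A j k i -> A j k' i.
Hypothesis A_card : forall j k, (\sum_i (A j k i : nat) <= k)%N.
Hypothesis A_disjoint : forall j j' k i,
  (lambda * k < site_dist (pos j) (pos j'))%N -> A j k i -> ~~ A j' k i.
Hypothesis undetermined_K : forall j x, ~~ undetermined h A j K x.
Hypothesis c1_ge0 : 0 <= c1.
Hypothesis rho_gt0 : forall k, 0 < rho k.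
Hypothesis rho_cube : forall k, (k.+1%:R) ^+ 3 * rho k <= 1.
Hypothesis rho_sum : forall n, \sum_(k < n) k.+1%:R ^+ 2 * rho k <= crho.
Hypothesis undetermined_prob : forall j k,
  E (fun x => (undetermined h A j k x)%:R) <= c1 * rho k ^+ d.

Variables (a b : R) (B : nat).
Hypothesis a_gt0 : 0 < a.
Hypothesis ab : a <= b.
Hypothesis B_gt0 : (0 < B)%N.
Hypothesis b_le : b <= B%:R * a.
Hypothesis h_itv : forall j y, a <= h j y <= b.

(** The finite model inherits translation invariance up to the error [eta]. *)
Variables (x : Z) (M : nat) (eta : R).
Hypothesis x_ge2 : (2 <= l1norm x)%N.
Hypothesis M_gt0 : (0 < M)%N.
Hypothesis M_root : (l1norm x < M.+1 ^ 12)%N.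
Let N := path_bound B x.
Let L := short_paths N x.

Definition geo z (y : Om) : seq step := geodesic init carrier B x (h^~ y \o shift z).

Hypothesis eta_small : eta * ((size L).+1 * N.+1)%:R <= (M%:R ^+ 3)^-1.
Hypothesis geo_invariant : forall z p, z \in cube d (M ^ 3) ->
  E (fun y => (geo z y == p)%:R) <= E (fun y => (geo 0 y == p)%:R) + eta.

Let env_itv z y j : a <= (h^~ y \o shift z) j <= b.
Proof. exact: h_itv. Qed.

Let b_ge0 : 0 <= b. Proof. exact: le_trans (ltW a_gt0) ab. Qed.

Let geo_spec z y := geodesic_spec init carrier a_gt0 b_ge0 B_gt0 b_le (env_itv z y) x.

Definition geo_carriers z y : seq J := map (shift z) (visited init carrier 0 (geo z y)).

Let Box := cube d (M ^ 3).
Let cN : nat := (2 * B).+2.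

Definition box_average (y : Om) : R :=
  averaged Box (fun z y => shifted_passage_time shift init carrier B x (h^~ y) z) y.

Lemma walk_length_shift z v l :
  walk_length pos (v + z) (map (shift z) l) = walk_length pos v l.
Proof.
elim: l v => //= j l IH v; rewrite pos_shift IH; congr (_ + _)%N.
by rewrite /site_dist opprD addrACA subrr addr0.
Qed.

Lemma geo_carriers_walk z y : (walk_length pos z (geo_carriers z y) <= 3 * N)%N.
Proof.
have [gp gN _] := geo_spec z y.
rewrite -{1}(add0r z) walk_length_shift.
apply: leq_trans (walk_length_visited size_init pos_init pos_carrier gp) _.
by rewrite leq_mul2l.
Qed.

Lemma geo_carriers_size z y : (size (geo_carriers z y) <= N.+1)%N.
Proof.
have [gp gN _] := geo_spec z y; rewrite size_map.
exact: leq_trans (size_visited _ size_init _ _) _.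
Qed.

Lemma geo_carriers_near z y u r :
  (count (fun j => site_dist (pos j) u <= r) (geo_carriers z y) <= cN * r.+1)%N.
Proof.
rewrite count_map.
have := geodesic_near (pos := pos) (carrier := carrier) size_init pos_carrier a_gt0 b_ge0 B_gt0 b_le (env_itv z y) x (u - z) r.
move=> /leq_trans - /(_ _ (leqnn _)); apply: leq_trans.
apply/eq_leq/eq_count => j /=.
by rewrite pos_shift /site_dist opprB addrA [pos j + z]addrC [z + _ - u]addrAC addrC.
Qed.

(** Each position of the geodesic is moved to [j] by at most one translation,
    which belongs to the box only if the position is close to [j]. *)
Lemma box_count j y :
  (\sum_(z <- Box) count_mem j (map (shift z) (visited init carrier 0 (geo 0 y)))
   <= cN * (d * M ^ 3).+1)%N.
Proof.
apply: leq_trans (geo_carriers_near 0 y (pos j) (d * M ^ 3)).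
rewrite /geo_carriers; set l := visited _ _ _ _; elim: l => [|j' l IH] /=.
  by rewrite big1.
rewrite big_split/= leq_add//.
rewrite pos_shift addr0.
have [near|far] := leqP (site_dist (pos j') (pos j)) (d * M ^ 3).
  apply: (@leq_trans (count_mem (pos j - pos j') Box)); last first.
    by rewrite count_uniq_mem ?cube_uniq//; case: (_ \in _).
  rewrite -sum1_count [leqRHS]big_mkcond/=; apply: leq_sum => z _.
  case: eqP => // <-; rewrite pos_shift addrC addKr eqxx.
  by [].
rewrite big_seq big1// => z /cube_l1norm zM; case: eqP => // e.
move: far; rewrite -e pos_shift site_dist_sym /site_dist addrC addKr => /leq_trans/(_ zM).
by rewrite ltnn.
Qed.

Definition visits_const : R := (cN * d.+1)%:R + 1.

(** Up to the error [eta], the geodesics may be replaced by the translates of the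
    one from the origin, to which [box_count] applies. As [d] is at least [2], the
    box has at least [M ^ 6] points. *)
Lemma box_visits j :
  (size Box)%:R^-1 * (\sum_(z <- Box) E (fun y => (count_mem j (geo_carriers z y))%:R))
    <= visits_const / M%:R ^+ 3.
Proof.
pose cnt z p := count_mem j (map (shift z) (visited init carrier 0 p)).
pose U := undup L.
have geoU z y : geo z y \in U.
  rewrite mem_undup mem_short_paths.
  by have [-> gN _] := geo_spec z y.
have decomp z z' : E (fun y => (cnt z (geo z' y))%:R) =
    \sum_(p <- U) (cnt z p)%:R * E (fun y => (geo z' y == p)%:R).
  under eq_bigr do rewrite -ExZ.
  rewrite -Ex_sum; apply: eq_Ex => y.
  rewrite (bigD1_seq (geo z' y))//= ?undup_uniq// eqxx mulr1 big1 ?addr0// => p.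
  by rewrite eq_sym => /negPf ->; rewrite mulr0.
have M30 : 0 < (M%:R ^+ 3 : R) by rewrite exprn_gt0// ltr0n.
have eta0 : 0 <= eta.
  have z0 : 0 \in cube d (M ^ 3) by apply: mem_cube; rewrite l1norm0.
  have := geo_invariant [::] z0; lra.
have err z : z \in Box -> E (fun y => (count_mem j (geo_carriers z y))%:R) <=
    E (fun y => (cnt z (geo 0 y))%:R) + (M%:R ^+ 3)^-1.
  move=> zB; rewrite -[X in X <= _]/(E (fun y => (cnt z (geo z y))%:R)) !decomp.
  apply: (@le_trans _ _ (\sum_(p <- U)
     ((cnt z p)%:R * E (fun y => (geo 0 y == p)%:R) + N.+1%:R * eta))).
    rewrite big_seq [leRHS]big_seq; apply: ler_sum => p.
    rewrite mem_undup mem_short_paths => /andP[_ pN].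
    apply: le_trans (ler_wpM2l _ (geo_invariant p zB)) _ => //.
    rewrite mulrDr lerD2l ler_wpM2r// ler_nat.
    apply: leq_trans (count_size _ _) _; rewrite size_map.
    by apply: leq_trans (size_visited _ size_init _ _) _.
  rewrite big_split/= lerD2l; apply: le_trans eta_small.
  rewrite big_const_seq count_predT iter_addr_0 -(mulr_natl (N.+1%:R * eta)) mulrA mulrC -natrM.
  rewrite ler_wpM2l// ler_nat leq_mul2r; apply/orP; right.
  by apply: leq_trans (leqnSn _); exact: size_undup.
have sBox : (M ^ 3 * M ^ 3 <= size Box)%N.
  rewrite size_cube; apply: (@leq_trans ((M ^ 3).*2.+1 ^ 2)%N).
    by rewrite mulnn leq_exp2r// -addnn; lia.
  by rewrite leq_pexp2l.
have Box0 : 0 < (size Box)%:R :> R.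
  by rewrite ltr0n; apply: leq_trans sBox; rewrite muln_gt0 !expn_gt0 M_gt0.
apply: (@le_trans _ _ ((size Box)%:R^-1 * ((cN * (d * M ^ 3).+1)%:R +
    (size Box)%:R * (M%:R ^+ 3)^-1))).
  rewrite ler_wpM2l ?invr_ge0//.
  apply: (@le_trans _ _ (\sum_(z <- Box) (E (fun y => (cnt z (geo 0 y))%:R) +
     (M%:R ^+ 3)^-1))).
    by rewrite big_seq [leRHS]big_seq; apply: ler_sum => z; exact: err.
  rewrite big_split/= lerD//.
    rewrite -Ex_sum -[leRHS](Ex_cst W q_sum1); apply: ler_Ex => // y.
    by rewrite -natr_sum ler_nat; exact: box_count.
  by rewrite big_const_seq count_predT iter_addr_0 -[leLHS]mulr_natl.
rewrite mulrDr mulrA mulVf ?gt_eqF// mul1r /visits_const mulrDl mul1r lerD2r.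
rewrite mulrC ler_pdivrMr// mulrAC ler_pdivlMr//.
rewrite -natrX -!natrM ler_nat -!mulnA leq_mul2l; apply/orP; right.
apply: (@leq_trans (d.+1 * (M ^ 3 * M ^ 3))%N); last by rewrite leq_mul2l sBox orbT.
rewrite mulnA leq_mul2r mulSn; apply/orP; right.
by rewrite -add1n leq_add2r expn_gt0 M_gt0.
Qed.

(** The factor [7 * B] comes from the bound [7 * B * l1norm x] on the length of
    geodesics. *)
Definition energy_total : R :=
  2 * (b - a) ^+ 2 * energy_const cA lambda c1 crho cN * (7 * B)%:R.

Definition influence_total : R :=
  4 * (b - a) ^+ 2 * visit_const d cA lambda c1 visits_const cN *
  energy_const cA lambda c1 crho cN * (7 * B)%:R.

Definition variance_const : R :=
  24 * (4 / kappa * energy_total) + 24 * (2 * influence_total + 1).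

Theorem box_average_variance :
  Var q box_average <= variance_const * (l1norm x)%:R / ln (l1norm x)%:R.
Proof.
pose l := (3 * N).+1; pose n := l1norm x.
have N1 : (0 < N)%N by rewrite /N /path_bound muln_gt0 B_gt0.
have arith (u v : nat) : (0 < u)%N -> (2 <= v)%N ->
    ((3 * (u * v.+1)).+1 <= 7 * u * v)%N by clear; nia.
have ln7 : (l <= 7 * B * n)%N by exact: arith.
have ec0 : 0 <= energy_const cA lambda c1 crho cN.
  have crho0 : 0 <= crho by have := rho_sum 0; rewrite big_ord0.
  apply: mulr_ge0 crho0; apply: mulr_ge0.
    by apply: mulr_ge0; rewrite ?sqr_ge0.
  by rewrite mulr_ge0// addr_ge0// !mulr_ge0// expR_ge0.
have vc0 : 0 <= visit_const d cA lambda c1 visits_const cN.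
  apply: mulr_ge0; first by apply: mulr_ge0; rewrite ?exprn_ge0// mulr_ge0.
  by apply: addr_ge0; [exact: addr_ge0|exact: mulr_ge0].
have it0 : 0 <= influence_total 
  by do 3 (apply: mulr_ge0 => //); rewrite mulr_ge0 ?sqr_ge0.
have et0 : 0 <= energy_total.
  by do 2 (apply: mulr_ge0 => //); rewrite mulr_ge0 ?sqr_ge0.
have ln7R : l%:R <= (7 * B)%:R * n%:R :> R by rewrite -natrM ler_nat.
have T_g z y : shifted_passage_time shift init carrier B x (h^~ y) z =
    \sum_(j <- geo_carriers z y) h j y.
  by rewrite /shifted_passage_time /cost /geo_carriers big_map.
have T_le z y y' : shifted_passage_time shift init carrier B x (h^~ y') z <=
    \sum_(j <- geo_carriers z y) h j y'.
  have [gp _ _] := geo_spec z y; have [_ _ gmin] := geo_spec z y'.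
  by rewrite /geo_carriers big_map; exact: gmin.
have g_size z y : (size (geo_carriers z y) <= l)%N.
  by apply: leq_trans (geo_carriers_size z y) _; rewrite ltnS leq_pmull.
have g_walk z y : (walk_length pos z (geo_carriers z y) <= l)%N.
  by apply: leq_trans (geo_carriers_walk z y) _; exact: leqnSn.
have Box0 : (0 < size Box)%N by rewrite size_cube expn_gt0.
have vis0 : 0 <= visits_const by rewrite addr_ge0.
have M0 : 0 < M%:R :> R by rewrite ltr0n.
have Q0 : 0 < M.+1%:R :> R by rewrite ltr0n.
have n0 : 0 <= n%:R :> R by [].
have L2 := averaged_L2 mem_at_pos pos_at_pos size_at_pos q_ge0 q_sum1 d_ge2
  A_mono A_card A_disjoint undetermined_K c1_ge0 rho_gt0 rho_sum undetermined_prob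
  Box0 ab h_itv g_size g_walk geo_carriers_near T_g T_le.
have L1 := averaged_L1 mem_at_pos pos_at_pos size_at_pos q_ge0 q_sum1 d_ge2
  A_mono A_card A_disjoint undetermined_K c1_ge0 rho_gt0 rho_cube rho_sum undetermined_prob
  Box0 ab h_itv g_size g_walk geo_carriers_near T_g T_le M_gt0 vis0 box_visits.
apply: (@variance_of_log _ _ _ _ _ M.+1%:R).
- by apply: Ex_ge0 => // y; exact: sqr_ge0.
- by rewrite ltr0n; apply: ltn_trans x_ge2.
- by rewrite ltr_wpDl// mulr_ge0.
- by rewrite mulr_ge0// divr_ge0// ltW.
- by rewrite (ler_nat R 2).
- by rewrite (ltr_nat R 1).
- by rewrite -natrX ler_nat ltnW.
apply: le_trans (falik_samorodnitsky q_ge0 q_sum1 kappa_gt0 q_atom _ _) _.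
- by rewrite divr_gt0// mulr_gt0// ?ltr0n; [rewrite ltr_wpDl// mulr_ge0|apply: ltn_trans x_ge2].
- apply: le_trans L1 _.
  set D := 4 * (b - a) ^+ 2 * _ * _; have D0 : 0 <= D.
    by do 2 (apply: mulr_ge0 => //); rewrite mulr_ge0 ?sqr_ge0.
  have itE : influence_total = D * (7 * B)%:R by [].
  apply: (@le_trans _ _ (influence_total * n%:R / M%:R)).
    by rewrite itE mulrA ler_pM2r ?invr_gt0// -mulrA ler_wpM2l.
  rewrite ler_pdivrMr// -[leRHS]mulrAC ler_pdivlMr//.
  have QM : M.+1%:R <= 2 * M%:R :> R by rewrite -natrM ler_nat mul2n -addnn -add1n leq_add2r.
  apply: (@le_trans _ _ (influence_total * n%:R * (2 * M%:R))).
    by rewrite ler_wpM2l// mulr_ge0.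
  have : 0 <= n%:R * M%:R :> R by rewrite mulr_ge0.
  rewrite -/n; lra.
- rewrite -[leRHS]mulrA ler_wpM2l ?divr_ge0 ?(ltW kappa_gt0)//; apply: le_trans L2 _.
  rewrite /energy_total -[leRHS]mulrA ler_wpM2l//.
  by apply: mulr_ge0 => //; rewrite mulr_ge0 ?sqr_ge0.
Qed.

End FiniteModel.

(** * From random variables to the finite model *)

Section VarianceBound.
Context {disp : measure_display} {Omega : measurableType disp} {R : realType}.
Variable P : probability Omega R.

Lemma Lfun2_bounded (f : Omega -> R) (c : R) : measurable_fun setT f ->
  (forall w, `|f w| <= c) -> f \in Lfun P 2%:E.
Proof.
move=> mf fc; rewrite inE/=; apply/andP; split; rewrite inE//=.
rewrite /finite_norm unlock poweR_lty//.
under eq_integral => w _/= do rewrite powR_mulrn//.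
have c0 : 0 <= c by apply: le_trans (fc point).
have : P.-integrable setT (EFin \o (fun w => `|f w| ^+ 2)).
  apply: measurable_bounded_integrable => //.
  - by apply: le_lt_trans (probability_le1 P measurableT) (ltry _).
  - by apply: measurable_funX; apply: measurableT_comp.
  - exists (c ^+ 2); split; first exact: num_real.
    move=> e ce w _; apply: le_trans (ltW ce).
    by rewrite ger0_norm ?exprn_ge0// lerXn2r ?nnegrE.
by move=> /integrable_lty; apply.
Qed.

Lemma variance_le_integral (f g : Omega -> R) (c K : R) :
  measurable_fun setT f -> measurable_fun setT g -> (forall w, `|f w| <= K) ->
  (forall w, (f w - c) ^+ 2 <= g w) ->
  ('V_P[f] <= \int[P]_w (g w)%:E)%E.
Proof.
move=> mf mg fK fg.
have f2 := Lfun2_bounded mf fK.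
have mfc : measurable_fun setT (f \- cst c)%R by exact: measurable_funB.
rewrite -(varianceB_cst_r c f2) varianceE; last first.
  apply: (@Lfun2_bounded _ (K + `|c|)) => // w.
  by apply: le_trans (ler_normB _ _) _; rewrite lerD2r.
pose h w := (f w - c) ^+ 2.
have -> : ((f \- cst c) ^+ 2)%R = h by apply/funext => w; rewrite /h !expr2.
apply: (@le_trans _ _ ('E_P[h])%E).
  set u := ('E_P[_])%E; set v := ('E_P[_])%E.
  have : (0 <= v ^+ 2)%E.
    rewrite expe2; have [v0|/ltW v0] := leP 0%E v; first exact: mule_ge0.
    exact: mule_le0.
  by move=> /(leeB (lexx u)); rewrite sube0.
rewrite unlock; apply: ge0_le_integral => //.
- by move=> w _; rewrite lee_fin sqr_ge0.
- by apply/measurable_EFinP; apply: measurable_funX.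
- exact/measurable_EFinP.
- by move=> w _; rewrite lee_fin; exact: fg.
Qed.

End VarianceBound.

Section Law.
Context {disp : measure_display} {Omega : measurableType disp} {R : realType}.
Variable P : probability Omega R.
Variables (I : countType) (S : finType) (X : I -> Omega -> S).
Hypothesis iidX : iid P X.
Variable i0 : I.

Definition atom (s : S) : R := fine (P (X i0 @^-1` [set s])).

Lemma atomE i s : P (X i @^-1` [set s]) = (atom s)%:E.
Proof.
have [mX idX _] := iidX.
by rewrite (idX i i0) /atom fineK// fin_num_measure//; exact: mX.
Qed.

Lemma atom_ge0 s : 0 <= atom s.
Proof. exact: fine_ge0. Qed.

Section Restriction.
Variable W : {fset I}.
Local Notation Om := {ffun W -> S}.
Let Y w : Om := restr W (X ^~ w).

Lemma restr_eqE (y : Om) : [set w | Y w = y] =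
  \bigcap_(i in [set` W]) (X i @^-1` [set s | forall h : i \in W, y [` h]%fset = s]).
Proof.
apply/seteqP; split => w /=.
  by move=> <- i iW h; rewrite /Y ffunE.
move=> h; apply/ffunP => -[i iW]; rewrite /Y ffunE/=.
by have := h i iW iW => ->.
Qed.

Lemma measurable_restr_eq (y : Om) : measurable [set w | Y w = y].
Proof.
rewrite restr_eqE; apply: fin_bigcap_measurable; first exact: finite_fset.
by move=> i _; have [mX _ _] := iidX; exact: mX.
Qed.

Lemma law_restr (y : Om) : P [set w | Y w = y] = (weight atom y)%:E.
Proof.
have [_ _ indX] := iidX.
rewrite restr_eqE indX big_seq_fsetE/= /weight -prodEFin.
apply: eq_bigr => -[i iW] _ /=; rewrite -(atomE i); congr (P (X i @^-1` _)).
apply/seteqP; split => s /=.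
  by move=> /(_ iW).
by move=> -> h; congr (y _); apply: val_inj.
Qed.

Lemma measurable_restr (A : set Om) : measurable [set w | A (Y w)].
Proof.
have -> : [set w | A (Y w)] = \bigcup_(y in A) [set w | Y w = y].
  by apply/seteqP; split => w /=; [move=> Aw; exists (Y w)|move=> [y Ay ->]].
apply: fin_bigcup_measurable; last by move=> y _; exact: measurable_restr_eq.
exact: finite_finset.
Qed.

Lemma restr_sum (H : Om -> R) w : H (Y w) = \sum_y H y * \1_([set w | Y w = y]) w.
Proof.
rewrite (bigD1 (Y w))//= indicE mem_set//= mulr1 big1 ?addr0// => y yY.
by rewrite indicE memNset ?mulr0// => /= e; rewrite e eqxx in yY.
Qed.

Lemma measurable_fun_restr (H : Om -> R) : measurable_fun setT (fun w => H (Y w)).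
Proof.
under eq_fun do rewrite restr_sum.
apply: measurable_sum => y; apply: measurable_funM => //.
by apply: measurable_indic; exact: measurable_restr_eq.
Qed.

Lemma integral_restr (H : Om -> R) : (forall y, 0 <= H y) ->
  (\int[P]_w (H (Y w))%:E)%E = (Ex atom H)%:E.
Proof.
move=> H0.
under eq_integral do rewrite restr_sum -sumEFin.
rewrite ge0_integral_sum//; last 2 first.
- move=> y; apply/measurable_EFinP; apply: measurable_funM => //.
  by apply: measurable_indic; exact: measurable_restr_eq.
- by move=> y w _; rewrite lee_fin mulr_ge0.
rewrite /Ex -sumEFin; apply: eq_bigr => y _.
rewrite (integralZl_indic measurableT (fun=> [set w | Y w = y]))//; last 2 first.
- by rewrite ltNge H0.
- exact: measurable_restr_eq.
rewrite integral_indic//; last exact: measurable_restr_eq.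
by rewrite setIT/= law_restr -EFinM mulrC.
Qed.

Lemma prob_restr (Q : pred Om) :
  P [set w | Q (Y w)] = (Ex atom (fun y => (Q y)%:R))%:E.
Proof.
have mQ : measurable [set w | Q (Y w)] by exact: (measurable_restr [set y | Q y]).
rewrite -integral_restr// -[X in P X]setIT -integral_indic//.
apply: eq_integral => w _; rewrite indicE; congr ((_ : bool)%:R%:E).
by apply/idP/idP; rewrite inE.
Qed.

End Restriction.

Lemma atom_sum1 : \sum_s atom s = 1.
Proof.
have := @prob_restr [fset i0]%fset xpredT.
have -> : [set w | xpredT (restr [fset i0]%fset (X ^~ w))] = setT.
  by apply/seteqP; split.
rewrite probability_setT /Ex => -[->].
under eq_bigr do rewrite mulr1.
by rewrite /weight -(bigA_distr_bigA (fun _ s => atom s))/= big_fset1.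
Qed.

Lemma atom_lower : exists2 kappa, 0 < kappa & forall s, atom s = 0 \/ kappa <= atom s.
Proof.
pose l := [seq atom s | s <- enum S & atom s != 0].
have [m m0 ml] : exists2 m, 0 < m & forall u, u \in l -> m <= u.
  have : all (fun u => 0 < u) l.
    apply/allP => u /mapP[s]; rewrite mem_filter => /andP[s0 _] ->.
    by rewrite lt_neqAle eq_sym s0 atom_ge0.
  elim: l => [_|u l IH /= /andP[u0 /IH[m m0 ml]]]; first by exists 1.
  exists (Num.min u m); first by rewrite lt_min u0.
  move=> v; rewrite in_cons => /orP[/eqP ->|/ml mv]; first by rewrite ge_min lexx.
  by rewrite ge_min mv orbT.
exists m => // s; have [->|s0] := eqVneq (atom s) 0; [by left|right].
by apply: ml; apply/mapP; exists s => //; rewrite mem_filter s0 mem_enum.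
Qed.

End Law.

(** * Measurability of geodesics *)

Section GeodesicMeasurability.
Context {disp : measure_display} {T : measurableType disp} {R : realType}.

Lemma argmin_measurable (U : eqType) (u0 p : U) (c : T -> U -> R) (l : seq U) :
  (forall u, measurable_fun setT (c^~ u)) ->
  measurable [set w | argmin u0 (c w) l = p].
Proof.
move=> mc.
have ma u l' : measurable [set w | all (fun v => c w u <= c w v) l'].
  elim: l' => [|v l' IH] /=.
    by rewrite (_ : [set _ | _] = setT)//; apply/seteqP; split.
  have -> : [set w | (c w u <= c w v) && all (fun v => c w u <= c w v) l'] =
      (setT `&` [set w | c w u <= c w v]) `&` [set w | all (fun v => c w u <= c w v) l'].
    rewrite setTI; apply/seteqP; split => w /=; first by move=> /andP.
    by move=> [-> ->].
  by apply: measurableI => //; exact: measurable_fun_le.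
rewrite /argmin.
suff K l' : measurable [set w |
    head u0 [seq u <- l' | all (fun v => c w u <= c w v) l] = p] by exact: K.
elim: l' => [|u l' IH] /=.
  have [e|e] := pselect (u0 = p).
    by rewrite (_ : [set _ | _] = setT)//; apply/seteqP; split.
  by rewrite (_ : [set _ | _] = set0)//; apply/seteqP; split.
set a := fun w => all (fun v => c w u <= c w v) l.
have -> : [set w | head u0 (if a w then
     u :: [seq u <- l' | all (fun v => c w u <= c w v) l]
     else [seq u <- l' | all (fun v => c w u <= c w v) l]) = p] =
   ([set w | a w] `&` [set _ | u = p]) `|`
   (~` [set w | a w] `&` [set w |
      head u0 [seq u <- l' | all (fun v => c w u <= c w v) l] = p]).
  apply/seteqP; split => w /=; first by case: ifP => _ h; [left|right].
  by case: ifP => aw [[]|[]].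
apply: measurableU; last by apply: measurableI => //; apply: measurableC; exact: ma.
apply: measurableI; first exact: ma.
have [e|e] := pselect (u = p).
  by rewrite (_ : [set _ | _] = setT)//; apply/seteqP; split.
by rewrite (_ : [set _ | _] = set0)//; apply/seteqP; split.
Qed.

Lemma geodesic_measurable d (J : eqType) init (carrier : edge d * 'rV[int]_d -> J)
    (B : nat) x (tau : J -> T -> R) p :
  (forall j, measurable_fun setT (tau j)) ->
  measurable [set w | geodesic init carrier B x (tau^~ w) = p].
Proof.
move=> mt; apply: (@argmin_measurable _ _ _ (fun w => cost init carrier (tau^~ w) 0)) => u.
exact: measurable_sum.
Qed.

End GeodesicMeasurability.

Lemma geodesic_product_measurable (R : realType) d (J : eqType) init
    (carrier : edge d * 'rV[int]_d -> J) (B : nat) x p :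
  product_salgebra measurable
    [set tau : J -> R | geodesic init carrier B x tau = p].
Proof.
pose T0 : pointedType := HB.pack (J -> R) (gen_eqMixin (J -> R))
  (gen_choiceMixin (J -> R)) (isPointed.Build (J -> R) (fun=> 0)).
pose G : set (set T0) :=
  \bigcup_j preimage_set_system setT (fun x : J -> R => x j) measurable.
have mev j : measurable_fun setT (fun u : g_sigma_algebraType G => (u : J -> R) j).
  move=> _ Y mY; apply: sub_sigma_algebra; exists j => //.
  by exists Y.
exact: (@geodesic_measurable _ (g_sigma_algebraType G) R d J init carrier B x
  (fun j u => u j) p mev).
Qed.

(** Multiplied by the square of [k], [decay k] is still summable. *)
Section DecayRate.
Variables (R : realType) (e : R).
Hypothesis e_gt0 : 0 < e.

Definition decay (k : nat) : R := k.+1%:R `^ (- (3 + e)).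

Lemma decay_gt0 k : 0 < decay k.
Proof. by apply: powR_gt0; rewrite ltr0n. Qed.

Lemma decay_cube k : k.+1%:R ^+ 3 * decay k <= 1.
Proof.
rewrite /decay powRN -powR_mulrn// ler_pdivrMr ?powR_gt0 ?ltr0n// mul1r.
by apply: ler_powR; rewrite ?ler1n// lerDl ltW.
Qed.

Lemma decay_sqr k : k.+1%:R ^+ 2 * decay k = k.+1%:R `^ (- (1 + e)).
Proof.
rewrite /decay -powR_mulrn// -powRD; last by rewrite pnatr_eq0 implybT.
by congr (_ `^ _); lra.
Qed.

(** The comparison with an integral, obtained from [expR u >= 1 + u]. *)
Lemma decay_telescope k :
  k.+2%:R `^ (- (1 + e)) <= (k.+1%:R `^ (- e) - k.+2%:R `^ (- e)) / e :> R.
Proof.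
set y : R := k.+1%:R; have y1 : 1 <= y by rewrite ler1n.
have -> : k.+2%:R = y + 1 :> R by rewrite /y natr1.
have y0 : 0 < y by lra.
have z0 : 0 < y + 1 by lra.
have -> : (y + 1) `^ (- (1 + e)) = (y + 1)^-1 * (y + 1) `^ (- e).
  rewrite -powR_inv1 ?ltW// -powRD; last by apply/implyP => _; rewrite gt_eqF.
  by congr (_ `^ _); lra.
have h : y `^ (- e) = (y + 1) `^ (- e) * expR (e * ln ((y + 1) / y)).
  rewrite /powR !gt_eqF// -expRD ln_div ?posrE//; congr expR; ring.
rewrite ler_pdivlMr// h -[X in _ <= _ - X]mulr1 -mulrBr mulrAC mulrC.
rewrite ler_pM2l ?powR_gt0//.
have := @expR_ge1Dx R (e * ln ((y + 1) / y)).
have := @ln_ge_1subV R ((y + 1) / y); rewrite divr_gt0// => /(_ isT).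
have -> : 1 - ((y + 1) / y)^-1 = (y + 1)^-1.
  by field; apply/andP; split; rewrite gt_eqF.
move=> /(ler_wpM2l (ltW e_gt0)); rewrite mulrC; lra.
Qed.

Lemma decay_sum n : \sum_(k < n) k.+1%:R ^+ 2 * decay k <= 1 + e^-1.
Proof.
under eq_bigr do rewrite decay_sqr.
case: n => [|n]; first by rewrite big_ord0 addr_ge0// invr_ge0 ltW.
suff : \sum_(k < n.+1) k.+1%:R `^ (- (1 + e)) <= 1 + (1 - n.+1%:R `^ (- e)) / e.
  move=> /le_trans; apply; rewrite lerD2l -[leRHS]mul1r.
  by rewrite ler_pM2r ?invr_gt0// gerBl powR_ge0.
elim: n => [|n IH]; first by rewrite big_ord1 powR1 subrr mul0r addr0.
rewrite big_ord_recr/=; apply: le_trans (lerD IH (decay_telescope n)) _.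
by rewrite -addrA -mulrDl lerD2l ler_pM2r ?invr_gt0//; lra.
Qed.

End DecayRate.

(** * Truncation of the representation *)

Section Transfer.
Context {disp : measure_display} {Omega : measurableType disp} {R : realType}.
Variable P : probability Omega R.
Variables (d : nat) (J : eqType).
Local Notation Z := 'rV[int]_d.
Local Notation step := (edge d * Z)%type.
Variables (pos : J -> Z) (at_pos : Z -> seq J) (cA : nat).
Hypothesis mem_at_pos : forall j, j \in at_pos (pos j).
Hypothesis pos_at_pos : forall v j, j \in at_pos v -> pos j = v.
Hypothesis size_at_pos : forall v, (size (at_pos v) <= cA)%N.
Variables (shift : Z -> J -> J) (init : Z -> seq J) (carrier : step -> J).
Hypothesis size_init : forall v, (size (init v) <= 1)%N.
Hypothesis pos_init : forall v j, j \in init v -> pos j = v.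
Hypothesis pos_carrier : forall e v u, joins e v u ->
  (site_dist (pos (carrier (e, u))) u <= 1)%N.
Hypothesis pos_shift : forall z j, pos (shift z j) = pos j + z.
Hypothesis init_shift : forall z v, init (v + z) = map (shift z) (init v).
Hypothesis carrier_shift : forall z s,
  carrier (step_shift z s) = shift z (carrier s).
Hypothesis shift0 : forall j, shift 0 j = j.

Variables (a b : R) (B : nat).
Hypothesis a_gt0 : 0 < a.
Hypothesis ab : a <= b.
Hypothesis B_gt0 : (0 < B)%N.
Hypothesis b_le : b <= B%:R * a.

Variable t : J -> Omega -> R.
Hypothesis mt : forall j, measurable_fun setT (t j).
Hypothesis t_itv : forall j w, a <= t j w <= b.

Variables (S : finType) (I : countType) (X : I -> Omega -> S).
Variables (h : J -> (I -> S) -> R) (idx : J -> nat -> I).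
Variables (c0 e0 : R) (lambda : nat).
Hypothesis d_ge2 : (2 <= d)%N.
Hypothesis iidX : iid P X.
Hypothesis t_h : forall j w, t j w = h j (X ^~ w).
Hypothesis c0_gt0 : 0 < c0.
Hypothesis e0_gt0 : 0 < e0.
Hypothesis undet_prob : forall j k, (0 < k)%N ->
  (P [set w | ~ determines (restr (first_indices (idx j) k) (X ^~ w)) (h j)]
    <= (c0 / k%:R `^ ((3 * d)%:R + e0))%:E)%E.
Hypothesis separated : forall j j' k, (0 < k)%N ->
  (lambda * k < site_dist (pos j) (pos j'))%N ->
  [disjoint first_indices (idx j) k & first_indices (idx j') k]%fset.
Hypothesis t_invariant : translation_invariant P shift t.

Variables (i0 : I) (w0 : Omega).
Let s0 : S := X i0 w0.
Local Notation q := (atom P X i0).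

Section FixedTarget.
Variables (x : Z) (M K : nat) (eta : R).
Hypothesis x_ge2 : (2 <= l1norm x)%N.
Hypothesis M_gt0 : (0 < M)%N.
Hypothesis K_gt0 : (0 < K)%N.

Let Box := cube d (M ^ 3).
Let N := path_bound B x.
Let L := short_paths N x.

(** Only these finitely many carriers can occur on the geodesics involved. *)
Definition relevant : seq J :=
  flatten [seq map (shift z) (visited init carrier 0 p) | z <- Box, p <- L].

Definition window : {fset I} :=
  [fset i in flatten [seq [seq idx j m | m <- iota 1 K] | j <- relevant]]%fset.

Local Notation Om := {ffun window -> S}.
Local Notation first j k := (first_indices (idx j) k).

Definition extend (y : Om) (i : I) : S := if insub i is Some u then y u else s0.

Definition inspected (j : J) (k : nat) : pred window :=
  fun u => fsval u \in first j k.

Definition clamp (u : R) : R := Num.max a (Num.min b u).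

(** A constant is substituted for all but the first [K] variables, so that these
    determine the value. The substituted configuration need not be one that occurs,
    whence the clamping. *)
Definition truncated (j : J) (y : Om) : R :=
  if j \in relevant then
    clamp (h j (fun i => if i \in first j K then extend y i else s0))
  else a.

Definition determined (j : J) (k : nat) (y : Om) : Prop :=
  determines (restr (first j k) (extend y)) (h j).

Lemma mem_first j k i :
  reflect (exists2 m, (0 < m <= k)%N & i = idx j m) (i \in first j k).
Proof.
apply: (iffP (imfsetP _ _ _ _)) => -[m /= mk ->].
  by exists m => //; move: mk; rewrite mem_iota add1n ltnS.
by exists m => //=; rewrite mem_iota add1n ltnS.
Qed.

Lemma first_sub j k k' : (k <= k')%N -> {subset first j k <= first j k'}.
Proof.
move=> kk i /mem_first[m /andP[m0 mk] ->]; apply/mem_first; exists m => //.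
by rewrite m0 (leq_trans mk).
Qed.

Lemma first_window j k i : j \in relevant -> (k <= K)%N -> i \in first j k ->
  i \in window.
Proof.
move=> jr kK /(first_sub kK)/mem_first[m mK ->].
rewrite in_fset /=; apply/flatten_mapP; exists j => //.
by apply: map_f; rewrite mem_iota add1n ltnS.
Qed.

Lemma extend_in (y : Om) i (iW : i \in window) : extend y i = y [` iW]%fset.
Proof. by rewrite /extend insubT. Qed.

Lemma restr_extend j k w : j \in relevant -> (k <= K)%N ->
  restr (first j k) (extend (restr window (X ^~ w))) = restr (first j k) (X ^~ w).
Proof.
move=> jr kK; apply/ffunP => -[i ik]; rewrite !ffunE/=.
by rewrite (extend_in _ (first_window jr kK ik)) ffunE.
Qed.

Lemma clamp_itv u : a <= clamp u <= b.
Proof. by rewrite /clamp le_max lexx/= ge_max ab ge_min lexx. Qed.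

Lemma clamp_id u : a <= u <= b -> clamp u = u.
Proof. by move=> /andP[au ub]; rewrite /clamp (min_idPr ub) (max_idPr au). Qed.

Lemma truncated_itv j y : a <= truncated j y <= b.
Proof. by rewrite /truncated; case: ifP => _; rewrite ?clamp_itv// lexx. Qed.

Lemma inspected_mono j k k' u : (k <= k')%N -> inspected j k u -> inspected j k' u.
Proof. by move=> kk; exact: first_sub. Qed.

Lemma inspected_card j k : (\sum_u (inspected j k u : nat) <= k)%N.
Proof.
apply: (@leq_trans (\sum_(m <- iota 1 k) \sum_(u : window) (fsval u == idx j m))%N).
  rewrite exchange_big/=; apply: leq_sum => u _; rewrite /inspected.
  case: mem_first => //= -[m /andP[m0 mk] ->].
  rewrite (big_rem m)/=; last by rewrite mem_iota m0 add1n ltnS.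
  by rewrite eqxx.
apply: (@leq_trans (\sum_(m <- iota 1 k) 1)%N); last by rewrite sum1_size size_iota.
apply: leq_sum => m _.
have [iW|iW] := boolP (idx j m \in window).
  rewrite (bigD1 [` iW]%fset)//= eqxx big1// => u uN.
  by apply/eqP; rewrite eqb0; apply: contra uN => /eqP e; apply/eqP/val_inj.
rewrite big1// => u _; apply/eqP; rewrite eqb0; apply: contra iW => /eqP <-.
exact: fsvalP.
Qed.

Lemma inspected_disjoint j j' k u :
  (lambda * k < site_dist (pos j) (pos j'))%N -> inspected j k u ->
  ~~ inspected j' k u.
Proof.
move=> far uk; have [k0|k0] := posnP k.
  by move: uk; rewrite k0 /inspected => /mem_first[m]; case: m.
have /fdisjointP := separated k0 far; exact.
Qed.

(** If [k] variables determine [h j], they determine its truncation, a value of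
    [h j] at a configuration with the same first [k] variables. *)
Lemma truncated_determined j k y : j \in relevant -> (k <= K)%N ->
  determined j k y -> ~~ undetermined truncated inspected j k y.
Proof.
move=> jr kK det; apply/existsP => -[y' /andP[/forallP yy]].
rewrite /truncated jr (det _ (fun i => if i \in first j K then extend y i else s0)) ?eqxx//.
  apply/ffunP => -[i ik]; rewrite !ffunE/= (first_sub kK ik).
  have iW := first_window jr kK ik.
  by rewrite !(extend_in _ iW); apply/eqP; exact: (implyP (yy [` iW]%fset)).
by apply/ffunP => -[i ik]; rewrite !ffunE/= (first_sub kK ik).
Qed.

Lemma truncated_undetermined_K j y : ~~ undetermined truncated inspected j K y.
Proof.
apply/existsP => -[y' /andP[/forallP yy]]; rewrite /truncated.
case: ifP => [jr|_]; last by rewrite eqxx.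
suff -> : (fun i => if i \in first j K then extend y' i else s0) =
  (fun i => if i \in first j K then extend y i else s0) by rewrite eqxx.
apply/funext => i; case: ifP => // iK.
have iW := first_window jr (leqnn K) iK.
by rewrite !(extend_in _ iW); apply/eqP; exact: (implyP (yy [` iW]%fset)).
Qed.

Lemma undetermined_mono j k k' y : (k <= k')%N ->
  undetermined truncated inspected j k' y -> undetermined truncated inspected j k y.
Proof.
move=> kk /existsP[y' /andP[/forallP yy hy]]; apply/existsP; exists y'.
rewrite hy andbT; apply/forallP => u; apply/implyP => uk.
by apply: (implyP (yy u)); exact: inspected_mono uk.
Qed.

(** The summand [1] serves the trivial bound at [k = 0], and the power of [2] the
    passage from [k] to [k.+1 <= 2 * k]. *)
Definition prob_const : R := 1 + c0 * 2 `^ ((3 * d)%:R + e0).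
Definition rate := decay (e0 / d%:R).

Lemma prob_const_ge0 : 0 <= prob_const.
Proof. by rewrite addr_ge0// mulr_ge0 ?powR_ge0// ltW. Qed.

Lemma rate_pow k : rate k ^+ d = (k.+1%:R `^ ((3 * d)%:R + e0))^-1.
Proof.
rewrite /rate /decay -powR_mulrn ?powR_ge0// -powRrM -powRN; congr (_ `^ _).
have d0 : d%:R != 0 :> R by rewrite pnatr_eq0; case: (d) d_ge2.
by rewrite natrM; field.
Qed.

Lemma undetermined_prob_pos j k : j \in relevant -> (0 < k <= K)%N ->
  Ex q (fun y => (`[< ~ determined j k y >])%:R) <= c0 / k%:R `^ ((3 * d)%:R + e0).
Proof.
move=> jr /andP[k0 kK]; rewrite -lee_fin -(prob_restr iidX i0 (W := window)).
apply: le_trans (undet_prob j k0); rewrite le_eqVlt; apply/orP; left; apply/eqP.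
congr (P _); apply/seteqP; split => w /=.
  by move=> /asboolP; rewrite /determined restr_extend.
by move=> nd; apply/asboolP; rewrite /determined restr_extend.
Qed.

Lemma truncated_undetermined_prob j k :
  Ex q (fun y => (undetermined truncated inspected j k y)%:R) <=
  prob_const * rate k ^+ d.
Proof.
have q0 := atom_ge0 P X i0; have q1 := atom_sum1 iidX i0.
have rhs0 : 0 <= prob_const * rate k ^+ d.
  by rewrite mulr_ge0 ?prob_const_ge0// exprn_ge0// ltW// decay_gt0.
have zero : (forall y, ~~ undetermined truncated inspected j k y) ->
    Ex q (fun y => (undetermined truncated inspected j k y)%:R) <=
    prob_const * rate k ^+ d.
  move=> nu; apply: le_trans rhs0; rewrite -[leRHS](Ex_cst window q1).
  by apply: ler_Ex => // y; rewrite (negPf (nu y)).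
have [jr|jr] := boolP (j \in relevant); last first.
  apply: zero => y; apply/existsP => -[y' /andP[_]].
  by rewrite /truncated (negPf jr) eqxx.
have [kK|kK] := leqP k K; last first.
  apply: zero => y; apply: contra (truncated_undetermined_K j y).
  exact/undetermined_mono/ltnW.
have [->|k0] := posnP k.
  apply: (@le_trans _ _ (Ex q (fun _ : Om => 1))).
    by apply: ler_Ex => // y; case: undetermined.
  rewrite Ex_cst// rate_pow powR1 invr1 mulr1 lerDl.
  by rewrite mulr_ge0 ?powR_ge0// ltW.
apply: (@le_trans _ _ (c0 / k%:R `^ ((3 * d)%:R + e0))).
  apply: le_trans (undetermined_prob_pos jr _); last by rewrite k0 kK.
  apply: ler_Ex => // y; case E: (undetermined _ _ _ _ _); last by case: asboolP.
  case: asboolP => // nd; exfalso.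
  have det : determined j k y by apply: contrapT.
  by have := truncated_determined jr kK det; rewrite E.
have r0 : 0 <= (3 * d)%:R + e0 by rewrite addr_ge0// ltW.
have kp : 0 < k%:R `^ ((3 * d)%:R + e0) by rewrite powR_gt0// ltr0n.
have k1p : 0 < k.+1%:R `^ ((3 * d)%:R + e0) by rewrite powR_gt0// ltr0n.
rewrite rate_pow ler_pdivrMr// mulrAC ler_pdivlMr//.
apply: (@le_trans _ _ (c0 * 2 `^ ((3 * d)%:R + e0) * k%:R `^ ((3 * d)%:R + e0))); last first.
  by rewrite ler_pM2r// lerDr.
rewrite -mulrA ler_pM2l// -powRM//.
apply: ge0_ler_powR => //; rewrite ?nnegrE ?mulr_ge0//.
by rewrite -natrM ler_nat mul2n -addnn -addn1 leq_add2l.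
Qed.

(** ** The error event *)

Definition truncation_error (y : Om) : bool :=
  has (fun j => `[< ~ determined j K y >]) relevant.

Lemma truncation_error_prob :
  Ex q (fun y => (truncation_error y)%:R) <=
  (size relevant)%:R * (c0 / K%:R `^ ((3 * d)%:R + e0)).
Proof.
apply: (@le_trans _ _ (Ex q (fun y => \sum_(j <- relevant) (`[< ~ determined j K y >])%:R))).
  apply: ler_Ex; first exact: atom_ge0.
  move=> y; rewrite /truncation_error -natr_sum ler_nat.
  elim: (relevant) => [|j l IH]; first by rewrite big_nil.
  rewrite big_cons /=; case: asboolP => _ //=.
rewrite Ex_sum mulr_natl -[leRHS]iter_addr_0 -count_predT -big_const_seq.
rewrite big_seq [leRHS]big_seq; apply: ler_sum => j jr.
by apply: undetermined_prob_pos => //; rewrite K_gt0 leqnn.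
Qed.

Local Notation Y w := (restr window (X ^~ w)).

Lemma truncated_exact w j : ~~ truncation_error (Y w) -> j \in relevant ->
  truncated j (Y w) = t j w.
Proof.
move=> /hasPn ne jr; have := ne j jr => /asboolPn/contrapT det.
rewrite /truncated jr.
rewrite (det _ (X ^~ w)); last 2 first.
- by apply/ffunP => -[i ik]; rewrite !ffunE/= ik.
- by rewrite restr_extend.
by rewrite -t_h clamp_id.
Qed.

Lemma relevant_visited z p j : z \in Box -> p \in L ->
  j \in visited init carrier 0 p -> shift z j \in relevant.
Proof.
move=> zB pL jp; apply/flattenP.
exists (map (shift z) (visited init carrier 0 p)); last exact: map_f.
by apply/allpairsP; exists (z, p).
Qed.

Lemma truncated_cost w z p : ~~ truncation_error (Y w) -> z \in Box -> p \in L ->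
  cost init carrier (truncated ^~ (Y w) \o shift z) 0 p =
  cost init carrier (t ^~ w \o shift z) 0 p.
Proof.
move=> ne zB pL; rewrite /cost big_seq [RHS]big_seq; apply: eq_bigr => j jp /=.
by rewrite truncated_exact//; exact: relevant_visited jp.
Qed.

Lemma truncated_geodesic w z : ~~ truncation_error (Y w) -> z \in Box ->
  geodesic init carrier B x (truncated ^~ (Y w) \o shift z) =
  geodesic init carrier B x (t ^~ w \o shift z).
Proof.
move=> ne zB; apply: eq_in_argmin => p pL; exact: truncated_cost.
Qed.

Let b_ge0 : 0 <= b. Proof. exact: le_trans (ltW a_gt0) ab. Qed.

Lemma shifted_itv z w j : a <= (t ^~ w \o shift z) j <= b.
Proof. exact: t_itv. Qed.

Lemma truncated_passage_time w z : ~~ truncation_error (Y w) -> z \in Box ->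
  shifted_passage_time shift init carrier B x (truncated ^~ (Y w)) z =
  shifted_passage_time shift init carrier B x (t ^~ w) z.
Proof.
move=> ne zB; rewrite /shifted_passage_time truncated_geodesic// truncated_cost//.
have [gp gs _] := geodesic_spec init carrier a_gt0 b_ge0 B_gt0 b_le (shifted_itv z w) x.
by rewrite mem_short_paths gp.
Qed.

Local Notation geoY := (geo shift init carrier truncated B x).

Hypothesis err_eta : (size relevant)%:R * (c0 / K%:R `^ ((3 * d)%:R + e0)) <= eta.

Lemma geodesic_law z p :
  P [set w | geodesic init carrier B x (t ^~ w \o shift z) = p] =
  P [set w | geodesic init carrier B x (t ^~ w) = p].
Proof.
exact: (t_invariant z (@geodesic_product_measurable R d J init carrier B x p)).
Qed.

(** Outside the error event the truncated and the true geodesic coincide. *)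
Lemma geo_near_law z p : z \in Box ->
  (P [set w | geoY z (Y w) == p] <=
     P [set w | geodesic init carrier B x (t ^~ w) = p] + eta%:E)%E /\
  (P [set w | geodesic init carrier B x (t ^~ w) = p] <=
     P [set w | geoY z (Y w) == p] + eta%:E)%E.
Proof.
move=> zB; rewrite -(geodesic_law z).
set G1 := [set w | geoY z (Y w) == p].
set G2 := [set w | _ = p].
set Er := [set w | truncation_error (Y w)].
have mG1 : measurable G1 by exact: (measurable_restr iidX [set y | geoY z y == p]).
have mEr : measurable Er by exact: (measurable_restr iidX [set y | truncation_error y]).
have mG2 : measurable G2.
  by apply: geodesic_measurable => j /=; exact: mt.
have PEr : (P Er <= eta%:E)%E.
  rewrite /Er (prob_restr iidX i0 (W := window)) lee_fin.
  exact: le_trans truncation_error_prob err_eta.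
have union (A C : set Omega) : measurable A -> measurable C -> A `<=` C `|` Er ->
    (P A <= P C + eta%:E)%E.
  move=> mA mC AC; apply: (@le_trans _ _ (P (C `|` Er))).
    by apply: le_measure => //; rewrite inE//; exact: measurableU.
  apply: le_trans (measureU2 _ mC mEr) _; exact: leeD2l.
split; apply: union => // w.
  rewrite /G1/= => /eqP gw; have [er|ne] := boolP (truncation_error (Y w)); [by right|left].
  by rewrite /G2/= -truncated_geodesic.
rewrite /G2/= => gw; have [er|ne] := boolP (truncation_error (Y w)); [by right|left].
by rewrite /G1/= /geo truncated_geodesic// gw.
Qed.

(** Pass to the true model, where the law does not depend on [z], and back. *)
Lemma geo_invariant_truncated z p : z \in Box ->
  Ex q (fun y => (geoY z y == p)%:R) <= Ex q (fun y => (geoY 0 y == p)%:R) + 2 * eta.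
Proof.
move=> zB; have zB0 : 0 \in Box by apply: mem_cube; rewrite l1norm0.
have [h1 _] := geo_near_law p zB; have [_ h2] := geo_near_law p zB0.
have := le_trans h1 (leeD2r eta%:E h2).
rewrite (prob_restr iidX i0 (W := window) (fun y => geoY z y == p)).
rewrite (prob_restr iidX i0 (W := window) (fun y => geoY 0 y == p)) -!EFinD lee_fin.
lra.
Qed.

Variables (kappa : R).
Hypothesis kappa_gt0 : 0 < kappa.
Hypothesis q_atom : forall s, q s = 0 \/ kappa <= q s.
Hypothesis M_lower : (M ^ 12 <= l1norm x)%N.
Hypothesis M_root : (l1norm x < M.+1 ^ 12)%N.
Hypothesis eta_small : 2 * eta * ((size L).+1 * N.+1)%:R <= (M%:R ^+ 3)^-1.
Hypothesis eta_small2 : eta * (l1norm x).+1%:R ^+ 2 <= 1.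

Local Notation n := (l1norm x).
Local Notation F := (box_average shift init carrier truncated B x M).

Definition model_const : R :=
  variance_const d cA kappa lambda prob_const (1 + (e0 / d%:R)^-1) a b B.

Lemma truncated_variance : Var q F <= model_const * n%:R / ln n%:R.
Proof.
have r0 : 0 < e0 / d%:R by rewrite divr_gt0// ltr0n; apply: ltn_trans d_ge2.
apply: (@box_average_variance R d J pos at_pos cA mem_at_pos pos_at_pos size_at_pos
  shift init carrier size_init pos_init pos_carrier pos_shift window S q kappa
  (atom_ge0 P X i0) (atom_sum1 iidX i0) kappa_gt0 q_atom truncated inspected K lambda
  prob_const rate (1 + (e0 / d%:R)^-1) d_ge2 inspected_mono inspected_card
  inspected_disjoint truncated_undetermined_K prob_const_ge0 (decay_gt0 _)
  (decay_cube r0) (decay_sum r0) truncated_undetermined_prob a b B a_gt0 ab B_gt0 b_le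
  truncated_itv x M (2 * eta) x_ge2 M_gt0 M_root eta_small).
by move=> z p zB; exact: geo_invariant_truncated.
Qed.

Lemma shifted_passage_time_bounds (tau : J -> R) z : (forall j, a <= tau j <= b) ->
  0 <= shifted_passage_time shift init carrier B x tau z <= b * n.+1%:R.
Proof.
move=> tau_itv; have tz j : a <= (tau \o shift z) j <= b by exact: tau_itv.
have [gp gs gmin] := geodesic_spec init carrier a_gt0 b_ge0 B_gt0 b_le tz x.
apply/andP; split.
  apply: sumr_ge0 => j _; apply: le_trans (ltW a_gt0) _.
  by case/andP: (tz j).
have [p pp sp] := straight_path 0 x.
apply: le_trans (gmin _ pp) _; apply: le_trans (sum_le tz _) _.
rewrite ler_wpM2l// ler_nat; apply: leq_trans (size_visited _ size_init _ _) _.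
by rewrite sp /site_dist sub0r l1normN.
Qed.

Definition boundary_error : R := b * (2 * (d * M ^ 3) + 1)%:R.
Definition crude_error : R := b * n.+1%:R.

Lemma mean_near (u : Z -> R) (T c : R) :
  (forall z, z \in Box -> `|T - u z| <= c) ->
  `|T - (size Box)%:R^-1 * \sum_(z <- Box) u z| <= c.
Proof.
move=> Tu.
have B0 : 0 < (size Box)%:R :> R by rewrite ltr0n size_cube expn_gt0.
have mcst (e : R) : (size Box)%:R^-1 * \sum_(z <- Box) e = e.
  rewrite big_const_seq count_predT iter_addr_0 -(mulr_natl e) mulrA mulVf ?mul1r//.
  by rewrite gt_eqF.
rewrite -[X in X - _]mcst -mulrBr -sumrB normrM ger0_norm ?invr_ge0//.
rewrite -[leRHS]mcst ler_wpM2l ?invr_ge0//; apply: le_trans (ler_norm_sum _ _ _) _.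
by rewrite big_seq [leRHS]big_seq; apply: ler_sum.
Qed.

Lemma average_near w :
  `|shifted_passage_time shift init carrier B x (t ^~ w) 0 - F (Y w)| <=
  boundary_error + (truncation_error (Y w))%:R * crude_error.
Proof.
apply: mean_near => z zB.
have D10 : 0 <= boundary_error by rewrite mulr_ge0.
have D20 : 0 <= crude_error by rewrite mulr_ge0.
case: (boolP (truncation_error (Y w))) => [er|ne].
  have /andP[u0 u1] := shifted_passage_time_bounds 0 (t_itv^~ w).
  have /andP[v0 v1] := shifted_passage_time_bounds z (truncated_itv^~ (Y w)).
  rewrite ler_norml mul1r; rewrite -/crude_error in u1 v1; lra.
rewrite truncated_passage_time// mul0r addr0.
have zM : (site_dist 0 z <= d * M ^ 3)%N.
  by rewrite /site_dist sub0r l1normN; exact: cube_l1norm.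
have lip u v : (site_dist u v <= d * M ^ 3)%N ->
    shifted_passage_time shift init carrier B x (t ^~ w) u <=
    shifted_passage_time shift init carrier B x (t ^~ w) v + boundary_error.
  move=> uv; have := @shifted_passage_time_lip R d J shift init carrier size_init
    init_shift carrier_shift a b B a_gt0 b_ge0 B_gt0 b_le (t ^~ w) (t_itv^~ w) x u v.
  move=> /le_trans; apply.
  by rewrite lerD2l ler_wpM2l// ler_nat leq_add2r leq_mul2l.
have h1 := lip _ _ zM; have h2 := lip z 0; rewrite site_dist_sym in h2.
by have := h2 zM; rewrite ler_norml; lra.
Qed.

(** An upper bound for the squared deviation which depends on finitely many
    variables only, so that its mean is computed in the finite model. *)
Definition dominating (y : Om) : R :=
  4 * boundary_error ^+ 2 + 4 * crude_error ^+ 2 * (truncation_error y)%:R +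
  2 * (F y - Ex q F) ^+ 2.

Lemma dominating_ge w :
  (shifted_passage_time shift init carrier B x (t ^~ w) 0 - Ex q F) ^+ 2 <=
  dominating (Y w).
Proof.
have := average_near w; rewrite /dominating.
set T := shifted_passage_time _ _ _ _ _ _ _; set f := F (Y w); set m := Ex q F.
have D10 : 0 <= boundary_error by rewrite mulr_ge0.
have D20 : 0 <= crude_error by rewrite mulr_ge0.
set D1 := boundary_error in D10 *; set D2 := crude_error in D20 *.
set e : R := (truncation_error _)%:R.
have ee : e = e ^+ 2 by rewrite /e; case: truncation_error; rewrite ?expr0n ?expr1n.
move=> h1.
have h2 : (T - f) ^+ 2 <= (D1 + e * D2) ^+ 2.
  rewrite -[leLHS]ger0_norm ?sqr_ge0// normrX lerXn2r ?nnegrE//.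
  by rewrite addr_ge0// mulr_ge0.
have h3 : (T - m) ^+ 2 <= 2 * (T - f) ^+ 2 + 2 * (f - m) ^+ 2.
  rewrite -subr_ge0.
  have -> : 2 * (T - f) ^+ 2 + 2 * (f - m) ^+ 2 - (T - m) ^+ 2 = (T - f - (f - m)) ^+ 2.
    by ring.
  exact: sqr_ge0.
have h4 : (D1 + e * D2) ^+ 2 <= 2 * D1 ^+ 2 + 2 * D2 ^+ 2 * e.
  rewrite [X in _ <= _ + _ * X]ee -subr_ge0.
  have -> : 2 * D1 ^+ 2 + 2 * D2 ^+ 2 * e ^+ 2 - (D1 + e * D2) ^+ 2 = (D1 - e * D2) ^+ 2.
    by ring.
  exact: sqr_ge0.
lra.
Qed.

Definition transfer_const : R :=
  4 * (b * (2 * d).+1%:R) ^+ 2 * 12 + 4 * b ^+ 2 + 2 * model_const.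

Lemma Ex_dominating : Ex q dominating <= transfer_const * n%:R / ln n%:R.
Proof.
have q0 := atom_ge0 P X i0; have q1 := atom_sum1 iidX i0.
have n1 : 1 < n%:R :> R by rewrite (ltr_nat R 1).
have n0 : 0 < n%:R :> R by lra.
have lnn : 0 < ln n%:R :> R by exact: ln_gt0.
have -> : Ex q dominating = 4 * boundary_error ^+ 2 +
    4 * crude_error ^+ 2 * Ex q (fun y => (truncation_error y)%:R) + 2 * Var q F.
  by rewrite /Var /dominating; set m := Ex q F; rewrite ExD ExD Ex_cst// !ExZ.
have v := truncated_variance.
(* [M ^ 6 * ln n <= 12 * M ^ 7 <= 12 * M ^ 12 <= 12 * n] *)
have M6 : (M%:R ^+ 3) ^+ 2 <= 12 * (n%:R / ln n%:R) :> R.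
  rewrite mulrA ler_pdivlMr//.
  have lnM : ln n%:R <= 12 * M%:R :> R.
    have : ln n%:R <= ln (M.+1%:R ^+ 12) :> R.
      have Q0 : 0 < M.+1%:R ^+ 12 :> R by rewrite exprn_gt0 ?ltr0n.
      by rewrite ler_ln ?posrE// -natrX ler_nat ltnW.
    rewrite lnXn ?ltr0n// -(mulr_natl (ln _)) => /le_trans; apply.
    rewrite ler_pM2l// -natr1 addrC le_ln1Dx//.
    by apply: (@lt_le_trans _ _ 0) => //; rewrite ltrN10.
  have M1 : 1 <= M%:R :> R by rewrite ler1n.
  apply: (@le_trans _ _ ((M%:R ^+ 3) ^+ 2 * (12 * M%:R))).
    by rewrite ler_wpM2l// sqr_ge0.
  rewrite mulrCA ler_pM2l// -exprM -exprSr.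
  apply: (@le_trans _ _ (M%:R ^+ 12)); first by rewrite ler_weXn2l.
  by rewrite -natrX ler_nat.
have D1 : boundary_error ^+ 2 <= (b * (2 * d).+1%:R) ^+ 2 * (M%:R ^+ 3) ^+ 2.
  rewrite -exprMn lerXn2r ?nnegrE ?mulr_ge0//.
  rewrite /boundary_error -mulrA ler_wpM2l// -natrX -natrM ler_nat.
  by rewrite (mulSn (2 * d)) mulnA addnC leq_add2r expn_gt0 M_gt0.
have D2 : crude_error ^+ 2 * Ex q (fun y => (truncation_error y)%:R) <= b ^+ 2.
  rewrite /crude_error exprMn -mulrA ler_piMr ?sqr_ge0//.
  apply: le_trans eta_small2; rewrite mulrC ler_wpM2r ?sqr_ge0//.
  exact: le_trans truncation_error_prob err_eta.
have one : 1 <= n%:R / ln n%:R :> R.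
  by rewrite ler_pdivlMr// mul1r ltW// ln_sublinear.
have D1' := le_trans D1 (ler_wpM2l (sqr_ge0 _) M6).
have b1 : b ^+ 2 <= b ^+ 2 * (n%:R / ln n%:R).
  by rewrite -[leLHS]mulr1 ler_wpM2l// sqr_ge0.
rewrite -mulrA in v.
rewrite /transfer_const -[leRHS]mulrA.
move: D1' D2 b1 v; set y := n%:R / ln n%:R; set u := (b * _) ^+ 2.
set D := boundary_error ^+ 2; set c := model_const; set Er := Ex q _.
set V := Var q F => h1 h2 h3 h4; lra.
Qed.

Lemma passage_time_variance :
  ('V_P[fun w => passage_time init carrier (t ^~ w) 0 x] <=
   (transfer_const * n%:R / ln n%:R)%:E)%E.
Proof.
have -> : (fun w => passage_time init carrier (t ^~ w) 0 x) =
    (fun w => shifted_passage_time shift init carrier B x (t ^~ w) 0).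
  apply/funext => w.
  exact: (@passage_time_shifted0 R d J shift init carrier a b B a_gt0 b_ge0 B_gt0 b_le (t ^~ w)
    (t_itv^~ w) x shift0).
apply: (@le_trans _ _ (\int[P]_w (dominating (Y w))%:E)%E); last first.
  rewrite (integral_restr iidX i0) ?lee_fin; first exact: Ex_dominating.
  move=> y; apply: addr_ge0; last by rewrite mulr_ge0 ?sqr_ge0.
  apply: addr_ge0; first by rewrite mulr_ge0 ?sqr_ge0.
  by apply: mulr_ge0 => //; rewrite mulr_ge0 ?sqr_ge0.
apply: (@variance_le_integral _ _ _ P
  (fun w => shifted_passage_time shift init carrier B x (t ^~ w) 0)
  (fun w => dominating (Y w)) (Ex q F) (b * n.+1%:R)).
- have -> : (fun w => shifted_passage_time shift init carrier B x (t ^~ w) 0) =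
     (fun w => \sum_(p <- undup L) cost init carrier (t ^~ w \o shift 0) 0 p *
        \1_([set w | geodesic init carrier B x (t ^~ w \o shift 0) = p]) w).
    apply/funext => w; rewrite /shifted_passage_time.
    set g := geodesic _ _ _ _ _.
    have gL : g \in undup L.
      rewrite mem_undup mem_short_paths.
      have [-> gs _] := geodesic_spec init carrier a_gt0 b_ge0 B_gt0 b_le (shifted_itv 0 w) x.
      exact: gs.
    rewrite (bigD1_seq g)//= ?undup_uniq// indicE mem_set//= mulr1 big1 ?addr0// => p pg.
    by rewrite indicE memNset ?mulr0//= => e; rewrite /g e eqxx in pg.
  apply: measurable_sum => p; apply: measurable_funM.
    by apply: measurable_sum => j; exact: mt.
  by apply: measurable_indic; apply: geodesic_measurable => j; exact: mt.
- exact: (measurable_fun_restr iidX dominating).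
- move=> w; have /andP[u0 u1] := shifted_passage_time_bounds 0 (t_itv^~ w).
  by rewrite ger0_norm.
- exact: dominating_ge.
Qed.

End FixedTarget.

(** The bound is uniform in the endpoint: the truncation level is chosen last,
    after the finite lists of paths and carriers. *)
Theorem passage_time_variance_bound : exists C : R, 0 < C /\
  forall x : Z, (2 <= l1norm x)%N ->
    ('V_P[fun w => passage_time init carrier (t ^~ w) 0 x]
     <= (C * (l1norm x)%:R / ln (l1norm x)%:R)%:E)%E.
Proof.
have [kappa kappa0 qk] := atom_lower P X i0.
exists (`|transfer_const kappa| + 1); split; first by rewrite ltr_wpDl.
move=> x x2; set n := l1norm x.
have [M M0 /andP[Mn nM]] := ex_root12 (ltnW x2).
pose L := short_paths (path_bound B x) x.
pose D : nat := (2 * ((size L).+1 * (path_bound B x).+1) * M ^ 3 * n.+1 ^ 2)%N.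
have D0 : (0 < D)%N by rewrite /D !muln_gt0 ?expn_gt0 ?M0.
pose eta : R := D%:R^-1.
have eta0 : 0 < eta by rewrite invr_gt0 ltr0n.
pose r := relevant x M.
pose K := (Num.truncn ((size r)%:R * c0 / eta)).+1.
have lnn : 0 < ln n%:R :> R by apply: ln_gt0; rewrite (ltr_nat R 1).
have err : (size r)%:R * (c0 / K%:R `^ ((3 * d)%:R + e0)) <= eta.
  have K0 : 0 < K%:R :> R by rewrite ltr0n.
  have Ke : K%:R <= K%:R `^ ((3 * d)%:R + e0) :> R.
    apply: le1r_powR; first by rewrite ler1n.
    apply: (@le_trans _ _ (3 * d)%:R); last by rewrite lerDl ltW.
    by rewrite ler1n muln_gt0/=; apply: ltn_trans d_ge2.
  rewrite mulrA ler_pdivrMr ?powR_gt0//.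
  apply: (@le_trans _ _ (eta * K%:R)); last by rewrite ler_pM2l.
  by rewrite [leRHS]mulrC -ler_pdivrMr//; exact/ltW/truncnS_gt.
have D1 : 2 * eta * ((size L).+1 * (path_bound B x).+1)%:R <= (M%:R ^+ 3)^-1.
  rewrite mulrAC -natrM -[leRHS]mul1r ler_pdivlMr ?exprn_gt0 ?ltr0n//.
  rewrite mulrAC -natrX -natrM ler_pdivrMr ?ltr0n// mul1r ler_nat.
  by rewrite /D leq_pmulr// expn_gt0.
have D2 : eta * n.+1%:R ^+ 2 <= 1.
  rewrite mulrC -natrX ler_pdivrMr ?ltr0n// mul1r ler_nat /D leq_pmull//.
  by rewrite !muln_gt0 ?expn_gt0 ?M0.
apply: le_trans (@passage_time_variance x M K eta x2 M0 isT err kappa kappa0 qk Mn nM D1 D2) _.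
rewrite lee_fin -!mulrA ler_wpM2r ?divr_ge0 ?(ltW lnn)//.
by apply: le_trans (ler_norm _) _; rewrite lerDl.
Qed.

End Transfer.

(** * The two versions of the model *)

Section Representation.
Context {disp : measure_display} {Omega : measurableType disp} {R : realType}.
Variable P : probability Omega R.
Variables (d : nat) (J : eqType).
Local Notation Z := 'rV[int]_d.
Variables (pos : J -> Z) (at_pos : Z -> seq J) (cA : nat).
Hypothesis mem_at_pos : forall j, j \in at_pos (pos j).
Hypothesis pos_at_pos : forall v j, j \in at_pos v -> pos j = v.
Hypothesis size_at_pos : forall v, (size (at_pos v) <= cA)%N.
Variables (dist : J -> J -> nat) (shift : Z -> J -> J).
Variables (init : Z -> seq J) (carrier : edge d * Z -> J).
Hypothesis size_init : forall v, (size (init v) <= 1)%N.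
Hypothesis pos_init : forall v j, j \in init v -> pos j = v.
Hypothesis pos_carrier : forall e v u, joins e v u ->
  (site_dist (pos (carrier (e, u))) u <= 1)%N.
Hypothesis pos_dist : forall j j', (site_dist (pos j) (pos j') <= dist j j' + 2)%N.
Hypothesis pos_shift : forall z j, pos (shift z j) = pos j + z.
Hypothesis init_shift : forall z v, init (v + z) = map (shift z) (init v).
Hypothesis carrier_shift : forall z s,
  carrier (step_shift z s) = shift z (carrier s).
Hypothesis shift0 : forall j, shift 0 j = j.

(** The discrepancy of [2] between the distance of two edges and that of their
    sources is absorbed into the separation constant. *)
Lemma represented_variance_bound (a b : R) (t : J -> {RV P >-> R}) :
  (2 <= d)%N -> 0 < a -> a < b -> (forall j w, a <= t j w <= b) ->
  has_representation P dist shift t ->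
  exists C : R, 0 < C /\ forall x : Z, (2 <= l1norm x)%N ->
    ('V_P[fun w => passage_time init carrier (fun j => t j w) 0 x]
     <= (C * (l1norm x)%:R / ln (l1norm x)%:R)%:E)%E.
Proof.
move=> d2 a0 ab tab [[S [I [X [h [idx [infI iidX [_ th] [c0 [e0 [c00 e00 undet]]]
  [alpha [alpha0 sep]]]]]]]] tinv].
have [i0 _] := infinite_setN0 infI.
pose B := (Num.truncn (b / a)).+1.
have bB : b <= B%:R * a.
  by rewrite -ler_pdivrMr//; exact/ltW/truncnS_gt.
pose lambda := (Num.truncn alpha^-1).+1.
have la : 1 < lambda%:R * alpha by rewrite -ltr_pdivrMr// div1r; exact: truncnS_gt.
have mt j : measurable_fun setT (t j) by [].
apply: (@passage_time_variance_bound _ _ _ P d J pos at_pos cA mem_at_pos pos_at_pos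
  size_at_pos shift init carrier size_init pos_init pos_carrier pos_shift init_shift
  carrier_shift shift0 a b B a0 (ltW ab) isT bB (fun j => t j) mt tab S I X h idx c0 e0
  (lambda + 2) d2 iidX th c00 e00 undet _ tinv i0 point) => j j' k k0 far.
apply: sep => //.
have far' : (lambda * k < dist j j')%N.
  have := leq_trans far (pos_dist j j'); rewrite mulnDl; move: (lambda * k)%N => u.
  by move: k0; clear; lia.
apply: (@le_lt_trans _ _ (alpha * (lambda * k)%:R)); last by rewrite ltr_pM2l// ltr_nat.
by rewrite natrM mulrA [alpha * _]mulrC ler_peMl// ltW.
Qed.

End Representation.

Theorem theorem1p6 (R : realType) (disp : measure_display)
    (Omega : measurableType disp) (P : probability Omega R)
    (d : nat) (a b : R) (hd : (2 <= d)%N) (ha : 0 < a) (hab : a < b) :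
  (forall t : 'rV[int]_d -> {RV P >-> R},
     (forall v w, a <= t v w <= b) ->
     has_representation P (@site_dist d) (@site_shift d) t ->
     exists C : R, 0 < C /\
       forall v : 'rV[int]_d, (2 <= l1norm v)%N ->
         ('V_P[fun w => site_passage_time (fun u => t u w) 0 v]
          <= (C * (l1norm v)%:R / ln (l1norm v)%:R)%:E)%E) /\
  (forall t : edge d -> {RV P >-> R},
     (forall e w, a <= t e w <= b) ->
     has_representation P (@edge_dist d) (@edge_shift d) t ->
     exists C : R, 0 < C /\
       forall v : 'rV[int]_d, (2 <= l1norm v)%N ->
         ('V_P[fun w => bond_passage_time (fun e => t e w) 0 v]
          <= (C * (l1norm v)%:R / ln (l1norm v)%:R)%:E)%E).
Proof.
split=> t tab rep.
- apply: (@represented_variance_bound _ _ R P d _ id (fun v => [:: v]) 1 _ _ _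
    (@site_dist d) (@site_shift d) (fun v => [:: v]) snd _ _ _ _ _ _ _ _ a b t) => //.
  + by move=> v; rewrite inE.
  + by move=> v j; rewrite inE => /eqP.
  + by move=> v j; rewrite inE => /eqP.
  + by move=> e v u _; rewrite site_distvv.
  + by move=> v w; exact: leq_addr.
  + by move=> v; rewrite /site_shift addr0.
- apply: (@represented_variance_bound _ _ R P d _ fst
    (fun v => [seq (v, i) | i <- enum 'I_d]) d _ _ _
    (@edge_dist d) (@edge_shift d) (fun=> [::]) fst _ _ _ _ _ _ _ _ a b t) => //.
  + by move=> [v i]; apply/mapP; exists i; rewrite ?mem_enum.
  + by move=> v j /mapP[i _ ->].
  + by move=> v; rewrite size_map -cardE card_ord.
  + move=> e v u evu; have vu := joins_dist evu; move: evu.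
    rewrite /joins /edge_src => /orP[] /andP[/eqP -> _]; first by rewrite vu.
    by rewrite site_distvv.
  + move=> e f; have step (g : edge d) : site_dist g.1 (edge_tgt g) = 1%N.
      by apply: (@joins_dist _ g); rewrite /joins /edge_src !eqxx.
    have h1 := site_dist_triangle e.1 (edge_tgt e) f.1.
    have h2 := site_dist_triangle e.1 (edge_tgt f) f.1.
    have h3 := site_dist_triangle (edge_tgt e) (edge_tgt f) f.1.
    rewrite (site_dist_sym (edge_tgt f)) step in h2 h3; rewrite step in h1.
    rewrite /edge_dist /edge_src.
    move: h1 h2 h3.
    move: (site_dist e.1 f.1) (site_dist e.1 (edge_tgt f)) (site_dist (edge_tgt e) f.1)
      (site_dist (edge_tgt e) (edge_tgt f)); clear; lia.
  + by move=> [v i]; rewrite /edge_shift addr0.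
Qed.
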